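(* Let $\Omega=B_1(0)\subseteq\mathbb{R}^d$, $d\geq2$, and let $\alpha\to\infty$ in a sector of the form $T_\phi^-$ for any $0<\phi<\pi/2$. Then there are infinitely many eigenvalues $\lambda(\alpha)$ of the Robin Laplacian $-\Delta_\Omega^\alpha$ such that $$\lambda(\alpha)=-\alpha^2+\alpha(d-1)+\mathcal{O}(1)$$ as $\alpha\to\infty$ in $T_\phi^-$.
   Context: The Robin Laplacian $-\Delta_\Omega^\alpha$ is the Laplacian on $L^2(\Omega)$ with boundary condition $\frac{\partial u}{\partial\nu}+\alpha u=0$ on $\partial\Omega$, $\nu$ the outer unit normal, $\alpha\in\mathbb{C}$ (the operator associated with the form $\int_\Omega\nabla u\cdot\overline{\nabla v}\,\mathrm{d}x+\int_{\partial\Omega}\alpha u\overline v\,\mathrm{d}\sigma$ on $H^1(\Omega)$). $T_\phi^-:=-\{z\in\mathbb{C}:|\arg z|<\phi\}$. Eigenvalues are considered as families (curves) $\lambda(\alpha)$ depending on $\alpha$. *)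

(* Defs.v *)
From HB Require Import structures.
From mathcomp Require Import all_boot all_order all_algebra.
From mathcomp Require Import complex.
From mathcomp Require Import all_classical all_reals all_analysis.
From mathcomp Require Import measurable_realfun.

Set Implicit Arguments.
Unset Strict Implicit.
Unset Printing Implicit Defensive.

Import Order.TTheory GRing.Theory Num.Theory.
Import numFieldNormedType.Exports.
Import Normc.

Local Open Scope classical_set_scope.
Local Open Scope ring_scope.
Local Open Scope complex_scope.

(* The usual topology of the complex plane: that of the modulus. *)
HB.instance Definition _ (R : realType) := NormedModule.copy R[i] R[i]^o.

Section rV_measurable.
Context {R : realType} (n : nat).

Let coord (i : 'I_n) (x : 'rV[R]_n) : measurableTypeR R := x ord0 i.

Let rV_set0 : g_sigma_preimage coord set0.
Proof. exact: sigma_algebra0. Qed.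

Let rV_setC A : g_sigma_preimage coord A -> g_sigma_preimage coord (~` A).
Proof. exact: sigma_algebraC. Qed.

Let rV_bigcup (F : (set 'rV[R]_n)^nat) :
  (forall k, g_sigma_preimage coord (F k)) ->
  g_sigma_preimage coord (\bigcup_k F k).
Proof. exact: sigma_algebra_bigcup. Qed.

(* The sigma-algebra on R^n generated by the coordinates, as for n.-tuple R. *)
HB.instance Definition _ := @isMeasurable.Build default_measure_display
  'rV[R]_n (g_sigma_preimage coord) rV_set0 rV_setC rV_bigcup.

Lemma measurable_coord (i : 'I_n) :
  measurable_fun [set: 'rV[R]_n] (fun x : 'rV[R]_n => x ord0 i).
Proof.
move=> _ Y mY; rewrite setTI; apply: sub_sigma_algebra => /=.
rewrite -bigcup_seq/=; exists i => /=; first by rewrite mem_index_enum.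
by exists Y => //; rewrite setTI.
Qed.

Lemma measurable_rV d (T : measurableType d) (f : T -> 'rV[R]_n) :
  (forall i, measurable_fun [set: T] (fun x => f x ord0 i)) ->
  measurable_fun [set: T] f.
Proof.
move=> mf.
suff : g_sigma_preimage (fun i => coord i \o f) `<=` measurable.
  by rewrite g_sigma_preimage_comp => H _ A mA; apply: H; exists A.
apply: smallest_sub; first exact: sigma_algebra_measurable.
rewrite -bigcup_seq; apply: bigcup_sub => i _ A [B mB <-].
exact: (mf i measurableT).
Qed.

End rV_measurable.

(* Lebesgue measure on R^n, built by iterated products. *)

Definition rVcons {R : realType} n (p : measurableTypeR R * 'rV[R]_n) :
  'rV[R]_n.+1 :=
  \row_i (if unlift ord0 i is Some j then p.2 ord0 j else p.1).

Fixpoint lebesgue_rV {R : realType} (n : nat) : set 'rV[R]_n -> \bar R :=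
  match n return set 'rV[R]_n -> \bar R with
  | 0 => dirac (0 : 'rV[R]_0)
  | m.+1 => pushforward (lebesgue_measure \x @lebesgue_rV R m)%E (@rVcons R m)
  end.

Section lebesgue_rV_measure.
Context {R : realType}.

Let rVuncons n (x : 'rV[R]_n.+1) : measurableTypeR R * 'rV[R]_n :=
  (x ord0 ord0, \row_i x ord0 (lift ord0 i)).

Let rVconsE0 n p : @rVcons R n p ord0 ord0 = p.1.
Proof.
by rewrite mxE unlift_none.
Qed.

Let rVconsES n p i : @rVcons R n p ord0 (lift ord0 i) = p.2 ord0 i.
Proof.
by rewrite mxE liftK.
Qed.

Let rVconsK n : cancel (@rVcons R n) (@rVuncons n).
Proof.
move=> [a x]; rewrite /rVuncons rVconsE0; congr (_, _).
by apply/rowP => i; rewrite mxE rVconsES.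
Qed.

Let measurable_rVcons n : measurable_fun setT (@rVcons R n).
Proof.
apply: measurable_rV => i; case: (unliftP ord0 i) => [j ->|->].
  under eq_fun do rewrite rVconsES.
  exact: (measurableT_comp (measurable_coord j) measurable_snd).
under eq_fun do rewrite rVconsE0.
exact: measurable_fst.
Qed.

Let measurable_rVuncons n : measurable_fun setT (@rVuncons n).
Proof.
apply/measurable_fun_pairP; split => /=; first exact: measurable_coord.
apply: measurable_rV => i; rewrite /comp /=.
by under eq_fun do rewrite mxE; exact: measurable_coord.
Qed.

Let sigma_finite_measure_pack d (T : measurableType d) (mu : set T -> \bar R) :
    mu set0 = 0%E -> (forall A, 0 <= mu A)%E -> semi_sigma_additive mu ->
    sigma_finite setT mu ->
  {m : {sigma_finite_measure set T -> \bar R} | mu = m}.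
Proof.
move=> mu0 mu_ge0 mu_sadd mu_sfin.
pose M := isMeasure.Build _ _ _ mu mu0 mu_ge0 mu_sadd.
pose mum := HB.pack_for {measure set T -> \bar R} mu M.
pose S := Measure_isSigmaFinite.Build _ _ _ (Measure.sort mum) mu_sfin.
by exists (HB.pack_for {sigma_finite_measure set T -> \bar R} mu M S).
Qed.

Let lebesgue_rV_pack n :
  {m : {sigma_finite_measure set 'rV[R]_n -> \bar R} | @lebesgue_rV R n = m}.
Proof.
elim: n => [|n [m mE]]; first by exists (dirac (0 : 'rV[R]_0)).
pose nu : {measure set (measurableTypeR R * 'rV[R]_n)%type -> \bar R} :=
  (lebesgue_measure \x m)%E.
pose mu := pushforward nu (@rVcons R n).
have mf := @measurable_rVcons n.
pose f : {mfun _ >-> _} :=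
  MeasurableFun.Pack (MeasurableFun.Class (isMeasurableFun.Build _ _ _ _ _ mf)).
have mu0 : mu set0 = 0%E by rewrite /mu /pushforward preimage_set0 measure0.
have mu_ge0 A : (0 <= mu A)%E by exact: measure_ge0.
have mu_sadd : semi_sigma_additive mu.
  exact: (@measure_semi_sigma_additive _ _ _
    (pushforward nu f)).
have mu_sfin : sigma_finite setT mu.
  have /sigma_finiteP[F [FT ndF Foo]] := sigma_finiteT (@lebesgue_measure R).
  have /sigma_finiteP[G [GT ndG Goo]] := sigma_finiteT m.
  exists (fun k => @rVuncons n @^-1` (F k `*` G k)).
    apply/esym; rewrite -subTset => x _.
    have [i _ Fi] : (\bigcup_k F k) (rVuncons x).1 by rewrite -FT.
    have [j _ Gj] : (\bigcup_k G k) (rVuncons x).2 by rewrite -GT.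
    exists (maxn i j) => //; split.
      by move: Fi; exact/subsetPset/ndF/leq_maxl.
    by move: Gj; exact/subsetPset/ndG/leq_maxr.
  move=> k; have [mFk Fk] := Foo k; have [mGk Gk] := Goo k.
  have mFG : measurable (F k `*` G k) by exact: measurableX.
  split; first by rewrite -[X in measurable X]setTI; exact: measurable_rVuncons.
  rewrite /mu /pushforward -comp_preimage.
  rewrite (_ : _ \o _ = id) ?preimage_id; last first.
    by apply/funext => x; exact: rVconsK.
  by rewrite /nu/= product_measure1E// lte_mul_pinfty// ge0_fin_numE.
have [mus musE] := sigma_finite_measure_pack mu0 mu_ge0 mu_sadd mu_sfin.
by exists mus; rewrite -musE /mu /= mE.
Qed.

Variable n : nat.

Let lebesgue_rV0 : @lebesgue_rV R n set0 = 0%E.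
Proof. by have [m ->] := lebesgue_rV_pack n; exact: measure0. Qed.

Let lebesgue_rV_ge0 A : (0 <= @lebesgue_rV R n A)%E.
Proof. by have [m ->] := lebesgue_rV_pack n; exact: measure_ge0. Qed.

Let lebesgue_rV_sigma_additive : semi_sigma_additive (@lebesgue_rV R n).
Proof.
by have [m ->] := lebesgue_rV_pack n; exact: measure_semi_sigma_additive.
Qed.

Let lebesgue_rV_sigma_finite : sigma_finite setT (@lebesgue_rV R n).
Proof. by have [m ->] := lebesgue_rV_pack n; exact: sigma_finiteT. Qed.

HB.instance Definition _ := isMeasure.Build _ _ _ (@lebesgue_rV R n)
  lebesgue_rV0 lebesgue_rV_ge0 lebesgue_rV_sigma_additive.

HB.instance Definition _ := Measure_isSigmaFinite.Build _ _ _
  (@lebesgue_rV R n) lebesgue_rV_sigma_finite.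

End lebesgue_rV_measure.

Section ball.
Context {R : realType}.

Definition enorm n (x : 'rV[R]_n) : R := Num.sqrt (\sum_(i < n) x ord0 i ^+ 2).

Definition unit_ball n : set 'rV[R]_n := [set x | enorm x < 1].

Definition unit_sphere n : set 'rV[R]_n := [set x | enorm x = 1].

Definition radial_proj n (x : 'rV[R]_n) : 'rV[R]_n := (enorm x)^-1 *: x.

Lemma measurable_enorm n : measurable_fun [set: 'rV[R]_n] (@enorm n).
Proof.
have msqrt : measurable_fun [set: R] (Num.sqrt : R -> R).
  by apply: continuous_measurable_fun; exact: sqrt_continuous.
apply: (measurableT_comp msqrt); apply: measurable_sum => i.
by apply: measurable_funX; exact: measurable_coord.
Qed.

Lemma measurable_unit_ball n : measurable (@unit_ball n).
Proof.
have -> : @unit_ball n = @enorm n @^-1` `]-oo, 1[.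
  by apply/seteqP; split => x /=; rewrite in_itv.
by rewrite -[X in measurable X]setTI; exact: measurable_enorm.
Qed.

Let measurable_inv : measurable_fun [set: R] (fun r : R => r^-1).
Proof.
rewrite -(setvU [set 0 : R]); apply/measurable_funU => //.
  exact: measurableC.
split; last exact: measurable_fun_set1.
apply: open_continuous_measurable_fun.
  apply/closed_openC/accessible_closed_set1.
  exact/hausdorff_accessible/Rhausdorff.
by move=> x; rewrite inE/= => /eqP x0; exact: inv_continuous.
Qed.

Lemma measurable_radial_proj n :
  measurable_fun [set: 'rV[R]_n] (@radial_proj n).
Proof.
apply: measurable_rV => i.
under eq_fun do rewrite mxE.
apply: measurable_funM; last exact: measurable_coord.
by apply: (measurableT_comp measurable_inv); exact: measurable_enorm.
Qed.

(* The surface measure of the unit sphere of R^n: n times the Lebesgue measure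
   of the cone {r w | 0 < r < 1, w \in A} over a subset A of the sphere. It is a
   measure on R^n that does not charge the complement of the sphere (n > 0):
   radial_proj maps only 0 outside of the sphere. *)
Definition sphere_measure n : set 'rV[R]_n -> \bar R :=
  pushforward (mscale (n%:R)%:nng (mrestr (@lebesgue_rV R n)
    (@measurable_unit_ball n))) (@radial_proj n).

Let sphere_measure0 n : @sphere_measure n set0 = 0%E.
Proof. by rewrite /sphere_measure /pushforward preimage_set0 measure0. Qed.

Let sphere_measure_ge0 n A : (0 <= @sphere_measure n A)%E.
Proof. by rewrite /sphere_measure /pushforward; exact: measure_ge0. Qed.

Let sphere_measure_sigma_additive n : semi_sigma_additive (@sphere_measure n).
Proof.
have mf := @measurable_radial_proj n.
pose f : {mfun _ >-> _} :=
  MeasurableFun.Pack (MeasurableFun.Class (isMeasurableFun.Build _ _ _ _ _ mf)).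
exact: (@measure_semi_sigma_additive _ _ _ (pushforward _ f)).
Qed.

HB.instance Definition _ n := isMeasure.Build _ _ _ (@sphere_measure n)
  (@sphere_measure0 n) (@sphere_measure_ge0 n)
  (@sphere_measure_sigma_additive n).

End ball.

Section sobolev.
Context {R : realType} (d : nat).

Definition partial (i : 'I_d) (f : 'rV[R]_d -> R) : 'rV[R]_d -> R :=
  fun x => 'D_(delta_mx ord0 i) f x.

Fixpoint Ck (k : nat) (f : 'rV[R]_d -> R) : Prop :=
  match k with
  | 0 => continuous f
  | j.+1 => continuous f /\ forall i : 'I_d,
      (forall x, derivable f x (delta_mx ord0 i)) /\ Ck j (partial i f)
  end.

Definition smooth (f : 'rV[R]_d -> R) : Prop := forall k, Ck k f.

Definition test_function (Om : set 'rV[R]_d) (phi : 'rV[R]_d -> R) : Prop :=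
  smooth phi /\
  exists K, [/\ compact K, K `<=` Om & forall x, ~ K x -> phi x = 0].

(* Functions of class C^1 on the whole of R^d. *)
Definition C1_complex (w : 'rV[R]_d -> R[i]) : Prop :=
  Ck 1 (fun x => complex.Re (w x)) /\ Ck 1 (fun x => complex.Im (w x)).

Definition cpartial (i : 'I_d) (w : 'rV[R]_d -> R[i]) : 'rV[R]_d -> R[i] :=
  fun x => partial i (fun y => complex.Re (w y)) x
           +i* partial i (fun y => complex.Im (w y)) x.

Definition cintegral (mu : {measure set 'rV[R]_d -> \bar R})
    (D : set 'rV[R]_d) (f : 'rV[R]_d -> R[i]) : R[i] :=
  (\int[mu]_(x in D) complex.Re (f x)) +i* (\int[mu]_(x in D) complex.Im (f x)).

Definition L2_norm_sq (mu : {measure set 'rV[R]_d -> \bar R})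
    (D : set 'rV[R]_d) (f : 'rV[R]_d -> R[i]) : \bar R :=
  (\int[mu]_(x in D) ((normc (f x)) ^+ 2)%:E)%E.

Definition L2 (mu : {measure set 'rV[R]_d -> \bar R})
    (D : set 'rV[R]_d) (f : 'rV[R]_d -> R[i]) : Prop :=
  [/\ measurable_fun D (fun x => complex.Re (f x)),
      measurable_fun D (fun x => complex.Im (f x)) &
      (L2_norm_sq mu D f < +oo)%E].

Definition L2_cvg (mu : {measure set 'rV[R]_d -> \bar R})
    (D : set 'rV[R]_d) (w : nat -> 'rV[R]_d -> R[i])
    (f : 'rV[R]_d -> R[i]) : Prop :=
  L2_norm_sq mu D (fun x => w n x - f x) @[n --> \oo] --> 0%E.

Local Notation leb := (@lebesgue_rV R d).

(* u is in H^1(Om) and g is its weak gradient. *)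
Definition H1 (Om : set 'rV[R]_d) (u : 'rV[R]_d -> R[i])
    (g : 'I_d -> 'rV[R]_d -> R[i]) : Prop :=
  [/\ L2 leb Om u,
      forall i, L2 leb Om (g i) &
      forall phi i, test_function Om phi ->
        cintegral leb Om (fun x => u x * (partial i phi x)%:C) =
        - cintegral leb Om (fun x => g i x * (phi x)%:C)].

Variables (Om bd : set 'rV[R]_d) (sigma : {measure set 'rV[R]_d -> \bar R}).

(* t is the trace on the boundary bd, with surface measure sigma, of the
   function u of H^1(Om) with weak gradient g: the trace operator is the
   continuous extension of the restriction of C^1 functions to bd. *)
Definition trace (u : 'rV[R]_d -> R[i]) (g : 'I_d -> 'rV[R]_d -> R[i])
    (t : 'rV[R]_d -> R[i]) : Prop :=
  L2 sigma bd t /\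
  exists w : nat -> 'rV[R]_d -> R[i],
    [/\ forall n, C1_complex (w n),
        L2_cvg leb Om w u,
        forall i, L2_cvg leb Om (fun n => cpartial i (w n)) (g i) &
        L2_cvg sigma bd w t].

(* The Robin form at (u, v), where u and v have gradients g and h and traces t
   and s. *)
Definition robin_form (alpha : R[i])
    (g : 'I_d -> 'rV[R]_d -> R[i]) (t : 'rV[R]_d -> R[i])
    (h : 'I_d -> 'rV[R]_d -> R[i]) (s : 'rV[R]_d -> R[i]) : R[i] :=
  cintegral leb Om (fun x => \sum_(i < d) g i x * (h i x)^*)
  + cintegral sigma bd (fun x => alpha * t x * (s x)^*).

(* The graph of the operator associated with the form: u is in the domain of the
   Robin Laplacian, which maps u to f. On a bounded Lipschitz domain every
   function of H^1(Om) has exactly one trace, so v ranges over all of H^1(Om). *)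
Definition robin_laplacian (alpha : R[i]) (u f : 'rV[R]_d -> R[i]) : Prop :=
  L2 leb Om f /\
  exists g t, [/\ H1 Om u g, trace u g t &
    forall v h s, H1 Om v h -> trace v h s ->
      robin_form alpha g t h s = cintegral leb Om (fun x => f x * (v x)^*)].

Definition robin_eigenvalue (alpha lambda : R[i]) : Prop :=
  exists u, ~ {ae leb, forall x, Om x -> u x = 0} /\
    robin_laplacian alpha u (fun x => lambda * u x).

End sobolev.

Section sector.
Context {R : realType}.

(* - {z | |arg z| < phi} *)
Definition neg_sector (phi : R) : set R[i] :=
  [set z | exists r theta : R, [/\ 0 < r, `|theta| < phi &
    z = - ((r * cos theta) +i* (r * sin theta))]].

(* The filter "alpha tends to infinity in neg_sector phi" *)
Definition sector_infty (phi : R) : set_system R[i] :=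
  [set P | exists rho : R, forall alpha,
    neg_sector phi alpha -> rho < normc alpha -> P alpha].

Lemma sector_infty_filter phi : Filter (sector_infty phi).
Proof.
split; first by exists 0.
- move=> P Q [r1 H1] [r2 H2]; exists (Num.max r1 r2) => a sa.
  by rewrite gt_max => /andP[? ?]; split; [exact: H1|exact: H2].
- by move=> P Q PQ [r H]; exists r => a sa ra; exact/PQ/H.
Qed.

Canonical sector_infty_filter_on phi :=
  FilterType (sector_infty phi) (sector_infty_filter phi).

End sector.

(* Main.v *)
(* Take u(x) = Y(x)^l F(w |x|^2) with Y(x) = x_1 + i x_2, whose gradient is an
   isotropic vector, and with F the entire solution of 4 y F'' + 2 (2 l + d) F' = F,
   F(0) = 1.  Then Laplacian u = w u; with w = z^2, the function u is a Robin
   eigenfunction for -z^2 as soon as l + q(z) + alpha = 0, where q(z) is the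
   logarithmic derivative at r = 1 of f(r) = F(z^2 r^2).

   The function f is a radial Bessel function: f'' + (n / r) f' = z^2 f with
   n = 2 l + d - 1.  The energy r^n Re(z^* f' f^* ) increases, so zeta = (f' - z f) /
   (f' + z f) is bounded by 1 when Re z > 0; as zeta solves a Riccati equation that
   contracts at rate Re z, its formal expansion is a true one, and
   q(z) = z - n / 2 + n (n - 2) / (8 z) + O(|z|^-2) in every sector
   |z| <= C Re z.  The error q(z) - z + n / 2 has a small Lipschitz constant, hence
   z = - alpha + (d - 1) / 2 - (q(z) - z + n / 2) has a solution z(alpha) by
   contraction, and -z(alpha)^2 has the announced expansion.  Different values of l
   give different coefficients n (n - 2) / 8, thus eventually different curves.

   That u is a weak eigenfunction follows from the divergence theorem on the ball.
   The latter reduces to the vanishing of the integral of a derivative with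
   compact support: multiply by cutoffs (1 - |x|^(2k))_+^2 and let k tend to
   infinity; the boundary term is computed by differentiating, in the dilation
   parameter, the integral of a 0-homogeneous function times a radial one. *)
Require Import Defs.
From mathcomp Require Import all_boot all_order all_algebra.
From mathcomp Require Import complex.
From mathcomp Require Import all_classical all_reals all_analysis.
From mathcomp Require Import measurable_realfun.
From mathcomp Require Import ring lra.

Set Implicit Arguments.
Unset Strict Implicit.
Unset Printing Implicit Defensive.

Import Order.TTheory GRing.Theory Num.Theory.
Import numFieldNormedType.Exports.
Import Normc.

Local Open Scope classical_set_scope.
Local Open Scope ring_scope.
Local Open Scope complex_scope.

(** * Directional derivatives and continuity *)

(** Three points shape the proof. First, the surface measure is defined by cones, so an integral
    over the sphere is really an integral over the ball of a 0-homogeneous function. The boundary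
    term of the divergence theorem must be produced in that form, which the dilation identity does.
    The derivatives of the cutoffs blow up at the sphere, so the limit is taken only after
    subtracting that identity: what multiplies them is then [O(1 - |x|^2)] and compensates the
    growth. Second, since [n / 2 - l = (d - 1) / 2], the terms of order [z] and [1] in the
    eigenvalue equation do not depend on [l]. The curves can be separated only at order [1 / z],
    hence two terms in the expansion of [zeta]. The small Lipschitz constant comes from a Riccati
    equation of [q] in the variable [z], which bounds the derivative by the function itself. Third,
    [u] is [C^1] on the whole space, so it is its own trace, and general test functions enter
    through the [C^1] sequences that the definition of the trace provides. *)

Section derive_rules.
Context {R : realType} {V : normedModType R}.
Implicit Types (f g : V -> R) (x v : V) (df dg : R).

Lemma der_eq f x v df dg : is_derive x v f df -> df = dg -> is_derive x v f dg.
Proof. by move=> H <-. Qed.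

Lemma der_cst x v (c : R) : is_derive x v (fun=> c) 0.
Proof. exact: is_derive_cst. Qed.

Lemma der_D f g x v df dg : is_derive x v f df -> is_derive x v g dg ->
  is_derive x v (fun y => f y + g y) (df + dg).
Proof. by move=> *; exact: is_deriveD. Qed.

Lemma der_N f x v df : is_derive x v f df -> is_derive x v (fun y => - f y) (- df).
Proof. by move=> *; exact: is_deriveN. Qed.

Lemma der_B f g x v df dg : is_derive x v f df -> is_derive x v g dg ->
  is_derive x v (fun y => f y - g y) (df - dg).
Proof. by move=> *; exact: is_deriveB. Qed.

Lemma der_M f g x v df dg : is_derive x v f df -> is_derive x v g dg ->
  is_derive x v (fun y => f y * g y) (df * g x + f x * dg).
Proof.
move=> hf hg; apply: (der_eq (is_deriveM hf hg)).
by rewrite addrC; congr (_ + _); rewrite [LHS]mulrC.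
Qed.

Lemma der_Zl (c : R) f x v df : is_derive x v f df ->
  is_derive x v (fun y => c * f y) (c * df).
Proof.
move=> hf; apply: (der_eq (der_M (der_cst x v c) hf)).
by rewrite mul0r add0r.
Qed.

Lemma der_X f n x v df : is_derive x v f df ->
  is_derive x v (fun y => f y ^+ n) (n%:R * f x ^+ n.-1 * df).
Proof.
move=> hf; elim: n => [|n IH].
  by apply: (der_eq (der_cst x v 1)); rewrite !mul0r.
rewrite (_ : (fun y => _) = (fun y => f y * f y ^+ n)); last first.
  by apply/funext => y; rewrite exprS.
apply: (der_eq (der_M hf IH)); case: n {IH} => [|n] /=.
  by rewrite /=; ring.
by rewrite -[n.+2%:R]natr1 exprS; ring.
Qed.

Lemma der_sum n (F : 'I_n -> V -> R) (dF : 'I_n -> R) x v :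
  (forall i, is_derive x v (F i) (dF i)) ->
  is_derive x v (fun y => \sum_(i < n) F i y) (\sum_(i < n) dF i).
Proof.
move=> H; rewrite (_ : (fun y => _) = \sum_(i < n) F i); first exact: is_derive_sum.
by apply/funext => y; rewrite fct_sumE.
Qed.

End derive_rules.

Section derive_rules1.
Context {R : realType}.

Lemma der_id (x v : R) : is_derive x v (fun y : R => y) v.
Proof. exact: is_derive_id. Qed.

Lemma der_cont (f : R -> R) (x df : R) : is_derive x 1 f df -> {for x, continuous f}.
Proof. by move=> [/derivable1_diffP /differentiable_continuous]. Qed.

Lemma der_cvgP (f : R -> R) (x l : R) :
  is_derive x 1 f l <-> h^-1 * (f (x + h) - f x) @[h --> 0^'] --> l.
Proof.
have E : (fun h : R => h^-1 * (f (x + h) - f x)) =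
         (fun h => h^-1 *: ((f \o shift x) (h *: 1) - f x)).
  by apply/funext => h; rewrite /shift /= [h *: 1]mulr1 (addrC h).
rewrite E; split => [[H1 <-]|H]; first exact: H1.
by split; [apply/cvg_ex; exists l|exact/cvg_lim].
Qed.

End derive_rules1.

Lemma cvg_exprn {R : realType} {T : Type} (F : set_system T) {FF : Filter F}
    (f : T -> R) (l : R) k :
  f x @[x --> F] --> l -> f x ^+ k @[x --> F] --> l ^+ k.
Proof.
move=> fl; elim: k => [|k IH]; first by rewrite expr0; exact: cvg_cst.
rewrite exprS; under eq_fun do rewrite exprS; exact: cvgM.
Qed.

Section continuity_rules.
Context {R : realType} {T : topologicalType}.
Implicit Types f g : T -> R.

Lemma cont_cst (c : R) : continuous (fun _ : T => c).
Proof. by move=> x; exact: cvg_cst. Qed.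

Lemma cont_D f g : continuous f -> continuous g -> continuous (fun x => f x + g x).
Proof. by move=> cf cg x; exact: (cvgD (cf x) (cg x)). Qed.

Lemma cont_N f : continuous f -> continuous (fun x => - f x).
Proof. by move=> cf x; exact: (cvgN (cf x)). Qed.

Lemma cont_B f g : continuous f -> continuous g -> continuous (fun x => f x - g x).
Proof. by move=> cf cg x; exact: (cvgB (cf x) (cg x)). Qed.

Lemma cont_M f g : continuous f -> continuous g -> continuous (fun x => f x * g x).
Proof. by move=> cf cg x; exact: (cvgM (cf x) (cg x)). Qed.

Lemma cont_X f k : continuous f -> continuous (fun x => f x ^+ k).
Proof. by move=> cf x; exact: (cvg_exprn (FF := nbhs_filter x) (cf x)). Qed.

Lemma cont_comp (h : R -> R) f : continuous h -> continuous f ->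
  continuous (fun x => h (f x)).
Proof. by move=> ch cf x; exact: (cvg_comp f h (cf x) (ch (f x))). Qed.

End continuity_rules.

(** * Lebesgue measure and the unit ball *)

Section affine_change.
Context {R : realType}.
Local Notation leb1 := (@lebesgue_measure R).

(** The measure [A |-> r * leb1 {x | r x + t \in A}] agrees with [leb1] on the intervals []a, b]],
    hence everywhere. *)
Lemma ge0_integral_affine1 (r t : R) (f : R -> \bar R) : 0 < r ->
  measurable_fun [set: measurableTypeR R] f -> (forall x, 0 <= f x)%E ->
  (\int[leb1]_x f x = r%:E * \int[leb1]_x f (r * x + t)%R)%E.
Proof.
move=> r0 mf f0.
pose phi (x : measurableTypeR R) : measurableTypeR R := r * x + t.
have mphi : measurable_fun [set: measurableTypeR R] phi.
  apply: measurable_funD => //; exact: measurable_funM.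
pose nu : {measure set (measurableTypeR R) -> \bar R} :=
  mscale (NngNum (ltW r0)) (pushforward leb1 phi).
have E A : measurable A -> leb1 A = nu mphi A.
  apply: lebesgue_measure_unique => _ [[a b] _ <-].
  change (leb1 `]a, b]%classic = r%:E * leb1 (phi @^-1` `]a, b]%classic))%E.
  have -> : phi @^-1` `]a, b]%classic = `](a - t) / r, (b - t) / r]%classic.
    apply/seteqP; split => x /=; rewrite !in_itv /= /phi;
      by rewrite ltr_pdivrMr// ler_pdivlMr// ltrBlDr lerBrDr (mulrC x).
  rewrite !lebesgue_measure_itv /= !lte_fin ltr_pM2r ?invr_gt0// ltrD2r.
  case: ifPn => _; last by rewrite mule0.
  by rewrite -!EFinB -EFinM; congr EFin; field; exact: lt0r_neq0.
rewrite (eq_measure_integral (nu mphi)); last by move=> A mA _; exact: E.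
by rewrite ge0_integral_mscale// ge0_integral_pushforward.
Qed.

Lemma rVconsE0 n p : @rVcons R n p ord0 ord0 = p.1.
Proof. by rewrite mxE unlift_none. Qed.

Lemma rVconsES n p i : @rVcons R n p ord0 (lift ord0 i) = p.2 ord0 i.
Proof. by rewrite mxE liftK. Qed.

Lemma measurable_rVcons n : measurable_fun setT (@rVcons R n).
Proof.
apply: measurable_rV => i; case: (unliftP ord0 i) => [j ->|->].
  under eq_fun do rewrite rVconsES.
  exact: (measurableT_comp (measurable_coord j) measurable_snd).
under eq_fun do rewrite rVconsE0.
exact: measurable_fst.
Qed.

Lemma measurable_affine n (r : R) (t : 'rV[R]_n) :
  measurable_fun setT (fun x : 'rV[R]_n => r *: x + t).
Proof.
apply: measurable_rV => i; under eq_fun do rewrite !mxE.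
apply: measurable_funD => //; apply: measurable_funM => //.
exact: measurable_coord.
Qed.

Lemma ge0_integral_lebesgue_rVS n (f : 'rV[R]_n.+1 -> \bar R) :
  measurable_fun setT f -> (forall x, 0 <= f x)%E ->
  (\int[@lebesgue_rV R n.+1]_x f x =
   \int[leb1]_a \int[@lebesgue_rV R n]_y f (rVcons (a, y)))%E.
Proof.
move=> mf f0.
transitivity (\int[(leb1 \x @lebesgue_rV R n)%E]_x (f \o @rVcons R n) x)%E.
  exact: (ge0_integral_pushforward (@measurable_rVcons n)
    (leb1 \x @lebesgue_rV R n)%E measurableT mf (fun y _ => f0 y)).
apply: fubini_tonelli1 => [|x]; last exact: f0.
exact: (measurableT_comp mf (@measurable_rVcons n)).
Qed.

(** Induction on the dimension: Tonelli slices off the first coordinate, and each coordinate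
    contributes one factor [r]. *)
Lemma ge0_integral_affine n (r : R) (t : 'rV[R]_n) (f : 'rV[R]_n -> \bar R) :
  0 < r -> measurable_fun setT f -> (forall x, 0 <= f x)%E ->
  (\int[@lebesgue_rV R n]_x f x =
   (r ^+ n)%:E * \int[@lebesgue_rV R n]_x f (r *: x + t)%R)%E.
Proof.
move=> r0; elim: n => [|n IH] in t f *.
  move=> mf f0; rewrite expr0 mul1e; apply: eq_integral => x _; congr f.
  by apply/rowP => -[].
move=> mf f0.
rewrite ge0_integral_lebesgue_rVS//.
have mfa a : measurable_fun setT (fun y => f (rVcons (a, y))).
  exact: (measurable_fun_pair2 (f := fun p => f (rVcons p)) a
            (measurableT_comp mf (@measurable_rVcons n))).
pose t' : 'rV[R]_n := \row_i t ord0 (lift ord0 i).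
under eq_integral => a _ do rewrite (IH t' _ (mfa a))//.
have mff : measurable_fun setT
   (fun p : measurableTypeR R * 'rV[R]_n => f (rVcons (p.1, r *: p.2 + t'))).
  apply: (measurableT_comp (measurableT_comp mf (@measurable_rVcons n))).
  apply: measurable_fun_pair; first exact: measurable_fst.
  exact: (measurableT_comp (measurable_affine r t') measurable_snd).
have mF := measurable_fun_fubini_tonelli_F _ mff (fun=> f0 _).
rewrite ge0_integralZl//; last 2 first.
  by move=> a _; exact: integral_ge0.
  by rewrite lee_fin exprn_ge0 ?ltW.
rewrite (ge0_integral_affine1 (t ord0 ord0) r0)//; last first.
  by move=> a; exact: integral_ge0.
  exact: mF.
rewrite [in RHS]ge0_integral_lebesgue_rVS//; last first.
  exact: (measurableT_comp mf (measurable_affine r t)).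
rewrite muleA -EFinM exprSr; congr (_ * _)%E.
apply: eq_integral => a _; apply: eq_integral => y _; congr f.
apply/rowP => i; case: (unliftP ord0 i) => [j ->|->].
  by rewrite rVconsES !mxE liftK.
  by rewrite rVconsE0 !mxE unlift_none.
exact: mF.
Qed.

End affine_change.

Section euclidean_space.
Context {R : realType}.
Local Notation leb1 := (@lebesgue_measure R).

Lemma cvg_rVP n (u : nat -> 'rV[R]_n) (x : 'rV[R]_n) :
  (forall i, u k ord0 i @[k --> \oo] --> x ord0 i) -> u k @[k --> \oo] --> x.
Proof.
move=> H; apply/cvg_ballP => e e0.
have : \forall k \near \oo, forall i, ball (x ord0 i) e (u k ord0 i).
  by apply: filter_forall => i; exact: (cvg_ball (H i) e0).
apply: filterS => k Hk; split => // i j; rewrite ord1; exact: Hk.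
Qed.

(** The sigma-algebra is generated by the coordinates, not by the open sets. Rounding each
    coordinate down to a multiple of [1 / (k + 1)] gives functions with countably many values on
    measurable cells, and [f] is their pointwise limit. *)
Lemma continuous_measurable_rV n (f : 'rV[R]_n -> R) :
  continuous f -> measurable_fun setT f.
Proof.
move=> cf.
pose a (k : nat) (x : 'rV[R]_n) : 'rV[int]_n :=
  \row_i Num.floor (x ord0 i * k.+1%:R).
pose b (k : nat) (m : 'rV[int]_n) : 'rV[R]_n :=
  \row_i ((m ord0 i)%:~R / k.+1%:R).
apply: (@measurable_fun_cvg _ _ _ _ (fun k x => f (b k (a k x)))).
- move=> k _ Y mY; rewrite setTI.
  have -> : (fun x => f (b k (a k x))) @^-1` Y =
      \bigcup_m ([set x | a k x = m] `&` [set x | Y (f (b k m))]).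
    apply/seteqP; split => [x /= Yx|x [m _] [/= <-]//].
    by exists (a k x).
  apply: countable_bigcupT_measurable => [|m]; first exact: countableP.
  apply: measurableI; last first.
    by case: (pselect (Y (f (b k m)))) => H;
      [rewrite (_ : [set _ | _] = setT)//|rewrite (_ : [set _ | _] = set0)//];
      apply/seteqP; split.
  have -> : [set x | a k x = m] = \bigcap_(i in [set: 'I_n])
     ((fun x : 'rV[R]_n => x ord0 i * k.+1%:R) @^-1`
        `[(m ord0 i)%:~R, (m ord0 i + 1)%:~R[).
    apply/seteqP; split => [x /= <- i _ /=|x Hx].
      by rewrite in_itv /= !mxE floor_itv.
    apply/rowP => i; rewrite mxE; apply: floor_def.
    by have := Hx i I; rewrite /= in_itv.
  apply: fin_bigcap_measurable => // i _.
  rewrite -[X in measurable X]setTI.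
  have mi : measurable_fun setT (fun x : 'rV[R]_n => x ord0 i * k.+1%:R).
    by apply: measurable_funM => //; exact: measurable_coord.
  exact: mi.
- move=> x _; apply: (cvg_comp (fun k => b k (a k x)) f); last exact: cf.
  apply: cvg_rVP => i; apply/cvgrPdist_lt => e e0.
  near=> k; rewrite !mxE.
  have k0 : 0 < k.+1%:R :> R by [].
  have /andP[h1 h2] := floor_itv (x ord0 i * k.+1%:R).
  set m := Num.floor _ in h1 h2 *.
  have h3 : m%:~R / k.+1%:R <= x ord0 i by rewrite ler_pdivrMr.
  rewrite ger0_norm ?subr_ge0// ltrBlDl.
  apply: (@le_lt_trans _ _ (m%:~R / k.+1%:R + k.+1%:R^-1)).
    by rewrite -{2}[_^-1]mul1r -mulrDl ler_pdivlMr// ltW// -(intrD _ m 1).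
  rewrite ltrD2l; near: k; exact: (near_infty_natSinv_lt (PosNum e0)).
Unshelve. all: by end_near. Qed.

Definition box n (c : R) : set 'rV[R]_n :=
  [set x | forall i, x ord0 i \in `[- c, c]].
Arguments box : clear implicits.

Lemma compact_box n c : compact (box n c).
Proof.
apply: (@rV_compact _  _ (fun=> `[(- c), c]%classic)).
by move=> _; apply: segment_compact.
Qed.

Lemma measurable_box n c : measurable (box n c).
Proof.
have -> : box n c = \bigcap_(i in [set: 'I_n])
   ((fun x : 'rV[R]_n => x ord0 i) @^-1` `[- c, c]).
  by apply/seteqP; split => [x Hx i _|x Hx i]; [exact: Hx|exact: Hx].
apply: fin_bigcap_measurable => // i _.
rewrite -[X in measurable X]setTI; exact: measurable_coord.
Qed.

Lemma lebesgue_rVS_product n (A : set (measurableTypeR R)) (B : set 'rV[R]_n) :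
  measurable A -> measurable B ->
  @lebesgue_rV R n.+1 [set x | A (x ord0 ord0) /\ B (\row_i x ord0 (lift ord0 i))]
  = (leb1 A * @lebesgue_rV R n B)%E.
Proof.
move=> mA mB; rewrite -product_measure1E//=; congr ((_ \x _)%E _).
apply/seteqP; split => -[x y] /=.
  by rewrite /preimage /= rVconsE0 => -[Ax]; rewrite (_ : \row__ _ = y)//;
    apply/rowP => i; rewrite !mxE liftK.
by rewrite /preimage /= rVconsE0 => -[Ax By]; rewrite (_ : \row__ _ = y)//;
    apply/rowP => i; rewrite !mxE liftK.
Qed.

Lemma lebesgue_rV_box n c : (@lebesgue_rV R n (box n c) < +oo)%E.
Proof.
elim: n => [|n IH]; first by rewrite /= /dirac indicE ltry.
have -> : box n.+1 c =
  [set x | `[- c, c]%classic (x ord0 ord0) /\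
           box n c (\row_i x ord0 (lift ord0 i))].
  apply/seteqP; split => x /=.
    by move=> H; split; [exact: H|move=> i; rewrite mxE].
  by move=> [H1 H2] i; case: (unliftP ord0 i) => [j ->|->//];
    have := H2 j; rewrite mxE.
rewrite lebesgue_rVS_product//; last exact: measurable_box.
rewrite lte_mul_pinfty// ge0_fin_numE// lebesgue_measure_itv /=.
by case: ifPn => // _; exact: ltry.
Qed.

(** The origin is the one point that [radial_proj] does not send to the sphere; this lemma discards
    it. *)
Lemma lebesgue_rV_0 n : @lebesgue_rV R n.+1 [set 0] = 0%E.
Proof.
have -> : [set 0] = [set x : 'rV[R]_n.+1 | [set 0] (x ord0 ord0) /\
           [set 0] (\row_i x ord0 (lift ord0 i))].
  apply/seteqP; split => x /=.
    by move=> ->; rewrite !mxE; split => //; apply/rowP => i; rewrite !mxE.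
  move=> [H1 /rowP H2]; apply/rowP => i.
  by case: (unliftP ord0 i) => [j ->|->]; rewrite mxE//; have := H2 j; rewrite !mxE.
rewrite lebesgue_rVS_product// ?lebesgue_measure_set1 ?mul0e//.
have -> : [set 0] = box n 0.
  apply/seteqP; split => x /=; first by move=> -> i; rewrite mxE in_itv /= oppr0 lexx.
  move=> H; apply/rowP => i; have := H i; rewrite in_itv /= oppr0 -eq_le mxE.
  by move/eqP.
exact: measurable_box.
Qed.

Lemma continuous_box_bounded n c (f : 'rV[R]_n -> R) : continuous f ->
  exists2 M, 0 <= M & forall x, box n c x -> `|f x| <= M.
Proof.
move=> cf.
have [E|/set0P ne] := eqVneq (box n c) set0.
  by exists 0 => // x; rewrite E.
have cnf : continuous (fun x => `|f x|).
  by move=> x; apply: (cvg_comp f Num.norm); [exact: cf|exact: norm_continuous].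
have [|y _ H] := EVT_max_rV ne (compact_box (n := n) (c := c)) (f := fun x => `|f x|).
  exact: continuous_subspaceT.
by exists `|f y| => // x bx; apply: H; rewrite inE.
Qed.

End euclidean_space.
Arguments box {R} n c.

Section enorm_theory.
Context {R : realType} {n : nat}.
Implicit Types x : 'rV[R]_n.

(** Radial functions are written in terms of the squared norm, which is a polynomial and so stays
    smooth at the origin. *)
Definition sqn x : R := \sum_(i < n) x ord0 i ^+ 2.

Lemma sqn_ge0 x : 0 <= sqn x.
Proof. by apply: sumr_ge0 => i _; exact: sqr_ge0. Qed.

Lemma enorm_ge0 x : 0 <= enorm x.
Proof. exact: sqrtr_ge0. Qed.

Lemma sqr_enorm x : enorm x ^+ 2 = sqn x.
Proof. by rewrite sqr_sqrtr// sqn_ge0. Qed.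

Lemma unit_ballE x : @unit_ball R n x <-> sqn x < 1.
Proof.
by rewrite /unit_ball /= -sqr_enorm expr_lt1// enorm_ge0.
Qed.

Lemma unit_sphereE x : @unit_sphere R n x <-> sqn x = 1.
Proof.
rewrite /unit_sphere /= -sqr_enorm; split => [->|/eqP]; first by rewrite expr1n.
by rewrite sqrf_eq1 => /orP[/eqP//|/eqP E]; have := enorm_ge0 x; rewrite E; lra.
Qed.

Lemma sqnZ (r : R) x : sqn (r *: x) = r ^+ 2 * sqn x.
Proof. by rewrite mulr_sumr; apply: eq_bigr => i _; rewrite mxE exprMn. Qed.

Lemma enormZ (r : R) x : 0 <= r -> enorm (r *: x) = r * enorm x.
Proof.
by move=> r0; rewrite /enorm [X in Num.sqrt X]sqnZ sqrtrM ?sqr_ge0// sqrtr_sqr ger0_norm.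
Qed.

Lemma sqn_coord x i : `|x ord0 i| <= enorm x.
Proof.
rewrite -sqrtr_sqr ler_wsqrtr// (bigD1 i)//= lerDl.
by apply: sumr_ge0 => j _; exact: sqr_ge0.
Qed.

Lemma enorm_box x c : enorm x <= c -> box n c x.
Proof.
by move=> xc i; rewrite in_itv /= -ler_norml (le_trans (sqn_coord x i)).
Qed.

Lemma enorm_eq0 x : enorm x = 0 -> x = 0.
Proof.
move=> x0; apply/rowP => i; rewrite mxE; apply/eqP; rewrite -normr_le0.
by rewrite -x0 sqn_coord.
Qed.

Lemma lebesgue_rV_ball : (@lebesgue_rV R n (@unit_ball R n) < +oo)%E.
Proof.
apply: (le_lt_trans _ (@lebesgue_rV_box R n 1)).
apply: le_measure; rewrite ?inE; [exact: measurable_unit_ball|exact: measurable_box|].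
by move=> x Bx; apply: enorm_box; exact: ltW.
Qed.

End enorm_theory.

Section lines.
Context {R : realType} {V : normedModType R}.

Lemma line_quotient (f : V -> R) (x v : V) (t : R) :
  (fun h : R => h^-1 *: (((fun t => f (x + t *: v)) \o shift t) (h *: 1) -
     (fun t => f (x + t *: v)) t)) =
  (fun h : R => h^-1 *: ((f \o shift (x + t *: v)) (h *: v) - f (x + t *: v))).
Proof.
apply/funext => h /=; congr (_ *: (f _ - _)).
by rewrite /shift /= scalerDl addrCA [h *: 1]mulr1.
Qed.

Lemma is_derive_lineP (f : V -> R) (x v : V) (t l : R) :
  is_derive (x + t *: v) v f l <-> is_derive t 1 (fun t => f (x + t *: v)) l.
Proof.
by split=> -[H1 H2]; split; move: H1 H2; rewrite /derivable /derive line_quotient.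
Qed.

Lemma is_derive_line0 (f : V -> R) (x v : V) (l : R) :
  is_derive x v f l <-> is_derive (0 : R) 1 (fun t => f (x + t *: v)) l.
Proof. by rewrite -is_derive_lineP scale0r addr0. Qed.

Lemma is_derive_seq (f : V -> R) (x v : V) (l : R) (h : nat -> R) :
  is_derive x v f l -> (forall k, h k != 0) -> h k @[k --> \oo] --> 0 ->
  (h k)^-1 * (f (h k *: v + x) - f x) @[k --> \oo] --> l.
Proof.
move=> [H1 <-] h0 hcv.
have : (fun h : R => h^-1 *: ((f \o shift x) (h *: v) - f x)) t @[t --> 0^'] -->
  'D_v f x by exact: H1.
by move/cvgr_dnbhsP => /(_ h); apply.
Qed.

End lines.

Section integral_tools.
Context {R : realType} {n : nat}.
Local Notation leb := (@lebesgue_rV R n).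
Local Notation B := (@unit_ball R n).

Lemma box_integrable (c M : R) (f : 'rV[R]_n -> R) :
  measurable_fun setT f -> (forall x, box n c x -> `|f x| <= M) ->
  leb.-integrable (box n c) (EFin \o f).
Proof.
move=> mf fM; apply: measurable_bounded_integrable.
- exact: measurable_box.
- exact: lebesgue_rV_box.
- exact: measurable_funTS.
- exists M; split; first exact: num_real.
  by move=> y My x bx; apply: (le_trans (fM x bx)); exact: ltW.
Qed.

Lemma ball_integrable (M : R) (f : 'rV[R]_n -> R) :
  measurable_fun setT f -> (forall x, B x -> `|f x| <= M) ->
  leb.-integrable B (EFin \o f).
Proof.
move=> mf fM; apply: measurable_bounded_integrable.
- exact: measurable_unit_ball.
- exact: lebesgue_rV_ball.
- exact: measurable_funTS.
- exists M; split; first exact: num_real.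
  by move=> y My x bx; apply: (le_trans (fM x bx)); exact: ltW.
Qed.

Lemma continuous_ball_integrable (f : 'rV[R]_n -> R) :
  continuous f -> leb.-integrable B (EFin \o f).
Proof.
move=> cf; have [M _ fM] := continuous_box_bounded 1 cf.
apply: (ball_integrable (M := M)); first exact: continuous_measurable_rV.
by move=> x Bx; apply: fM; apply: enorm_box; exact: ltW.
Qed.

Lemma Rintegral_support (D : set 'rV[R]_n) (f : 'rV[R]_n -> R) :
  (forall x, ~ D x -> f x = 0) -> \int[leb]_(x in D) f x = \int[leb]_x f x.
Proof.
move=> f0; rewrite Rintegral_mkcond; apply: eq_Rintegral => x _.
by rewrite patchE; case: ifPn => // /negP; rewrite inE => /f0.
Qed.

Lemma Rintegral_affine (r : R) (t : 'rV[R]_n) (f : 'rV[R]_n -> R) :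
  0 < r -> measurable_fun setT f -> leb.-integrable setT (EFin \o f) ->
  leb.-integrable setT (EFin \o (fun x => f (r *: x + t))) ->
  \int[leb]_x f x = r ^+ n * \int[leb]_x f (r *: x + t).
Proof.
move=> r0 mf if1 if2.
have mfE : measurable_fun setT (EFin \o f) by exact/measurable_EFinP.
rewrite /Rintegral integralE [in RHS]integralE.
rewrite (ge0_integral_affine t r0 (measurable_funepos mfE))//.
rewrite (ge0_integral_affine t r0 (measurable_funeneg mfE))//.
have h1 := integrable_pos_fin_num measurableT if2.
have h2 := integrable_neg_fin_num measurableT if2.
rewrite -[EFin \o _]/((EFin \o f) \o (fun x => r *: x + t)) in h1 h2.
pose af x : 'rV[R]_n := r *: x + t.
rewrite (funepos_comp (EFin \o f) af) in h1.
rewrite (funeneg_comp (EFin \o f) af) in h2.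
rewrite -[X in (_ * X - _)%E](fineK h1) -[X in (_ - _ * X)%E](fineK h2).
rewrite -[(fun x => (f (r *: x + t)%R)%:E)]/((EFin \o f) \o (fun x => r *: x + t)).
rewrite (funepos_comp (EFin \o f) af) (funeneg_comp (EFin \o f) af).
rewrite -[X in _ = _ * fine (X - _)%E](fineK h1).
rewrite -[X in _ = _ * fine (_ - X)%E](fineK h2).
by rewrite -!EFinM -!EFinB /= mulrBr.
Qed.

(** Differentiation under the integral sign, for an integral that does not depend on the parameter.
    It is applied to translations, for integration by parts, and to dilations, for the boundary
    term. *)
Lemma Rintegral_partial_eq0 (c u v a M : R) (f df : R -> 'rV[R]_n -> R) (k : R) :
  u < a < v ->
  (forall t, u < t < v -> measurable_fun setT (f t)) ->
  (forall t, u < t < v -> exists N, forall x, box n c x -> `|f t x| <= N) ->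
  (forall t x, u < t < v -> box n c x -> is_derive t 1 (f ^~ x) (df t x)) ->
  (forall t x, u < t < v -> box n c x -> `|df t x| <= M) ->
  (forall t, u < t < v -> \int[leb]_(x in box n c) f t x = k) ->
  \int[leb]_(x in box n c) df a x = 0.
Proof.
move=> auv mf bf dff dfM fk.
have itv t : `]u, v[%classic t -> u < t < v by rewrite /= in_itv.
have M0 : 0 <= Num.max 0 M by rewrite le_max lexx.
have dE t x : u < t < v -> box n c x -> partial1of2 f t x = df t x.
  by move=> tuv bx; rewrite /partial1of2 derive1E; have [_ ->] := dff t x tuv bx.
have := @differentiation_under_integral R _ _ leb f (box n c) (@measurable_box R n c)
  a u v auv.
have i1 : forall x : R, `]u, v[%classic x -> leb.-integrable (box n c) (EFin \o f x).
  move=> t /itv tuv; have [N fN] := bf t tuv.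
  by apply: (box_integrable (M := N)) => //; exact: mf.
have i2 : forall (x : R) (y : 'rV_n), `]u, v[%classic x -> box n c y ->
    derivable (f^~ y) x 1.
  by move=> t x /itv tuv bx; have [] := dff t x tuv bx.
have i3 : leb.-integrable (box n c) (EFin \o (fun=> Num.max 0 M)).
  apply: (box_integrable (M := Num.max 0 M)) => //.
  by move=> x _; rewrite ger0_norm.
move=> /(_ i1 i2 _ (fun=> M0) i3) H.
rewrite (@eq_Rintegral _ _ _ leb _ (partial1of2 f a)); last first.
  by move=> x; rewrite inE => bx; rewrite dE.
rewrite -H; last first.
  move=> t x /itv tuv bx; rewrite dE// (le_trans (dfM t x tuv bx))//.
  by rewrite le_max lexx orbT.
rewrite derive1E (near_eq_derive (g := fun=> k)) ?derive_cst ?oner_eq0//.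
  have : \forall t \near a, t \in `]u, v[ by exact: near_in_itvoo.
  by apply: filterS => t tuv; exact: fk.
Qed.

End integral_tools.

(** * One-variable estimates and cutoffs *)

Section one_variable.
Context {R : realType}.

Lemma bounded_derive_lipschitz_le (k dk : R -> R) (a b M : R) : a <= b ->
  (forall t, a <= t <= b -> is_derive t 1 k (dk t)) ->
  (forall t, a <= t <= b -> `|dk t| <= M) ->
  `|k b - k a| <= M * `|b - a|.
Proof.
move=> ab h1 h2.
have sub t : t \in `]a, b[ -> a <= t <= b.
  by rewrite in_itv /= => /andP[/ltW-> /ltW->].
have [||c cab ->] := @MVT_segment R k dk a b ab.
- by move=> t /sub; exact: h1.
- apply: derivable_within_continuous => t; rewrite in_itv /= => tab.
  by have [] := h1 t tab.
- by rewrite normrM ler_wpM2r//; apply: h2; move: cab; rewrite in_itv.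
Qed.

Lemma bounded_derive_lipschitz (k dk : R -> R) (c M a b : R) :
  (forall t : R, `|t| <= c -> is_derive t 1 k (dk t)) ->
  (forall t : R, `|t| <= c -> `|dk t| <= M) -> `|a| <= c -> `|b| <= c ->
  `|k b - k a| <= M * `|b - a|.
Proof.
move=> h1 h2 ac bc.
wlog ab : a b ac bc / a <= b => [H|].
  have [ab|ba] := leP a b; first exact: H.
  by rewrite distrC (distrC b); apply: H => //; exact: ltW.
have sub t : a <= t <= b -> `|t| <= c.
  by move=> /andP[h3 h4]; move: ac bc; rewrite !ler_norml; lra.
by apply: (bounded_derive_lipschitz_le (dk := dk)) => // t /sub; [exact: h1|exact: h2].
Qed.

(** Each of the [k + 1] terms of [(1 - s^(k+1)) / (1 - s)] is at least [s^k]. The derivative of a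
    cutoff times the distance to the boundary is thereby bounded uniformly in [k]. *)
Lemma expr_mul_onem_le (s : R) k : 0 <= s <= 1 ->
  k.+1%:R * s ^+ k * (1 - s) <= 1.
Proof.
move=> /andP[s0 s1].
apply: (@le_trans _ _ (1 - s ^+ k.+1)); last by rewrite gerBl exprn_ge0.
have -> : 1 - s ^+ k.+1 = (\sum_(i < k.+1) s ^+ i) * (1 - s).
  by rewrite -[LHS]opprB subrX1 -mulNr opprB mulrC.
rewrite ler_wpM2r ?subr_ge0//.
have -> : k.+1%:R * s ^+ k = \sum_(i < k.+1) s ^+ k.
  by rewrite sumr_const card_ord mulr_natl.
apply: ler_sum => i _; apply: ler_wiXn2l => //; exact: (leq_ord i).
Qed.

(** Of the two factors of [s^(2k) = s^k * s^k], one absorbs the linear growth by [expr_mul_onem_le],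
    the other tends to 0. *)
Lemma cvg_natmul_exprn (s : R) : 0 <= s < 1 ->
  k.*2.+1%:R * s ^+ k.*2 @[k --> \oo] --> 0.
Proof.
move=> /andP[s0 s1].
have os : 0 < 1 - s by rewrite subr_gt0.
apply: (@squeeze_cvgr _ _ _ _ (fun=> 0) (geometric (2 / (1 - s)) s)).
- near=> k; apply/andP; split; first by rewrite mulr_ge0// exprn_ge0.
  rewrite /geometric /= mulrAC ler_pdivlMr//.
  rewrite -addnn exprD -!mulrA.
  have h := expr_mul_onem_le k (_ : 0 <= s <= 1).
  have {}h : k.+1%:R * s ^+ k * (1 - s) <= 1 by apply: h; rewrite s0 ltW.
  have sk0 : 0 <= s ^+ k by exact: exprn_ge0.
  have E : (k + k).+1%:R <= 2 * k.+1%:R :> R.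
    by rewrite -natrM ler_nat mul2n -addnn addSn ltnS leq_add2l.
  apply: (@le_trans _ _ (2 * (k.+1%:R * s ^+ k * (1 - s)) * s ^+ k)).
    rewrite -subr_ge0.
    have -> : 2 * (k.+1%:R * s ^+ k * (1 - s)) * s ^+ k -
      (k + k).+1%:R * (s ^+ k * (s ^+ k * (1 - s))) =
      (2 * k.+1%:R - (k + k).+1%:R) * (s ^+ k * (s ^+ k * (1 - s))) by ring.
    by rewrite !mulr_ge0 ?subr_ge0// ltW.
  by rewrite ler_wpM2r// ler_piMr.
- exact: cvg_cst.
- by apply: cvg_geometric; rewrite ger0_norm.
Unshelve. all: by end_near. Qed.

(** The variable [s] stands for [|x|^2]. Squaring removes the corner of the positive part at [s = 1]
    and makes the cutoff [C^1] on the whole line. *)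
Definition cutoff (m : nat) (s : R) : R := Num.max 0 (1 - s ^+ m.+1) ^+ 2.
Definition dcutoff (m : nat) (s : R) : R :=
  - (2 * Num.max 0 (1 - s ^+ m.+1) * (m.+1%:R * s ^+ m)).

Lemma is_derive_sqr_max0 (y : R) :
  is_derive y 1 (fun y => Num.max 0 y ^+ 2) (2 * Num.max 0 y).
Proof.
have [y0|y0|->] := ltgtP y 0.
- rewrite mulr0.
  apply: (near_eq_is_derive (f := fun=> 0)).
  near=> t; rewrite /= max_l ?expr0n//; apply: ltW; near: t; exact: lt_nbhsl.
- have h : is_derive y 1 (fun t : R => t ^+ 2) (2 * y).
    by apply: (der_eq (der_X 2 (der_id y 1))); rewrite /= expr1 mulr1.
  apply: near_eq_is_derive h.
  near=> t; rewrite /= max_r//; apply: ltW; near: t; exact: lt_nbhsr.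
- rewrite ?maxxx mulr0.
  apply/der_cvgP; apply: (@cvg_to_0_linear _ _ 1 1) => // h /andP[h0 _] /=.
  rewrite add0r maxxx expr0n subr0 mul1r normrM normfV normrX.
  rewrite ler_pdivrMl// -expr2 lerXn2r// ?nnegrE//.
  by have [h1|h1] := leP 0 h; rewrite ?normr0.
Unshelve. all: by end_near. Qed.

Lemma is_derive_cutoff m (s : R) : is_derive s 1 (cutoff m) (dcutoff m s).
Proof.
have h1 : is_derive s 1 (fun s : R => 1 - s ^+ m.+1) (- (m.+1%:R * s ^+ m)).
  apply: (der_eq (der_B (der_cst _ _ _) (der_X m.+1 (der_id s 1)))).
  by rewrite sub0r mulr1.
by apply: (der_eq (is_derive1_comp (is_derive_sqr_max0 _) h1)); rewrite mulrN.
Qed.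

Lemma cutoff_ge1 m s : 1 <= s -> cutoff m s = 0.
Proof. by move=> s1; rewrite /cutoff max_l ?expr0n// subr_le0 exprn_ege1. Qed.

Lemma dcutoff_ge1 m s : 1 <= s -> dcutoff m s = 0.
Proof.
by move=> s1; rewrite /dcutoff max_l ?mulr0 ?mul0r ?oppr0// subr_le0 exprn_ege1.
Qed.

Lemma cutoffE m s : 0 <= s <= 1 -> cutoff m s = (1 - s ^+ m.+1) ^+ 2.
Proof.
by move=> /andP[s0 s1]; rewrite /cutoff max_r// subr_ge0 exprn_ile1.
Qed.

Lemma dcutoffE m s : 0 <= s <= 1 ->
  dcutoff m s = - (2 * (1 - s ^+ m.+1) * (m.+1%:R * s ^+ m)).
Proof.
by move=> /andP[s0 s1]; rewrite /dcutoff max_r// subr_ge0 exprn_ile1.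
Qed.

Lemma cutoff_le1 m s : 0 <= s -> `|cutoff m s| <= 1.
Proof.
move=> s0; have [s1|s1] := leP s 1; last by rewrite cutoff_ge1 ?normr0// ltW.
rewrite cutoffE ?s0// normrX exprn_ile1// ger0_norm ?subr_ge0 ?exprn_ile1//.
by rewrite gerBl exprn_ge0.
Qed.

Lemma dcutoff_le m s : 0 <= s -> `|dcutoff m s| <= 2 * m.+1%:R.
Proof.
move=> s0; have [s1|s1] := leP s 1; last by rewrite dcutoff_ge1 ?normr0 ?ltW// mulr_ge0.
rewrite dcutoffE ?s0// normrN !normrM ger0_norm// -mulrA ler_wpM2l//.
have h k : 0 <= s ^+ k <= 1 by rewrite exprn_ge0// exprn_ile1.
have /andP[h1 h2] := h m.+1; have /andP[h3 h4] := h m.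
rewrite (ger0_norm h3) (ger0_norm (_ : 0 <= _)) ?subr_ge0//.
rewrite normr_nat mulrCA ler_piMr// mulr_ile1 ?subr_ge0//; lra.
Qed.

End one_variable.

(** * The divergence theorem on the ball *)

Section integration_by_parts.
Context {R : realType} {n : nat}.
Local Notation leb := (@lebesgue_rV R n).
Local Notation B := (@unit_ball R n).
Local Notation dv i := (@delta_mx R 1 n ord0 i).

Lemma sqn_line (x : 'rV[R]_n) (i : 'I_n) (t : R) :
  sqn (x + t *: (dv i)) = sqn x + 2 * t * x ord0 i + t ^+ 2.
Proof.
rewrite /sqn [in LHS](bigD1 i)//= [in RHS](bigD1 i)//=.
rewrite !mxE !eqxx mulr1 (eq_bigr (fun j => x ord0 j ^+ 2)); last first.
  by move=> j ji; rewrite !mxE eqxx (negbTE ji) mulr0 addr0.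
by ring.
Qed.

Lemma der_coord (x v : 'rV[R]_n) i :
  is_derive x v (fun y : 'rV[R]_n => y ord0 i) (v ord0 i).
Proof.
rewrite is_derive_line0.
have -> : (fun t : R => (x + t *: v) ord0 i) = (fun t => x ord0 i + t * v ord0 i).
  by apply/funext => t; rewrite !mxE.
apply: (der_eq (der_D (der_cst _ _ _) (der_M (der_id 0 1) (der_cst _ _ _)))).
by rewrite add0r mulr0 addr0 mul1r.
Qed.

Lemma der_sqn (x v : 'rV[R]_n) :
  is_derive x v (@sqn R n) (2 * \sum_(i < n) x ord0 i * v ord0 i).
Proof.
apply: (der_eq (der_sum (fun i => der_X 2 (der_coord x v i)))).
by rewrite mulr_sumr; apply: eq_bigr => i _; rewrite /= expr1 mulrA.
Qed.

Lemma sum_delta (x : 'rV[R]_n) (i : 'I_n) :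
  \sum_(j < n) x ord0 j * ((dv i) : 'rV[R]_n) ord0 j = x ord0 i.
Proof.
rewrite (bigD1 i)//= !mxE !eqxx mulr1 big1 ?addr0// => j ji.
by rewrite !mxE (negbTE ji) andbF mulr0.
Qed.

Lemma continuous_coord i : continuous (fun x : 'rV[R]_n => x ord0 i).
Proof. by move=> x; apply: differentiable_continuous; exact: differentiable_coord. Qed.

Lemma continuous_sqn : continuous (@sqn R n).
Proof.
move=> x; apply: (cvg_big (U := R) add_continuous) => [|i _]; first exact: nbhs_filter.
by apply: (cvg_exprn (FF := nbhs_filter x)); exact: (@continuous_coord i x).
Qed.

(** This includes the points of the sphere. Moving along the axis [i] away from the origin never
    enters the ball, so the difference quotients vanish along a sequence of steps of one sign. *)
Lemma is_derive_outside0 (K : 'rV[R]_n -> R) (x : 'rV[R]_n) i l :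
  (forall x, ~ B x -> K x = 0) -> ~ B x -> is_derive x (dv i) K l -> l = 0.
Proof.
move=> K0 nBx dK.
(* The sign makes [h k * x_i] nonnegative, so [|x + h k e_i|^2] is at least [|x|^2]. *)
pose s : R := if 0 <= x ord0 i then 1 else -1.
have s0 : s != 0 by rewrite /s; case: ifP => _; rewrite ?oppr_eq0 oner_eq0.
pose h k : R := s * k.+1%:R^-1.
have h0 k : h k != 0 by rewrite mulf_neq0// invr_eq0.
have hcv : h k @[k --> \oo] --> 0.
  rewrite -[X in _ --> X](mulr0 s); apply: (cvgMr (F := \oo)); exact: cvg_harmonic.
have := is_derive_seq dK h0 hcv.
rewrite (_ : (fun k => _) = fun=> 0); first by move=> /(cvg_unique (@Rhausdorff R) (cvg_cst _)).
apply/funext => k; rewrite K0 ?K0 ?subrr ?mulr0//.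
rewrite addrC => /unit_ballE; rewrite sqn_line.
have sx : 1 <= sqn x by rewrite leNgt; apply/negP => /unit_ballE.
have h1 : 0 <= h k * x ord0 i.
  rewrite /h -mulrA mulrCA mulr_ge0//.
  by rewrite /s; case: ifPn => [?|]; rewrite ?mul1r// -ltNge mulN1r; lra.
have h2 := sqr_ge0 (h k).
by rewrite -mulrA; lra.
Qed.

(** By translation invariance the integral of [K (x + t e_i)] does not depend on [t]; its derivative
    at [t = 0] is the integral of [dK]. *)
Lemma Rintegral_ball_derive (i : 'I_n) (K dK : 'rV[R]_n -> R) :
  (forall x, is_derive x (dv i) K (dK x)) -> continuous K -> continuous dK ->
  (forall x, ~ B x -> K x = 0) -> \int[leb]_(x in B) dK x = 0.
Proof.
move=> dKE cK cdK K0.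
have dK0 x : ~ B x -> dK x = 0 by move=> Bx; exact: (is_derive_outside0 K0 Bx (dKE x)).
(* For [|t| < 1] every translate of [K] vanishes outside [box n 3], and the shifted arguments of
   points of that box stay in [box n 4], where the bounds are taken. *)
have Bbox x : B x -> box n 3 x by move=> Bx; apply: enorm_box; apply: ltW; apply: lt_trans Bx _; lra.
have [M _ dKM] := continuous_box_bounded 4 cdK.
have [N _ KN] := continuous_box_bounded 4 cK.
have ei0 j : `|(dv i) ord0 j| <= 1 :> R by rewrite mxE eqxx /=; case: (_ == _); rewrite ?normr1 ?normr0.
have sh x (t : R) : -1 < t < 1 -> box n 3 x -> box n 4 (x + t *: (dv i)).
  move=> /andP[t1 t2] bx j; have := bx j; rewrite !in_itv /= -!ler_norml => bxj.
  rewrite mxE (le_trans (ler_normD _ _))// (_ : 4 = 3 + 1 :> R); last by ring.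
  rewrite lerD// mxE normrM mulr_ile1// ler_norml !ltW//.
have cKt (t : R) : continuous (fun x : 'rV[R]_n => K (x + t *: (dv i))).
  move=> x; apply: (cvg_comp (fun x : 'rV[R]_n => x + t *: (dv i)) K); last exact: cK.
  exact: (cvgD (@cvg_id _ (nbhs x)) (cvg_cst (t *: dv i))).
have mKt (t : R) : measurable_fun setT (fun x : 'rV[R]_n => K (x + t *: (dv i))).
  exact: continuous_measurable_rV.
have supp (t : R) x : -1 < t < 1 -> ~ box n 3 x -> K (x + t *: (dv i)) = 0.
  move=> t1 nbx; apply: K0 => Bx; apply: nbx => j.
  have := @enorm_box R n _ 1 (ltW Bx) j; rewrite !in_itv /= !mxE -!ler_norml => h.
  have e1 := ei0 j.
  rewrite -[x ord0 j](addrK (t * (dv i) ord0 j)) (le_trans (ler_normB _ _))//.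
  rewrite (_ : 3 = 1 + 2 :> R); last by ring.
  rewrite lerD//; first by move: h; rewrite !mxE.
  rewrite normrM; apply: (@le_trans _ _ 1); last by lra.
  by rewrite mulr_ile1// ler_norml; case/andP: t1 => /ltW-> /ltW->.
have intK (t : R) : -1 < t < 1 -> leb.-integrable setT (EFin \o (fun x : 'rV[R]_n => K (x + t *: (dv i)))).
  move=> t1; have [M' _ KM'] := continuous_box_bounded 3 (cKt t).
  have := @box_integrable R n 3 M' _ (mKt t) KM'.
  rewrite integrable_mkcond; last exact: measurable_box.
  congr (_.-integrable _ _); apply/funext => x; rewrite patchE.
  case: ifPn => // /negP; rewrite inE => nbx /=.
  by rewrite supp.
have itv0 : -1 < (0 : R) < 1 by lra.
have const (t : R) : -1 < t < 1 -> \int[leb]_(x in box n 3) K (x + t *: (dv i)) =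
   \int[leb]_x K x.
  move=> t1; rewrite Rintegral_support; last by move=> x; exact: supp.
  rewrite [RHS](@Rintegral_affine R n 1 (t *: (dv i)))//.
  - by rewrite expr1n mul1r; apply: eq_Rintegral => x _; rewrite scale1r.
  - by have := mKt 0; under eq_fun do rewrite scale0r addr0.
  - by have := intK 0 itv0; under eq_fun do rewrite scale0r addr0.
  - have := intK t t1; congr (_.-integrable _ _); apply/funext => x /=.
    by rewrite scale1r.
have H := @Rintegral_partial_eq0 R n 3 (-1) 1 0 M (fun t (x : 'rV[R]_n) => K (x + t *: (dv i)))
  (fun t (x : 'rV[R]_n) => dK (x + t *: (dv i))) (\int[leb]_x K x) itv0.
rewrite Rintegral_support// -(Rintegral_support (D := box n 3)); last first.
  by move=> x bx; apply: dK0 => /Bbox.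
rewrite -[RHS]H.
- by apply: eq_Rintegral => x _; rewrite scale0r addr0.
- by move=> t _; exact: mKt.
- by move=> t t1; exists N => x bx; apply: KN; exact: sh.
- by move=> t x _ _; rewrite -is_derive_lineP; exact: dKE.
- by move=> t x t1 bx; apply: dKM; exact: sh.
- by move=> t t1; exact: const.
Qed.

End integration_by_parts.

Section dilation.
Context {R : realType} {n : nat}.
Local Notation leb := (@lebesgue_rV R n).
Local Notation B := (@unit_ball R n).

Lemma sqn_box_le (c : R) (x : 'rV[R]_n) : box n c x -> sqn x <= n%:R * c ^+ 2.
Proof.
move=> bx; apply: (@le_trans _ _ (\sum_(i < n) c ^+ 2)); last first.
  by rewrite sumr_const card_ord mulr_natl.
apply: ler_sum => i _; have := bx i; rewrite in_itv /= => /andP[h1 h2].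
by nra.
Qed.

(** As [h] is 0-homogeneous, the substitution [x -> t x] shows that [t^n] times the integral of
    [phi (t^2 |x|^2) h x] does not depend on [t]. The claim is the derivative at [t = 1]. *)
Lemma Rintegral_dilation (phi dphi : R -> R) (C M : R) (h : 'rV[R]_n -> R) :
  (forall s : R, is_derive s 1 phi (dphi s)) ->
  (forall s, 1 <= s -> phi s = 0) -> (forall s, 1 <= s -> dphi s = 0) ->
  (forall s, 0 <= s -> `|phi s| <= C) -> (forall s, 0 <= s -> `|dphi s| <= C) ->
  measurable_fun setT h -> (forall x, `|h x| <= M) ->
  (forall t x, 0 < t -> h (t *: x) = h x) ->
  \int[leb]_(x in B) (n%:R * phi (sqn x) * h x + 2 * sqn x * dphi (sqn x) * h x) = 0.
Proof.
move=> dphiE phi1 dphi1 phiC dphiC mh hM hom.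
have C0 : 0 <= C by apply: le_trans (phiC 0 (lexx _)).
have M0 : 0 <= M by apply: le_trans (hM 0).
pose f (t : R) (x : 'rV[R]_n) := t ^+ n * phi (t ^+ 2 * sqn x) * h x.
pose df (t : R) (x : 'rV[R]_n) := n%:R * t ^+ n.-1 * phi (t ^+ 2 * sqn x) * h x +
   t ^+ n * (dphi (t ^+ 2 * sqn x) * (2 * t * sqn x)) * h x.
have cphi : continuous phi by move=> s; exact: (der_cont (dphiE s)).
have mphi t : measurable_fun setT (fun x : 'rV[R]_n => phi (t ^+ 2 * sqn x) * h x).
  apply: measurable_funM => //; apply: continuous_measurable_rV => x.
  apply: (cvg_comp (fun x : 'rV[R]_n => t ^+ 2 * sqn x) phi); last exact: cphi.
  apply: (cvgMr (F := nbhs x)); exact: continuous_sqn.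
have nBsq x : ~ B x -> 1 <= sqn x by rewrite leNgt => nBx; apply/negP => /unit_ballE.
have Bbox x : B x -> box n 2 x by move=> Bx; apply: enorm_box; apply: ltW; apply: lt_trans Bx _; lra.
have sq0 (t : R) x : 0 <= t ^+ 2 * sqn x by rewrite mulr_ge0 ?sqr_ge0 ?sqn_ge0.
have supp (t : R) x : 1/2 < t -> ~ box n 2 x -> phi (t ^+ 2 * sqn x) = 0.
  move=> t2 nbx; apply: phi1; rewrite leNgt; apply/negP => tx; apply: nbx.
  apply: enorm_box; rewrite -(@ler_pXn2r _ 2)// ?nnegrE ?enorm_ge0// sqr_enorm.
  have t4 : 1/4 <= t ^+ 2 by nra.
  have := sqn_ge0 x; nra.
have bnd (t : R) x : `|phi (t ^+ 2 * sqn x) * h x| <= C * M.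
  by rewrite normrM ler_pM// phiC.
have intf (t : R) : 1/2 < t ->
    leb.-integrable setT (EFin \o (fun x => phi (t ^+ 2 * sqn x) * h x)).
  move=> t1.
  have := @box_integrable R n 2 (C * M) _ (mphi t) (fun x _ => bnd t x).
  rewrite integrable_mkcond; last exact: measurable_box.
  congr (_.-integrable _ _); apply/funext => x; rewrite patchE.
  case: ifPn => // /negP; rewrite inE => nbx /=.
  by rewrite supp// mul0r.
(* For [t > 1/2] the support of [phi (t^2 |x|^2)] lies in the ball of radius 2, so one box serves
   for all parameters. *)
have itv1 : 1/2 < (1 : R) < 2 by lra.
have const (t : R) : 1/2 < t < 2 -> \int[leb]_(x in box n 2) f t x =
   \int[leb]_x (phi (sqn x) * h x).
  move=> /andP[t1 t2]; have t0 : 0 < t by lra.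
  rewrite Rintegral_support; last first.
    by move=> x bx; rewrite /f supp// mulr0 mul0r.
  rewrite [RHS](@Rintegral_affine R n t 0)//.
  - rewrite (@eq_Rintegral _ _ _ leb _ (fun x => t ^+ n * (phi (t ^+ 2 * sqn x) * h x))).
      rewrite RintegralZl//; last exact: intf.
      by congr (_ * _); apply: eq_Rintegral => x _; rewrite addr0 sqnZ hom.
    by move=> x _; rewrite /f mulrA.
  - by have := mphi 1; under eq_fun do rewrite expr1n mul1r.
  - have := intf 1; rewrite ltr_pdivrMr// mul1r => /(_ (ltr1n _ 2)).
    by congr (_.-integrable _ _); apply/funext => x /=; rewrite expr1n mul1r.
  - have := intf t t1.
    by congr (_.-integrable _ _); apply/funext => x /=; rewrite addr0 sqnZ hom.
pose D := n%:R * 2 ^+ n.-1 * (C * M) + 2 ^+ n * (2 * 2 * (n%:R * 2 ^+ 2)) * (C * M).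
have H := @Rintegral_partial_eq0 R n 2 (1/2) 2 1 D f df _ itv1.
rewrite Rintegral_support; last first.
  by move=> x /nBsq s1; rewrite phi1// dphi1// !mulr0 !mul0r addr0.
rewrite -(Rintegral_support (D := box n 2)); last first.
  move=> x bx; have s1 : 1 <= sqn x by apply: nBsq => /Bbox.
  by rewrite phi1// dphi1// !mulr0 !mul0r addr0.
rewrite -[RHS](H (\int[leb]_x (phi (sqn x) * h x))).
- apply: eq_Rintegral => x _; rewrite /df !expr1n !mul1r; ring.
- move=> t _; rewrite /f; under eq_fun do rewrite -mulrA.
  by apply: measurable_funM.
- move=> t _; exists (`|t ^+ n| * (C * M)) => x _.
  by rewrite /f -mulrA normrM ler_wpM2l.
- move=> t x _ _; rewrite /f /df.
  have h1 := der_X 2 (der_id t 1).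
  have h2 := der_M h1 (der_cst t 1 (sqn x)).
  have h3 := @is_derive1_comp _ phi (fun t => t ^+ 2 * sqn x) t _ _ (dphiE _) h2.
  have h4 := der_X n (der_id t 1).
  apply: (der_eq (der_M (der_M h4 h3) (der_cst t 1 (h x)))).
  rewrite /= expr1; ring.
- move=> t x /andP[t1 t2] bx; have t0 : 0 < t by lra.
  have le2 k : `|t ^+ k| <= 2 ^+ k.
    by rewrite normrX gtr0_norm// lerXn2r// ?nnegrE ?ltW.
  rewrite /df (le_trans (ler_normD _ _))// /D lerD//.
    rewrite -mulrA normrM ler_pM// normrM normr_nat ler_wpM2l//.
  have -> : t ^+ n * (dphi (t ^+ 2 * sqn x) * (2 * t * sqn x)) * h x =
    t ^+ n * (2 * t * sqn x) * (dphi (t ^+ 2 * sqn x) * h x) by ring.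
  rewrite normrM; apply: ler_pM => //; last by rewrite normrM ler_pM// dphiC.
  rewrite normrM; apply: ler_pM => //.
  have s0 := sqn_ge0 x.
  rewrite ger0_norm ?mulr_ge0 ?(ltW t0)//.
  by apply: ler_pM; rewrite ?mulr_ge0 ?(ltW t0)// ?ler_wpM2l ?(ltW t2) ?sqn_box_le.
- by move=> t t1; exact: const.
Qed.

End dilation.

Section lipschitz.
Context {R : realType} {n : nat}.
Local Notation dv i := (@delta_mx R 1 n ord0 i).

(* Moving from y to x one coordinate at a time only requires the partial
   derivatives. *)
Lemma box_lipschitz (f : 'rV[R]_n -> R) (G : 'I_n -> 'rV[R]_n -> R) (c M : R) :
  0 <= c -> (forall i x, is_derive x (dv i) f (G i x)) ->
  (forall i x, box n c x -> `|G i x| <= M) ->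
  forall x y, box n c x -> box n c y ->
  `|f x - f y| <= M * \sum_(i < n) `|x ord0 i - y ord0 i|.
Proof.
move=> c0 dfG GM x y bx by_.
pose z k : 'rV[R]_n := \row_j (if (j < k)%N then x ord0 j else y ord0 j).
have zn : z n = x by apply/rowP => j; rewrite mxE ltn_ord.
have z0 : z 0 = y by apply/rowP => j; rewrite mxE ltn0.
have -> : f x - f y = \sum_(i < n) (f (z i.+1) - f (z i)).
  rewrite -{1}zn -{1}z0 -(telescope_sumr (fun k => f (z k)))//.
  by rewrite big_mkord.
rewrite (le_trans (ler_norm_sum _ _ _))// mulr_sumr; apply: ler_sum => i _.
(* With the coordinate [i] cleared, both [z i] and [z i.+1] lie on the line [w + t e_i], at
   [t = y_i] and [t = x_i]. *)
pose w : 'rV[R]_n := \row_j (if j == i then 0 else z i ord0 j).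
have zi : z i = w + y ord0 i *: dv i.
  apply/rowP => j; rewrite !mxE eqxx /=.
  have [->|ji] := eqVneq j i; first by rewrite ltnn mulr1 add0r.
  by rewrite mulr0 addr0.
have ziS : z i.+1 = w + x ord0 i *: dv i.
  apply/rowP => j; rewrite !mxE eqxx /= ltnS.
  have [->|ji] := eqVneq j i; first by rewrite leqnn mulr1 add0r.
  by rewrite mulr0 addr0 leq_eqVlt (_ : (j == i :> nat) = false)//; apply/negbTE.
rewrite zi ziS.
have bw (t : R) : `|t| <= c -> box n c (w + t *: dv i).
  move=> tc j; rewrite !mxE eqxx /= in_itv /= -ler_norml.
  have [_|ji] := eqVneq j i; first by rewrite mulr1 add0r.
  rewrite mulr0 addr0; case: ifP => _; [have := bx j|have := by_ j];
    by rewrite in_itv /= ler_norml.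
apply: (bounded_derive_lipschitz (c := c) (k := fun t => f (w + t *: dv i))
   (dk := fun t => G i (w + t *: dv i))).
- by move=> t _; rewrite -is_derive_lineP.
- by move=> t tc; apply: GM; exact: bw.
- by have := by_ i; rewrite in_itv /= ler_norml.
- by have := bx i; rewrite in_itv /= ler_norml.
Qed.

End lipschitz.

(** * Integration over the sphere *)

Section sphere_integral.
Context {R : realType} {n : nat}.
Local Notation leb := (@lebesgue_rV R n.+1).
Local Notation B := (@unit_ball R n.+1).
Local Notation S := (@unit_sphere R n.+1).
Local Notation sigma := (@sphere_measure R n.+1).

Lemma measurable_unit_sphere : measurable S.
Proof.
have -> : S = @enorm R n.+1 @^-1` [set 1] by apply/seteqP; split.
by rewrite -[X in measurable X]setTI; exact: measurable_enorm.
Qed.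

Lemma radial_proj_sphere (x : 'rV[R]_n.+1) : x != 0 -> S (radial_proj x).
Proof.
move=> x0; have e0 : 0 < enorm x.
  rewrite lt_def enorm_ge0 andbT; apply: contra_neq x0; exact: enorm_eq0.
by rewrite /unit_sphere /= /radial_proj enormZ ?invr_ge0 ?ltW// mulVf// gt_eqF.
Qed.

Lemma ge0_integral_sphere (f : 'rV[R]_n.+1 -> \bar R) :
  measurable_fun setT f -> (forall x, 0 <= f x)%E ->
  (\int[sigma]_(x in S) f x =
   n.+1%:R%:E * \int[leb]_(x in B) f (radial_proj x))%E.
Proof.
move=> mf f0.
have mS := measurable_unit_sphere.
have mB := @measurable_unit_ball R n.+1.
have mp := @measurable_radial_proj R n.+1.
have mP : measurable (@radial_proj R n.+1 @^-1` S) by rewrite -[X in measurable X]setTI; exact: mp.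
have mfp : measurable_fun setT (f \o @radial_proj R n.+1) by exact: measurableT_comp.
pose m := mscale (NngNum (ler0n R n.+1)) (mrestr leb mB).
transitivity (\int[m]_(x in @radial_proj R n.+1 @^-1` S)
   (f \o @radial_proj R n.+1) x)%E.
  apply: (ge0_integral_pushforward mp m mS).
    exact: measurable_funTS.
  by move=> y _; exact: f0.
rewrite (ge0_integral_mscale _ mP _ (measurable_funTS mfp) (fun x _ => f0 _)).
congr (_ * _)%E.
set P := @radial_proj R n.+1 @^-1` S in mP *; set F := f \o _ in mfp *.
have F0 x : (0 <= F x)%E by exact: f0.
have split_int (mu : {measure set 'rV[R]_n.+1 -> \bar R}) (A C : set 'rV[R]_n.+1) :
    measurable A -> measurable C -> mu (A `\` C) = 0%E ->
    (\int[mu]_(x in A) F x = \int[mu]_(x in A `&` C) F x)%E.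
  move=> mA mC AC0; rewrite -{1}(setUIDK A C) ge0_integral_setU//.
  - rewrite [X in (_ + X)%E]null_set_integral ?adde0//; first exact: measurableD.
    exact: measurable_funTS.
  - exact: measurableI.
  - exact: measurableD.
  - exact: measurable_funTS.
  - by rewrite disj_set2E; apply/eqP; rewrite setDE setIACA setICr setI0.
rewrite (split_int _ P B mP mB); last first.
  rewrite [LHS](_ : _ = leb ((P `\` B) `&` B))//.
  by rewrite setDE -setIA setICl setI0 measure0.
rewrite [in RHS](split_int _ B P mB mP); last first.
  apply/eqP; rewrite -measure_le0 -(lebesgue_rV_0 n); apply: le_measure.
  - by rewrite inE; exact: measurableD.
  - rewrite inE (_ : [set 0] = @enorm R n.+1 @^-1` [set 0]).
      by rewrite -[X in measurable X]setTI; exact: measurable_enorm.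
    apply/seteqP; split => x /=; last exact: enorm_eq0.
    by move=> ->; rewrite -(scale0r 0) enormZ// mul0r.
  - move=> x [Bx nPx] /=; apply: contrapT => /eqP x0; apply: nPx.
    exact: radial_proj_sphere.
rewrite (setIC P); apply: eq_measure_integral => A mA AB.
rewrite [LHS](_ : _ = leb (A `&` B))// setIidl//.
by move=> x /AB[].
Qed.

Lemma Rintegral_sphere (f : 'rV[R]_n.+1 -> R) (M : R) :
  measurable_fun setT f -> (forall x, box n.+1 1 x -> `|f x| <= M) ->
  \int[sigma]_(x in S) f x =
  n.+1%:R * \int[leb]_(x in B) f (radial_proj x).
Proof.
move=> mf fM.
have mfE : measurable_fun setT (EFin \o f) by exact/measurable_EFinP.
rewrite /Rintegral integralE [in RHS]integralE.
rewrite (ge0_integral_sphere (measurable_funepos mfE))//.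
rewrite (ge0_integral_sphere (measurable_funeneg mfE))//.
have bp (x : 'rV[R]_n.+1) : box n.+1 1 (radial_proj x).
  have [->|x0] := eqVneq x 0.
    by move=> i; rewrite /radial_proj scaler0 mxE in_itv /=; lra.
  by apply: enorm_box; rewrite (radial_proj_sphere x0).
have ip : leb.-integrable B (EFin \o (f \o @radial_proj R n.+1)).
  apply: (ball_integrable (M := M)); last by move=> x _; exact: fM.
  exact: (measurableT_comp mf (@measurable_radial_proj R n.+1)).
have mB := @measurable_unit_ball R n.+1.
have h1 := integrable_pos_fin_num mB ip.
have h2 := integrable_neg_fin_num mB ip.
rewrite -[EFin \o _]/((EFin \o f) \o @radial_proj R n.+1) in h1 h2.
rewrite (funepos_comp (EFin \o f) (@radial_proj R n.+1)) in h1.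
rewrite (funeneg_comp (EFin \o f) (@radial_proj R n.+1)) in h2.
rewrite -[X in (_ * X - _)%E](fineK h1) -[X in (_ - _ * X)%E](fineK h2).
rewrite -[(fun x => (f (radial_proj x))%:E)]/((EFin \o f) \o @radial_proj R n.+1).
rewrite (funepos_comp (EFin \o f) (@radial_proj R n.+1)) (funeneg_comp (EFin \o f) (@radial_proj R n.+1)).
rewrite -[X in _ = _ * fine (X - _)%E](fineK h1).
rewrite -[X in _ = _ * fine (_ - X)%E](fineK h2).
by rewrite -!EFinM -!EFinB /= mulrBr.
Qed.

End sphere_integral.

Section dominated.
Context {R : realType} {n : nat}.
Local Notation leb := (@lebesgue_rV R n).
Local Notation B := (@unit_ball R n).

Lemma Rintegral_ball_cvg (F : nat -> 'rV[R]_n -> R) (f : 'rV[R]_n -> R) (M : R) :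
  (forall k, measurable_fun setT (F k)) -> measurable_fun setT f ->
  (forall k x, B x -> `|F k x| <= M) ->
  (forall x, B x -> F k x @[k --> \oo] --> f x) ->
  \int[leb]_(x in B) F k x @[k --> \oo] --> \int[leb]_(x in B) f x.
Proof.
move=> mF mf FM Ff.
have mB := @measurable_unit_ball R n.
have iM : leb.-integrable B (EFin \o (fun=> M)).
  by apply: (ball_integrable (M := `|M|)).
have [|||||_ _ H] := @dominated_convergence _ _ R leb B mB (fun k => EFin \o F k)
   (EFin \o f) (EFin \o (fun=> M)).
- by move=> k; apply: measurable_funTS; exact/measurable_EFinP.
- by apply: measurable_funTS; exact/measurable_EFinP.
- by apply: aeW => x Bx; apply: cvg_EFin; [exact: nearW|exact: Ff].
- exact: iM.
- by apply: aeW => x k Bx /=; rewrite lee_fin FM.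
apply: fine_cvg; rewrite fineK; first exact: H.
apply: integrable_fin_num => //.
apply: (ball_integrable (M := M)) => // x Bx.
apply: (cvgr_to_le (cvg_norm (Ff x Bx))); apply: nearW => k; exact: FM.
Qed.

End dominated.

Section cutoff_continuity.
Context {R : realType}.

Lemma continuous_dcutoff m : continuous (@dcutoff R m).
Proof.
move=> s.
have -> : @dcutoff R m = (fun s => - (((1 - s ^+ m.+1) + `|1 - s ^+ m.+1|) * (m.+1%:R * s ^+ m))).
  apply/funext => t; rewrite /dcutoff; congr (- (_ * _)).
  by have [h|h] := leP 0 (1 - t ^+ m.+1); [rewrite ger0_norm//|rewrite ltr0_norm//]; ring.
have h k : t ^+ k @[t --> s] --> s ^+ k by apply: cvg_exprn; exact: cvg_id.
have h1 : 1 - t ^+ m.+1 @[t --> s] --> 1 - s ^+ m.+1.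
  by apply: cvgB; [exact: cvg_cst|exact: h].
apply: cvgN; apply: cvgM; last by apply: cvgM; [exact: cvg_cst|exact: h].
by apply: cvgD => //; exact: cvg_norm.
Qed.

End cutoff_continuity.

Section divergence.
Context {R : realType} {n : nat}.
Local Notation leb := (@lebesgue_rV R n.+1).
Local Notation B := (@unit_ball R n.+1).
Local Notation S := (@unit_sphere R n.+1).
Local Notation sigma := (@sphere_measure R n.+1).
Local Notation dv i := (@delta_mx R 1 n.+1 ord0 i).

Variables (f : 'rV[R]_n.+1 -> R) (G : 'I_n.+1 -> 'rV[R]_n.+1 -> R) (i : 'I_n.+1).
Hypothesis dfG : forall j x, is_derive x (dv j) f (G j x).
Hypothesis cf : continuous f.
Hypothesis cG : forall j, continuous (G j).

(** On the sphere [g] is the flux density [f nu_i]; [h] is its 0-homogeneous extension, whose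
    integral over the ball times [N] is the boundary term. *)
Let g (x : 'rV[R]_n.+1) := f x * x ord0 i.
Let h (x : 'rV[R]_n.+1) := g (radial_proj x).
Let N := n.+1%:R : R.

Let cg : continuous g.
Proof. by apply: cont_M => //; exact: continuous_coord. Qed.

Let mh : measurable_fun setT h.
Proof.
exact: (measurableT_comp (continuous_measurable_rV cg) (@measurable_radial_proj R n.+1)).
Qed.

Lemma box_radial_proj (x : 'rV[R]_n.+1) : box n.+1 1 (radial_proj x).
Proof.
have [->|x0] := eqVneq x 0.
  by move=> j; rewrite /radial_proj scaler0 mxE in_itv /=; lra.
by apply: enorm_box; rewrite (radial_proj_sphere x0).
Qed.

Let hom t x : 0 < t -> h (t *: x) = h x.
Proof.
move=> t0; rewrite /h /radial_proj enormZ ?ltW// scalerA invfM mulrAC mulVf ?mul1r//.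
exact: lt0r_neq0.
Qed.

Let dg (j : 'I_n.+1) (x : 'rV[R]_n.+1) := G j x * x ord0 i + f x * dv j ord0 i.

Let dgE j x : is_derive x (dv j) g (dg j x).
Proof. exact: (der_M (dfG j x) (der_coord x (dv j) i)). Qed.

Let cdg j : continuous (dg j).
Proof.
apply: cont_D; apply: cont_M => //; [exact: continuous_coord|exact: cont_cst].
Qed.

(** Split the difference as [(g x - g (x / |x|)) + (1 - |x|^2) h x]. The first part is Lipschitz in
    the distance [1 - |x|], which is at most [1 - |x|^2]; in the second, [h] is bounded. *)
Let lip : exists2 L, 0 <= L & forall x, B x -> `|g x - sqn x * h x| <= L * (1 - sqn x).
Proof.
have [M1 M10 gM] := continuous_box_bounded 1 cg.
have /boolp.choice[M HM] : forall j, exists Mj : R,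
    0 <= Mj /\ forall x, box n.+1 1 x -> `|dg j x| <= Mj.
  move=> j; have [Mj Mj0 H] := continuous_box_bounded 1 (@cdg j).
  by exists Mj.
have M0 j : 0 <= M j := (HM j).1; have dgM j := (HM j).2.
pose L := \sum_j M j.
have LM j : M j <= L by rewrite /L (bigD1 j)//= lerDl sumr_ge0.
have L0 : 0 <= L by apply: sumr_ge0.
exists (L * N + M1) => [|x Bx]; first by rewrite addr_ge0// mulr_ge0.
have s1 : sqn x < 1 by exact/unit_ballE.
have s0 := sqn_ge0 x; have e0 := enorm_ge0 x.
have es : 1 - enorm x <= 1 - sqn x.
  rewrite lerD2l lerN2 -sqr_enorm expr2 ler_piMr//; exact: ltW.
have -> : g x - sqn x * h x = (g x - h x) + (1 - sqn x) * h x by ring.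
rewrite (le_trans (ler_normD _ _))// [leRHS]mulrDl lerD//; last first.
  rewrite normrM mulrC [X in _ * X <= _]ger0_norm ?subr_ge0 ?(ltW s1)// ler_wpM2r ?subr_ge0 ?(ltW s1)//.
  by apply: gM; exact: box_radial_proj.
have := @box_lipschitz R n.+1 g dg 1 L ler01 dgE (fun j x bx => le_trans (dgM j x bx) (LM j))
   x (radial_proj x) (enorm_box (ltW Bx)) (box_radial_proj x).
move=> /le_trans; apply; rewrite -mulrA ler_wpM2l//.
apply: (@le_trans _ _ (\sum_(j < n.+1) (1 - sqn x))); last first.
  by rewrite sumr_const card_ord mulr_natl.
apply: ler_sum => j _; apply: le_trans es; rewrite mxE.
(* At the origin the inverse of 0 is 0, so [radial_proj 0 = 0]; the left-hand side vanishes
   there. *)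
have [->|x0] := eqVneq x 0; first by rewrite !mxE mulr0 subrr normr0 subr_ge0 /enorm big1 ?sqrtr0// => k _; rewrite mxE expr0n.
have ep : 0 < enorm x by rewrite lt_def e0 andbT; apply: contra_neq x0; exact: enorm_eq0.
have xj := sqn_coord x j.
have -> : x ord0 j - (enorm x)^-1 * x ord0 j = x ord0 j * (enorm x)^-1 * (enorm x - 1).
  by field; exact: lt0r_neq0.
rewrite normrM distrC [X in _ * X]ger0_norm ?subr_ge0 ?(ltW Bx)//.
rewrite ler_piMl ?subr_ge0 ?(ltW Bx)// normrM normfV (ger0_norm e0).
by rewrite ler_pdivrMr// mul1r.
Qed.

(** The identity of [Rintegral_ball_derive] for [phi_k f] minus that of [Rintegral_dilation] for [h]
    says that [T k] has integral 0. As [k] grows, [T k] tends boundedly to [G i - N h], so the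
    integral of [G i] is [N] times that of [h], which is the sphere integral. *)
Lemma ball_divergence :
  \int[leb]_(x in B) G i x = \int[sigma]_(x in S) (f x * x ord0 i).
Proof.
have [M1 M10 gM] := continuous_box_bounded 1 cg.
have [M2 M20 GM] := continuous_box_bounded 1 (@cG i).
have hM x : `|h x| <= M1 by apply: gM; exact: box_radial_proj.
have [L L0 gL] := lip.
rewrite (Rintegral_sphere (continuous_measurable_rV cg) gM) -/N.
(* Doubling the index makes [dphi k] contain [s^(2k)], the form treated by [cvg_natmul_exprn]. *)
pose phi k := @cutoff R k.*2; pose dphi k := @dcutoff R k.*2.
pose T k x := phi k (sqn x) * (G i x - N * h x) +
   2 * dphi k (sqn x) * (g x - sqn x * h x).
have mB := @measurable_unit_ball R n.+1.
have csq := @continuous_sqn R n.+1.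
have cphi k : continuous (fun x : 'rV[R]_n.+1 => phi k (sqn x)).
  apply: cont_comp csq => s; exact: (der_cont (is_derive_cutoff k.*2 _)).
have cdphi k : continuous (fun x : 'rV[R]_n.+1 => dphi k (sqn x)).
  by apply: cont_comp csq; exact: continuous_dcutoff.
have sB x : B x -> 0 <= sqn x <= 1.
  by move=> /unit_ballE s1; rewrite sqn_ge0 ltW.
have phi1 k x : `|phi k (sqn x)| <= 1 by apply: cutoff_le1; exact: sqn_ge0.
(* Together with [lip], this dominates the second term of [T k] uniformly in [k]. *)
have dphi1 k x : B x -> `|dphi k (sqn x)| * (1 - sqn x) <= 2.
  move=> /sB /[dup] s01 /andP[s0 s1].
  have h1 := expr_mul_onem_le k.*2 s01.
  have /andP[p0 p1] : 0 <= sqn x ^+ k.*2.+1 <= 1 by rewrite exprn_ge0// exprn_ile1.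
  have q0 : 0 <= k.*2.+1%:R * sqn x ^+ k.*2 by rewrite mulr_ge0// exprn_ge0.
  rewrite /dphi dcutoffE// normrN ger0_norm; last by apply: mulr_ge0 => //; apply: mulr_ge0 => //; rewrite subr_ge0.
  have -> : 2 * (1 - sqn x ^+ k.*2.+1) * (k.*2.+1%:R * sqn x ^+ k.*2) * (1 - sqn x) =
    2 * ((1 - sqn x ^+ k.*2.+1) * (k.*2.+1%:R * sqn x ^+ k.*2 * (1 - sqn x))) by ring.
  rewrite -[leRHS]mulr1 ler_wpM2l//; apply: mulr_ile1 => //.
  - by rewrite subr_ge0.
  - by rewrite mulr_ge0// subr_ge0.
  - by rewrite gerBl.
have T0 k : \int[leb]_(x in B) T k x = 0.
  pose K x := phi k (sqn x) * f x.
  pose dK x := dphi k (sqn x) * (2 * x ord0 i) * f x + phi k (sqn x) * G i x.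
  have cK : continuous K by apply: cont_M; [exact: cphi|exact: cf].
  have cdK : continuous dK.
    apply: cont_D; last by apply: cont_M; [exact: cphi|exact: cG].
    apply: cont_M; last exact: cf.
    apply: cont_M; first exact: cdphi.
    by apply: cont_M; [exact: cont_cst|exact: continuous_coord].
  have IK := @Rintegral_ball_derive R n.+1 i K dK.
  have {}IK : \int[leb]_(x in B) dK x = 0.
    apply: IK => // x.
      apply: der_M (dfG i x); rewrite is_derive_line0.
      have h1 := (@is_derive_line0 _ _ _ _ _ _).1 (der_sqn x (dv i)).
      rewrite sum_delta in h1.
      apply: (@is_derive1_comp _ (phi k) (fun t : R => sqn (x + t *: dv i)) 0 _ _ _ h1).
      rewrite scale0r addr0; exact: is_derive_cutoff.
    move=> nBx; rewrite /K /phi cutoff_ge1 ?mul0r// leNgt; apply/negP => s1.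
    by apply: nBx; exact/unit_ballE.
  pose W x := N * phi k (sqn x) * h x + 2 * sqn x * dphi k (sqn x) * h x.
  pose C := 1 + 2 * k.*2.+1%:R : R.
  have k0 : 0 <= k.*2.+1%:R :> R by [].
  have IW : \int[leb]_(x in B) W x = 0.
    apply: (@Rintegral_dilation R n.+1 (phi k) (dphi k) C M1 h).
    - by move=> s; exact: is_derive_cutoff.
    - by move=> s; exact: cutoff_ge1.
    - by move=> s; exact: dcutoff_ge1.
    - by move=> s s0; rewrite (le_trans (cutoff_le1 _ s0))// /C lerDl mulr_ge0.
    - by move=> s s0; rewrite (le_trans (dcutoff_le _ s0))// /C lerDr.
    - exact: mh.
    - exact: hM.
    - by move=> t x; exact: hom.
  rewrite (@eq_Rintegral _ _ _ leb _ (fun x => dK x - W x)); last first.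
    by move=> x _; rewrite /T /dK /W /g; ring.
  rewrite RintegralB ?IK ?IW ?subrr//; first exact: continuous_ball_integrable.
  apply: (ball_integrable (M := N * M1 + 2 * C * M1)).
    apply: measurable_funD; apply: measurable_funM => //; apply: continuous_measurable_rV.
      by apply: cont_M; [exact: cont_cst|exact: cphi].
    apply: cont_M; last exact: cdphi.
    by apply: cont_M; [exact: cont_cst|exact: csq].
  move=> x /sB /andP[s0 s1]; rewrite (le_trans (ler_normD _ _))// lerD//.
    rewrite normrM ler_pM// normrM normr_nat ler_piMr//; exact: phi1.
  rewrite normrM ler_pM// normrM ler_pM//.
    by rewrite normrM normr_nat (ger0_norm s0) ler_piMr.
  by rewrite (le_trans (dcutoff_le _ s0))// /C lerDr.
have Tlim x : B x -> T k x @[k --> \oo] --> G i x - N * h x.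
  move=> /[dup] /sB s01 /unit_ballE s1; have /andP[s0 _] := s01.
  have e1 : sqn x ^+ k.*2.+1 @[k --> \oo] --> 0.
    apply: (@squeeze_cvgr _ _ _ _ (fun=> 0) (geometric 1 (sqn x))).
    - near=> k; rewrite exprn_ge0//= mul1r ler_wiXn2l//; first exact: ltW.
      by rewrite -addnn ltnW// ltnS leq_addr.
    - exact: cvg_cst.
    - by apply: cvg_geometric; rewrite ger0_norm.
  have e2 := @cvg_natmul_exprn R (sqn x) (introT andP (conj s0 s1)).
  have c1 : 1 - sqn x ^+ k.*2.+1 @[k --> \oo] --> (1 - 0 : R).
    by apply: cvgB => //; exact: cvg_cst.
  have p1 : phi k (sqn x) @[k --> \oo] --> (1 : R).
    rewrite (_ : (fun k => _) = (fun k => (1 - sqn x ^+ k.*2.+1) ^+ 2)); last first.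
      by apply/funext => k; rewrite /phi cutoffE.
    have := @cvg_exprn R nat \oo _ _ _ 2 c1; rewrite subr0 expr1n. exact.
  have p2 : dphi k (sqn x) @[k --> \oo] --> (0 : R).
    rewrite (_ : (fun k => _) = (fun k =>
      - (2 * (1 - sqn x ^+ k.*2.+1) * (k.*2.+1%:R * sqn x ^+ k.*2)))); last first.
      by apply/funext => k; rewrite /dphi dcutoffE.
    have := cvgN (cvgM (cvgM (@cvg_cst R 2 nat \oo _) c1) e2).
    rewrite mulr0 oppr0; exact.
  rewrite -[X in _ --> X]addr0; apply: cvgD.
    by rewrite -[X in _ --> X]mul1r; apply: cvgM => //; exact: cvg_cst.
  rewrite -[X in _ --> X](mul0r (g x - sqn x * h x)); apply: cvgM; last exact: cvg_cst.
  by rewrite -[X in _ --> X](mulr0 2); apply: cvgM => //; exact: cvg_cst.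
have iG : leb.-integrable B (EFin \o G i) by exact: continuous_ball_integrable.
have ih : leb.-integrable B (EFin \o h) by apply: (ball_integrable (M := M1)).
have iNh : leb.-integrable B (EFin \o (fun x => N * h x)).
  apply: (ball_integrable (M := N * M1)); first exact: measurable_funM.
  by move=> x _; rewrite normrM normr_nat ler_wpM2l.
have mG : measurable_fun setT (G i) by exact: continuous_measurable_rV.
have mW : measurable_fun setT (fun x => G i x - N * h x).
  by apply: measurable_funB => //; exact: measurable_funM.
have := @Rintegral_ball_cvg R n.+1 T (fun x => G i x - N * h x)
  (1 * (M2 + N * M1) + 2 * 2 * L) _ mW _ Tlim.
under eq_fun do rewrite T0.
move=> H; have {}H : (fun=> 0 : R) @ \oo --> \int[leb]_(x in B) (G i x - N * h x).
  apply: H => [k|k x Bx].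
    apply: measurable_funD; apply: measurable_funM => //.
    - exact: continuous_measurable_rV.
    - apply: measurable_funM => //; exact: continuous_measurable_rV.
    - apply: measurable_funB; first exact: continuous_measurable_rV.
      by apply: measurable_funM => //; exact: continuous_measurable_rV.
  rewrite (le_trans (ler_normD _ _))// lerD//.
    rewrite normrM ler_pM//.
    rewrite (le_trans (ler_normB _ _))// lerD//.
      by apply: GM; apply: enorm_box; exact: ltW.
    by rewrite normrM normr_nat ler_wpM2l.
  rewrite !normrM normr_nat -!mulrA ler_wpM2l//.
  apply: (@le_trans _ _ (`|dphi k (sqn x)| * (L * (1 - sqn x)))).
    by rewrite ler_wpM2l//; exact: gL.
  by rewrite mulrCA mulrC ler_wpM2r//; exact: dphi1.
have := cvg_unique (@Rhausdorff R) (cvg_cst _) H.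
rewrite RintegralB// RintegralZl// => E.
by apply/eqP; rewrite -subr_eq0 -E.
Unshelve. all: by end_near. Qed.

End divergence.

(** * Complex-valued functions and entire series *)

Section complex_basics.
Context {R : realType}.
Implicit Types z w : R[i].
Local Notation Re := complex.Re.
Local Notation Im := complex.Im.

Lemma ReD z w : Re (z + w) = Re z + Re w. Proof. by case: z => ? ?; case: w. Qed.
Lemma ImD z w : Im (z + w) = Im z + Im w. Proof. by case: z => ? ?; case: w. Qed.
Lemma ReN z : Re (- z) = - Re z. Proof. by case: z. Qed.
Lemma ImN z : Im (- z) = - Im z. Proof. by case: z. Qed.
Lemma ReB z w : Re (z - w) = Re z - Re w. Proof. by rewrite ReD ReN. Qed.
Lemma ImB z w : Im (z - w) = Im z - Im w. Proof. by rewrite ImD ImN. Qed.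
Lemma ReM z w : Re (z * w) = Re z * Re w - Im z * Im w.
Proof. by case: z => ? ?; case: w. Qed.
Lemma ImM z w : Im (z * w) = Re z * Im w + Im z * Re w.
Proof. by case: z => a b; case: w => c d. Qed.
Lemma ReJ z : Re z^* = Re z. Proof. by case: z. Qed.
Lemma ImJ z : Im z^* = - Im z. Proof. by case: z. Qed.
Lemma ReC (a : R) : Re a%:C = a. Proof. by []. Qed.
Lemma ImC (a : R) : Im a%:C = 0. Proof. by []. Qed.
Lemma Re_nat k : Re (k%:R : R[i]) = k%:R.
Proof. by elim: k => [|k IH]; rewrite ?mulrSr// ReD IH. Qed.
Lemma Im_nat k : Im (k%:R : R[i]) = 0.
Proof. by elim: k => [|k IH]; rewrite ?mulrSr// ImD IH add0r. Qed.
Definition ReImE := (Re_nat, Im_nat, ReB, ImB, ReD, ImD, ReN, ImN, ReM, ImM, ReJ, ImJ, ReC, ImC).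

Lemma complex_ext z w : Re z = Re w -> Im z = Im w -> z = w.
Proof. by case: z => ? ?; case: w => ? ? /= -> ->. Qed.

Lemma sqr_normcE z : normc z ^+ 2 = Re z ^+ 2 + Im z ^+ 2.
Proof. by case: z => a b; rewrite /normc /= sqr_sqrtr// addr_ge0// sqr_ge0. Qed.

Lemma normc_ge0 z : 0 <= normc z.
Proof. by case: z => a b; exact: sqrtr_ge0. Qed.

Lemma normc_le z (c : R) : 0 <= c -> Re z ^+ 2 + Im z ^+ 2 <= c ^+ 2 -> normc z <= c.
Proof. by move=> c0; rewrite -sqr_normcE ler_pXn2r// nnegrE normc_ge0. Qed.

Lemma normRe_le z : `|Re z| <= normc z.
Proof.
rewrite -(@ler_pXn2r _ 2)// ?nnegrE ?normc_ge0// sqr_normcE real_normK ?num_real//.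
by rewrite lerDl sqr_ge0.
Qed.

Lemma normIm_le z : `|Im z| <= normc z.
Proof.
rewrite -(@ler_pXn2r _ 2)// ?nnegrE ?normc_ge0// sqr_normcE real_normK ?num_real//.
by rewrite lerDr sqr_ge0.
Qed.

Lemma Re_le_normc z : Re z <= normc z.
Proof. by rewrite (le_trans (ler_norm _))// normRe_le. Qed.

Lemma normc_le_add z : normc z <= `|Re z| + `|Im z|.
Proof.
apply: normc_le; first by rewrite addr_ge0.
rewrite sqrrD !real_normK ?num_real// -addrA lerD2l lerDr mulrn_wge0// mulr_ge0//.
Qed.

Lemma normcD z w : normc (z + w) <= normc z + normc w.
Proof. exact: le_normcD. Qed.

Lemma normcN z : normc (- z) = normc z.
Proof. exact: normcN. Qed.

Lemma normcB z w : normc (z - w) <= normc z + normc w.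
Proof. by rewrite (le_trans (normcD _ _))// normcN. Qed.

Lemma normcBC z w : normc (z - w) = normc (w - z).
Proof. by rewrite -opprB normcN. Qed.

Lemma normcB_ge z w : normc z - normc w <= normc (z - w).
Proof. by rewrite lerBlDr -{1}(subrK w z) normcD. Qed.

Lemma normcJ z : normc z^* = normc z.
Proof. by case: z => a b; rewrite /normc /= sqrrN. Qed.

Lemma normcX z k : normc (z ^+ k) = normc z ^+ k.
Proof. by elim: k => [|k IH]; rewrite ?expr0 ?normc1// !exprS normcM IH. Qed.

Lemma normcR (a : R) : normc a%:C = `|a|.
Proof. by rewrite /normc /= expr0n addr0 sqrtr_sqr. Qed.

Lemma normc_nat k : normc (k%:R : R[i]) = k%:R.
Proof. by rewrite -(rmorph_nat (real_complex R)) normcR normr_nat. Qed.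

Lemma normc_eq0 z : (normc z == 0) = (z == 0).
Proof. by apply/eqP/eqP => [/eq0_normc//|->]; rewrite normc0. Qed.

Lemma normc_gt0 z : (0 < normc z) = (z != 0).
Proof. by rewrite lt_def normc_ge0 andbT normc_eq0. Qed.

Lemma normcJM z : z * z^* = (normc z ^+ 2)%:C.
Proof. by case: z => a b; apply: complex_ext; rewrite ?sqr_normcE /=; ring. Qed.

Lemma RCM (a b : R) : (a * b)%:C = a%:C * b%:C.
Proof. exact: (rmorphM (real_complex R)). Qed.
Lemma RCD (a b : R) : (a + b)%:C = a%:C + b%:C.
Proof. exact: (rmorphD (real_complex R)). Qed.
Lemma RCN (a : R) : (- a)%:C = - a%:C.
Proof. exact: (rmorphN (real_complex R)). Qed.
Lemma RCX (a : R) k : (a ^+ k)%:C = a%:C ^+ k.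
Proof. exact: (rmorphXn (real_complex R)). Qed.
Lemma RCV (a : R) : (a^-1)%:C = (a%:C)^-1.
Proof. exact: (fmorphV (real_complex R)). Qed.
Lemma RC_nat k : (k%:R : R)%:C = k%:R.
Proof. exact: (rmorph_nat (real_complex R)). Qed.
Lemma RC0 : (0 : R)%:C = 0. Proof. by []. Qed.
Lemma RC1 : (1 : R)%:C = 1. Proof. by []. Qed.
Definition RCE := (RCM, RCD, RCN, RCX, RCV, RC_nat, RC0, RC1).

End complex_basics.

Section complex_derive.
Context {R : realType} {V : normedModType R}.
Local Notation Re := complex.Re.
Local Notation Im := complex.Im.
Implicit Types (f g : V -> R[i]) (x v : V) (l m : R[i]).

(** Here [R[i]] is normed over itself while directions and increments are real, so derivatives are
    taken componentwise. *)
Definition cder f x v l : Prop :=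
  is_derive x v (fun y => Re (f y)) (Re l) /\ is_derive x v (fun y => Im (f y)) (Im l).

Lemma cder_eq f x v l m : cder f x v l -> l = m -> cder f x v m.
Proof. by move=> H <-. Qed.

Lemma cder_ext f g x v l : (forall y, f y = g y) -> cder f x v l -> cder g x v l.
Proof. by move=> /funext ->. Qed.

Lemma cder_cst x v (c : R[i]) : cder (fun=> c) x v 0.
Proof. by split; exact: der_cst. Qed.

Lemma cder_real (f : V -> R) x v (l : R) : is_derive x v f l ->
  cder (fun y => (f y)%:C) x v l%:C.
Proof. by move=> fl; split => //=; exact: der_cst. Qed.

Lemma cder_D f g x v l m : cder f x v l -> cder g x v m ->
  cder (fun y => f y + g y) x v (l + m).
Proof.
move=> [f1 f2] [g1 g2]; split; rewrite ReImE; under eq_fun do rewrite ReImE;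
  exact: der_D.
Qed.

Lemma cder_N f x v l : cder f x v l -> cder (fun y => - f y) x v (- l).
Proof.
move=> [f1 f2]; split; rewrite ReImE; under eq_fun do rewrite ReImE; exact: der_N.
Qed.

Lemma cder_B f g x v l m : cder f x v l -> cder g x v m ->
  cder (fun y => f y - g y) x v (l - m).
Proof. by move=> fl gm; apply: cder_D => //; exact: cder_N. Qed.

Lemma cder_M f g x v l m : cder f x v l -> cder g x v m ->
  cder (fun y => f y * g y) x v (l * g x + f x * m).
Proof.
move=> [f1 f2] [g1 g2]; split; under eq_fun do rewrite ReImE.
  by apply: (der_eq (der_B (der_M f1 g1) (der_M f2 g2))); rewrite !ReImE; ring.
by apply: (der_eq (der_D (der_M f1 g2) (der_M f2 g1))); rewrite !ReImE; ring.
Qed.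

Lemma cder_Zl (c : R[i]) f x v l : cder f x v l -> cder (fun y => c * f y) x v (c * l).
Proof.
by move=> fl; apply: (cder_eq (cder_M (cder_cst x v c) fl)); rewrite mul0r add0r.
Qed.

Lemma cder_X k f x v l : cder f x v l ->
  cder (fun y => f y ^+ k) x v (k%:R * f x ^+ k.-1 * l).
Proof.
move=> fl; elim: k => [|k IH].
  by apply: (cder_eq (cder_cst x v 1)); rewrite !mul0r.
apply: (@cder_ext (fun y => f y * f y ^+ k)) => [y|]; first by rewrite exprS.
apply: (cder_eq (cder_M fl IH)); case: k {IH} => [|k] /=; first by ring.
by rewrite -[k.+2%:R]natr1 exprS; ring.
Qed.

Lemma cder_J f x v l : cder f x v l -> cder (fun y => (f y)^*) x v l^*.
Proof.
move=> [f1 f2]; split; under eq_fun do rewrite ReImE; rewrite ReImE //; exact: der_N.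
Qed.

Lemma cder_sum n (F : 'I_n -> V -> R[i]) (dF : 'I_n -> R[i]) x v :
  (forall i, cder (F i) x v (dF i)) ->
  cder (fun y => \sum_(i < n) F i y) x v (\sum_(i < n) dF i).
Proof.
move=> H; elim: n => [|n IH] in F dF H *.
  by rewrite big_ord0; under eq_fun do rewrite big_ord0; exact: cder_cst.
rewrite big_ord_recr /=; apply: (@cder_ext
  (fun y => \sum_(i < n) F (widen_ord (leqnSn n) i) y + F ord_max y)).
  by move=> y; rewrite big_ord_recr.
by apply: cder_D; [exact: IH|exact: H].
Qed.

End complex_derive.

Lemma cder_line {R : realType} {V : normedModType R} (f : V -> R[i]) x v (t : R) l :
  cder f (x + t *: v) v l <-> cder (fun t : R => f (x + t *: v)) t 1 l.
Proof.
split=> -[h1 h2]; split.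
- exact: (is_derive_lineP (fun y => complex.Re (f y)) x v t _).1.
- exact: (is_derive_lineP (fun y => complex.Im (f y)) x v t _).1.
- exact: (is_derive_lineP (fun y => complex.Re (f y)) x v t _).2.
- exact: (is_derive_lineP (fun y => complex.Im (f y)) x v t _).2.
Qed.

Lemma cder_line0 {R : realType} {V : normedModType R} (f : V -> R[i]) x v l : cder f x v l <-> cder (fun t : R => f (x + t *: v)) 0 1 l.
Proof. by rewrite -cder_line scale0r addr0. Qed.


Section complex_continuity.
Context {R : realType} {T : topologicalType}.
Local Notation Re := complex.Re.
Local Notation Im := complex.Im.
Implicit Types f g : T -> R[i].

Definition ccont f : Prop :=
  continuous (fun y => Re (f y)) /\ continuous (fun y => Im (f y)).

Lemma ccont_cst (c : R[i]) : ccont (fun=> c).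
Proof. by split; exact: cont_cst. Qed.

Lemma ccont_real (f : T -> R) : continuous f -> ccont (fun y => (f y)%:C).
Proof. by move=> cf; split => //=; exact: cont_cst. Qed.

Lemma ccont_D f g : ccont f -> ccont g -> ccont (fun y => f y + g y).
Proof.
by move=> [f1 f2] [g1 g2]; split; under eq_fun do rewrite ReImE; exact: cont_D.
Qed.

Lemma ccont_M f g : ccont f -> ccont g -> ccont (fun y => f y * g y).
Proof.
move=> [f1 f2] [g1 g2]; split; under eq_fun do rewrite ReImE.
  by apply: cont_B; exact: cont_M.
by apply: cont_D; exact: cont_M.
Qed.

Lemma ccont_X k f : ccont f -> ccont (fun y => f y ^+ k).
Proof.
move=> cf; elim: k => [|k IH]; first exact: ccont_cst.
by under eq_fun do rewrite exprS; exact: ccont_M.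
Qed.

Lemma ccont_J f : ccont f -> ccont (fun y => (f y)^*).
Proof.
by move=> [f1 f2]; split; under eq_fun do rewrite ReImE; [exact: f1|exact: cont_N].
Qed.

Lemma ccont_sum n (F : 'I_n -> T -> R[i]) : (forall i, ccont (F i)) ->
  ccont (fun y => \sum_(i < n) F i y).
Proof.
elim: n => [|n IH] in F *; first by under eq_fun do rewrite big_ord0; move=> _; exact: ccont_cst.
by move=> cF; under eq_fun do rewrite big_ord_recr; apply: ccont_D; [exact: IH|exact: cF].
Qed.

End complex_continuity.

Section complex_series.
Context {R : realType}.
Local Notation Re := complex.Re.
Local Notation Im := complex.Im.
Implicit Types (u v : nat -> R[i]) (l m y h : R[i]) (a : nat -> R).

Definition csums u l : Prop :=
  (series (fun j => Re (u j)) n @[n --> \oo] --> Re l) /\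
  (series (fun j => Im (u j)) n @[n --> \oo] --> Im l).

Lemma csums_unique u l m : csums u l -> csums u m -> l = m.
Proof.
move=> [l1 l2] [m1 m2]; apply: complex_ext.
  exact: (cvg_unique (@Rhausdorff R) l1 m1).
exact: (cvg_unique (@Rhausdorff R) l2 m2).
Qed.

Lemma csums_ext u v l : (forall j, u j = v j) -> csums u l -> csums v l.
Proof. by move=> /funext ->. Qed.

Lemma csums_D u v l m : csums u l -> csums v m -> csums (fun j => u j + v j) (l + m).
Proof.
move=> [l1 l2] [m1 m2]; split; rewrite ReImE.
  rewrite (_ : series _ = (fun n => series (fun j => Re (u j)) n + series (fun j => Re (v j)) n)).
    exact: cvgD.
  by apply/funext => n; rewrite /series /= -big_split; apply: eq_bigr => j _; rewrite /= ReImE.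
rewrite (_ : series _ = (fun n => series (fun j => Im (u j)) n + series (fun j => Im (v j)) n)).
  exact: cvgD.
by apply/funext => n; rewrite /series /= -big_split; apply: eq_bigr => j _; rewrite /= ReImE.
Qed.

Lemma csums_Z (c : R[i]) u l : csums u l -> csums (fun j => c * u j) (c * l).
Proof.
move=> [l1 l2]; split; rewrite ReImE.
  rewrite (_ : series _ = (fun n => Re c * series (fun j => Re (u j)) n -
     Im c * series (fun j => Im (u j)) n)).
    by apply: cvgB; apply: cvgMr.
  apply/funext => n; rewrite /series /= !mulr_sumr -sumrB.
  by apply: eq_bigr => j _; rewrite ReImE.
rewrite (_ : series _ = (fun n => Re c * series (fun j => Im (u j)) n +
   Im c * series (fun j => Re (u j)) n)).
  by apply: cvgD; apply: cvgMr.
apply/funext => n; rewrite /series /= !mulr_sumr -big_split.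
by apply: eq_bigr => j _; rewrite /= ReImE.
Qed.

Lemma cvg_series_shift (w : nat -> R) (c : R) :
  series (fun j => w j.+1) n @[n --> \oo] --> c <->
  series w n @[n --> \oo] --> w 0%N + c.
Proof.
rewrite -(cvg_shiftS (series w)).
have -> : [sequence series w n.+1]_n = (fun n => w 0%N + series (fun j => w j.+1) n).
  apply/funext => n; rewrite /series /= !big_mkord big_ord_recl; congr (_ + _).
split => H; first by apply: cvgD => //; exact: cvg_cst.
have -> : c = w 0%N + c - w 0%N by rewrite addrAC subrr add0r.
have -> : series (fun j => w j.+1) = (fun n => w 0%N + series (fun j => w j.+1) n - w 0%N).
  by apply/funext => n; rewrite addrAC subrr add0r.
by apply: cvgB => //; exact: cvg_cst.
Qed.

Lemma csums_shift u l : csums (fun j => u j.+1) l <-> csums u (u 0%N + l).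
Proof.
rewrite /csums !ReImE -(cvg_series_shift (fun j => Re (u j))).
by rewrite -(cvg_series_shift (fun j => Im (u j))).
Qed.

(** Comparison with the exponential series; the factor 2 comes from estimating the real and
    imaginary parts separately. *)
Lemma csums_dominated (M rho : R) u l : 0 <= M -> 0 <= rho ->
  (forall j, normc (u j) <= M * (rho ^+ j / j`!%:R)) -> csums u l ->
  normc l <= 2 * (M * expR rho).
Proof.
move=> M0 rho0 uM [l1 l2].
have ps n : series (exp_coeff rho) n <= expR rho.
  apply: nondecreasing_cvgn_le; last exact: is_cvg_series_exp_coeff.
  by apply: nondecreasing_series => j _ _; exact: exp_coeff_ge0.
have bnd (w : nat -> R) n : (forall j, `|w j| <= normc (u j)) -> `|series w n| <= M * expR rho.
  move=> wu; apply: (@le_trans _ _ (M * series (exp_coeff rho) n)); last by rewrite ler_wpM2l.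
  rewrite /series /= mulr_sumr (le_trans (ler_norm_sum _ _ _))//.
  by apply: ler_sum => j _; exact: le_trans (wu j) (uM j).
rewrite (le_trans (normc_le_add _))// (_ : 2 * _ = M * expR rho + M * expR rho); last by ring.
apply: lerD.
  apply: (cvgr_to_le (cvg_norm l1)); apply: nearW => n; apply: bnd => j; exact: normRe_le.
apply: (cvgr_to_le (cvg_norm l2)); apply: nearW => n; apply: bnd => j; exact: normIm_le.
Qed.

(** Domination by the exponential series gives convergence in the whole plane, and the condition is
    inherited by the coefficients of the derivative. *)
Definition ecoef a := forall j, `|a j| <= (j`!%:R)^-1.
Definition dcoef a (j : nat) : R := j.+1%:R * a j.+1.

Lemma ecoef_d a : ecoef a -> ecoef (dcoef a).
Proof.
move=> ea j; rewrite /dcoef normrM normr_nat.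
apply: (@le_trans _ _ (j.+1%:R * (j.+1`!%:R)^-1)); first by rewrite ler_wpM2l.
by rewrite factS natrM invfM mulVKf.
Qed.

Definition eseries a y : R[i] :=
  (limn (series (fun j => Re ((a j)%:C * y ^+ j)))) +i*
  (limn (series (fun j => Im ((a j)%:C * y ^+ j)))).

Lemma eterm_le a y j : ecoef a -> normc ((a j)%:C * y ^+ j) <= normc y ^+ j / j`!%:R.
Proof.
move=> ea; rewrite normcM normcR normcX mulrC ler_wpM2l// exprn_ge0// normc_ge0//.
Qed.

Lemma csums_eseries a y : ecoef a -> csums (fun j => (a j)%:C * y ^+ j) (eseries a y).
Proof.
move=> ea.
have H (w : nat -> R) : (forall j, `|w j| <= normc ((a j)%:C * y ^+ j)) -> cvgn (series w).
  move=> wu; apply: normed_cvg; apply: (@series_le_cvg _ _ (exp_coeff (normc y))) => //.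
  - by move=> j /=.
  - by move=> j; apply: exp_coeff_ge0; exact: normc_ge0.
  - by move=> j; rewrite /= (le_trans (wu j))// eterm_le.
  - exact: is_cvg_series_exp_coeff.
by split; apply: H => j; [exact: normRe_le|exact: normIm_le].
Qed.

Lemma eseries0 a : ecoef a -> eseries a 0 = (a 0%N)%:C.
Proof.
move=> ea; apply: (csums_unique (csums_eseries 0 ea)).
rewrite -[X in csums _ X]addr0 -[X in X + _](_ : (a 0%N)%:C * 0 ^+ 0 = _); last by rewrite expr0 mulr1.
apply/(@csums_shift (fun j => (a j)%:C * 0 ^+ j)).
apply: (csums_ext (u := fun=> 0)) => [j|]; first by rewrite expr0n mulr0.
have E : series (fun=> 0 : R) = fun=> 0.
  by apply/funext => n; rewrite /series /= big1.
by split => /=; rewrite E; exact: cvg_cst.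
Qed.

Lemma csums_deseries a y : ecoef a ->
  csums (fun j => (a j)%:C * (j%:R * y ^+ j.-1)) (eseries (dcoef a) y).
Proof.
move=> ea; rewrite -[X in csums _ X]add0r.
rewrite -[X in X + _](_ : (a 0%N)%:C * (0%:R * y ^+ 0.-1) = _); last by rewrite mul0r mulr0.
apply/(@csums_shift (fun j => (a j)%:C * (j%:R * y ^+ j.-1))).
apply: csums_ext (csums_eseries y (ecoef_d ea)) => j.
by rewrite /dcoef /= rmorphM /= rmorph_nat; ring.
Qed.

(** The growth in [k] is only geometric, so that summation against [1 / k!] yields
    [expR (2 * rho)]. *)
Lemma taylor_exprn_le y h (rho : R) k : 1 <= rho -> normc y + normc h <= rho ->
  normc ((y + h) ^+ k - y ^+ k - h * (k%:R * y ^+ k.-1)) <= normc h ^+ 2 * (2 * rho) ^+ k.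
Proof.
move=> rho1 yh; have n0 := @normc_ge0 R.
elim: k => [|k IH].
  by rewrite !expr0 subrr mul0r mulr0 subr0 normc0 mulr1 sqr_ge0.
(* The remainders satisfy [r_(k+1) = (y + h) r_k + k h^2 y^(k-1)]; the bound follows with [k <= 2^k]
   and [1 <= rho]. *)
have -> : (y + h) ^+ k.+1 - y ^+ k.+1 - h * (k.+1%:R * y ^+ k.+1.-1) =
  (y + h) * ((y + h) ^+ k - y ^+ k - h * (k%:R * y ^+ k.-1)) +
  k%:R * h ^+ 2 * y ^+ k.-1.
  case: k {IH} => [|k] /=; first by ring.
  by rewrite -[k.+2%:R]natr1 !exprS; ring.
have r0 : 0 <= rho by lra.
have yr : normc y <= rho by have := n0 h; lra.
apply: (le_trans (normcD _ _)).
apply: (@le_trans _ _ (rho * (normc h ^+ 2 * (2 * rho) ^+ k) + k%:R * normc h ^+ 2 * rho ^+ k)).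
  apply: lerD.
    by rewrite normcM ler_pM// (le_trans (normcD _ _)).
  rewrite !normcM !normcX normc_nat ler_wpM2l ?mulr_ge0 ?exprn_ge0//.
  apply: (@le_trans _ _ (rho ^+ k.-1)); first by rewrite lerXn2r// nnegrE.
  by rewrite ler_weXn2l// leq_pred.
have -> : (2 * rho) ^+ k.+1 = 2 * 2 ^+ k * rho ^+ k.+1 by rewrite exprMn (exprS 2).
have -> : (2 * rho) ^+ k = 2 ^+ k * rho ^+ k by rewrite exprMn.
have kk : k%:R <= 2 ^+ k :> R by rewrite -natrX ler_nat ltnW// ltn_expl.
have rk : rho ^+ k <= rho ^+ k.+1 by rewrite ler_weXn2l.
have h2 : 0 <= normc h ^+ 2 by exact: sqr_ge0.
have rk0 : 0 <= rho ^+ k by exact: exprn_ge0.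
have p2 : 0 <= 2 ^+ k :> R by exact: exprn_ge0.
rewrite -subr_ge0.
have -> : normc h ^+ 2 * (2 * 2 ^+ k * rho ^+ k.+1) -
  (rho * (normc h ^+ 2 * (2 ^+ k * rho ^+ k)) + k%:R * normc h ^+ 2 * rho ^+ k) =
  normc h ^+ 2 * ((2 ^+ k - k%:R) * rho ^+ k + 2 ^+ k * (rho ^+ k.+1 - rho ^+ k)).
  by rewrite (exprS rho); ring.
by rewrite mulr_ge0// addr_ge0// mulr_ge0// subr_ge0.
Qed.

Lemma eseries_taylor a y h (rho : R) : ecoef a -> 1 <= rho -> normc y + normc h <= rho ->
  normc (eseries a (y + h) - eseries a y - h * eseries (dcoef a) y) <=
  2 * (normc h ^+ 2 * expR (2 * rho)).
Proof.
move=> ea rho1 yh.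
have s1 := csums_eseries (y + h) ea; have s2 := csums_Z (-1) (csums_eseries y ea).
have s3 := csums_Z (- h) (csums_deseries y ea).
have := csums_D (csums_D s1 s2) s3; rewrite mulN1r mulNr => s4.
apply: (csums_dominated _ _ _ s4); first exact: sqr_ge0.
  by rewrite mulr_ge0//; lra.
move=> j.
have -> : (a j)%:C * (y + h) ^+ j + -1 * ((a j)%:C * y ^+ j) +
   - h * ((a j)%:C * (j%:R * y ^+ j.-1)) =
   (a j)%:C * ((y + h) ^+ j - y ^+ j - h * (j%:R * y ^+ j.-1)) by ring.
rewrite normcM normcR [leLHS]mulrC [leRHS]mulrA.
by apply: ler_pM => //; [exact: normc_ge0|exact: taylor_exprn_le].
Qed.

End complex_series.

Section entire_chain_rule.
Context {R : realType}.
Local Notation Re := complex.Re.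
Local Notation Im := complex.Im.
Implicit Types (a : nat -> R).

Lemma cder_eseries1 a (f : R -> R[i]) (t : R) (l : R[i]) : ecoef a -> cder f t 1 l ->
  cder (fun s => eseries a (f s)) t 1 (eseries (dcoef a) (f t) * l).
Proof.
move=> ea [/der_cvgP f1 /der_cvgP f2].
set E' := eseries (dcoef a) (f t).
pose qR h := h^-1 * (Re (f (t + h)) - Re (f t)).
pose qI h := h^-1 * (Im (f (t + h)) - Im (f t)).
pose D h := f (t + h) - f t.
pose rem h := eseries a (f t + D h) - eseries a (f t) - D h * E'.
pose rho := normc (f t) + 1.
pose K := expR (2 * rho).
have rho1 : 1 <= rho by rewrite /rho lerDr normc_ge0.
have hid : (fun h : R => h) h @[h --> 0^'] --> (0 : R).
  by apply: (@cvg_trans _ (nbhs 0)); [exact: cvg_within|exact: cvg_id].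
have hnorm : `|h| @[h --> (0 : R)^'] --> (0 : R).
  have := cvg_norm hid; rewrite normr0; exact.
have q2 : qR h ^+ 2 + qI h ^+ 2 @[h --> 0^'] --> Re l ^+ 2 + Im l ^+ 2.
  by apply: cvgD; apply: cvg_exprn.
have hq : h ^+ 2 * (qR h ^+ 2 + qI h ^+ 2) @[h --> 0^'] --> (0 : R).
  have := cvgM (cvg_exprn (k := 2) hid) q2; rewrite expr0n mul0r; exact.
have DE h : h != 0 -> normc (D h) ^+ 2 = h ^+ 2 * (qR h ^+ 2 + qI h ^+ 2).
  move=> h0; rewrite sqr_normcE /D !ReImE /qR /qI; field; exact: h0.
have D1 : \forall h \near 0^', normc (D h) <= 1.
  have : \forall h \near 0^', h ^+ 2 * (qR h ^+ 2 + qI h ^+ 2) <= 1.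
    by apply: (cvgr_le (0 : R) hq); exact: ltr01.
  move=> H; near=> h; rewrite -(@ler_pXn2r _ 2)// ?nnegrE ?normc_ge0//.
  rewrite expr1n DE; first by near: h; exact: H.
  by near: h; exact: nbhs_dnbhs_neq.
(* The Taylor remainder is [O(|D h|^2)] and [|D h|^2] is [h^2] times a convergent quantity, so
   dividing by [h] still leaves a factor [|h|]. *)
have small (P : R[i] -> R) : (forall z, `|P z| <= normc z) ->
    h^-1 * P (rem h) @[h --> 0^'] --> (0 : R).
  move=> PN; apply/norm_cvg0P.
  apply: (@squeeze_cvgr _ _ _ _ (fun=> 0) (fun h => 2 * K * (`|h| * (qR h ^+ 2 + qI h ^+ 2)))).
  - near=> h; rewrite normr_ge0 /=.
    have h0 : h != 0 by near: h; exact: nbhs_dnbhs_neq.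
    have Dh : normc (D h) <= 1 by near: h; exact: D1.
    rewrite normrM normfV mulrC ler_pdivrMr ?normr_gt0// (le_trans (PN _))//.
    apply: (le_trans (@eseries_taylor _ a (f t) (D h) rho ea rho1 _)).
      by rewrite /rho lerD2l.
    rewrite DE// -/K -(@real_normK _ h) ?num_real//; lra.
  - exact: cvg_cst.
  - have := cvgMr (a := 2 * K) (cvgM hnorm q2); rewrite mul0r mulr0; exact.
have remE h : eseries a (f (t + h)) = eseries a (f t) + D h * E' + rem h.
  have -> : f (t + h) = f t + D h by rewrite [RHS]addrC subrK.
  by rewrite /rem; move: (eseries a (f t)) (eseries a _) => U W; ring.
split; apply/der_cvgP.
  rewrite (_ : (fun h => _) = (fun h => (qR h * Re E' - qI h * Im E') + h^-1 * Re (rem h))).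
    rewrite (_ : Re (E' * l) = Re l * Re E' - Im l * Im E' + 0); last first.
      by rewrite ReImE addr0; ring.
    apply: cvgD; last by apply: small; exact: normRe_le.
    by apply: cvgB; apply: cvgMl.
  apply/funext => h; rewrite remE; move: (rem h) (eseries a (f t)) => U W.
  rewrite /D !(ReD, ImD, ReM, ImM, ReN, ImN) /qR /qI; ring.
rewrite (_ : (fun h => _) = (fun h => (qR h * Im E' + qI h * Re E') + h^-1 * Im (rem h))).
  rewrite (_ : Im (E' * l) = Re l * Im E' + Im l * Re E' + 0); last first.
    by rewrite ReImE addr0; ring.
  apply: cvgD; last by apply: small; exact: normIm_le.
  by apply: cvgD; apply: cvgMl.
apply/funext => h; rewrite remE; move: (rem h) (eseries a (f t)) => U W.
  rewrite /D !(ReD, ImD, ReM, ImM, ReN, ImN) /qR /qI; ring.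
Unshelve. all: by end_near. Qed.

Lemma cder_eseries {V : normedModType R} a (f : V -> R[i]) x v (l : R[i]) :
  ecoef a -> cder f x v l ->
  cder (fun y => eseries a (f y)) x v (eseries (dcoef a) (f x) * l).
Proof.
move=> ea /cder_line0 fl; apply/cder_line0.
by have := cder_eseries1 ea fl; rewrite scale0r addr0.
Qed.

Lemma ccont_eseries {T : topologicalType} a (f : T -> R[i]) : ecoef a -> ccont f ->
  ccont (fun y => eseries a (f y)).
Proof.
move=> ea [f1 f2].
suff H (P : R[i] -> R) : (forall z, `|P z| <= normc z) -> (forall z w, P (z - w) = P z - P w) ->
    continuous (fun y => P (eseries a (f y))).
  by split; apply: H; [exact: normRe_le|exact: ReB|exact: normIm_le|exact: ImB].
move=> PN PB x.
pose D y := f y - f x.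
pose rho := normc (f x) + 1.
pose K := expR (2 * rho).
have rho1 : 1 <= rho by rewrite /rho lerDr normc_ge0.
pose L := normc (eseries (dcoef a) (f x)).
have Dn : normc (D y) @[y --> x] --> (0 : R).
  apply: (@squeeze_cvgr _ _ _ _ (fun=> 0) (fun y => `|Re (f y) - Re (f x)| + `|Im (f y) - Im (f x)|)).
  - near=> y; rewrite normc_ge0 /=.
    by rewrite (le_trans (normc_le_add _))// /D !ReImE.
  - exact: cvg_cst.
  - have cn (g : T -> R) : continuous g -> continuous (fun y : T => `|g y - g x| : R).
      by move=> cg; apply: (cont_comp (@norm_continuous _ R)); apply: cont_B => //; exact: cont_cst.
    by have := @cont_D _ _ _ _ (cn _ f1) (cn _ f2) x; rewrite /continuous_at !subrr !normr0 addr0.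
have D1 : \forall y \near x, normc (D y) <= 1.
  by apply: (cvgr_le (0 : R) Dn); exact: ltr01.
apply/subr_cvg0/norm_cvg0P.
apply: (@squeeze_cvgr _ _ _ _ (fun=> 0) (fun y => 2 * (normc (D y) ^+ 2 * K) + normc (D y) * L)).
- near=> y; rewrite normr_ge0 /= -PB (le_trans (PN _))//.
  have Dy : normc (D y) <= 1 by near: y; exact: D1.
  rewrite -/(eseries _ _) (_ : f y = f x + D y); last by rewrite /D; ring.
  have -> : eseries a (f x + D y) - eseries a (f x) =
    (eseries a (f x + D y) - eseries a (f x) - D y * eseries (dcoef a) (f x)) +
     D y * eseries (dcoef a) (f x) by rewrite subrK.
  rewrite (le_trans (normcD _ _))// lerD//; last by rewrite normcM.
  by apply: eseries_taylor => //; rewrite /rho lerD2l.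
- exact: cvg_cst.
- have := cvgD (cvgMr (a := 2) (cvgMl (b := K) (cvg_exprn (k := 2) Dn))) (cvgMl (b := L) Dn).
  rewrite expr0n !mul0r mulr0 addr0; exact.
Unshelve. all: by end_near. Qed.

End entire_chain_rule.

Section bessel.
Context {R : realType}.

(* The coefficients of 0F1(; n / 2; y / 4). *)
Fixpoint bcoef (n j : nat) : R :=
  if j is i.+1 then bcoef n i / (i.+1%:R * (4 * i%:R + 2 * n%:R)) else 1.

Lemma ecoef_bcoef n : (0 < n)%N -> ecoef (bcoef n).
Proof.
move=> n0 j; elim: j => [|j IH]; first by rewrite fact0 invr1 normr1.
have h : 1 <= 4 * j%:R + 2 * n%:R :> R.
  have := ler0n R j; have : 1 <= n%:R :> R by rewrite ler1n.
  by move=> *; lra.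
have j1 : 0 < j.+1%:R :> R by [].
have -> : (j.+1`!%:R)^-1 = (j`!%:R)^-1 * j.+1%:R^-1 :> R.
  by rewrite factS natrM invfM mulrC.
rewrite /= normrM ler_pM//.
rewrite normfV normrM normr_nat ger0_norm; last by lra.
by rewrite lef_pV2 ?posrE ?mulr_gt0//; [rewrite ler_peMr ?ler0n|lra].
Qed.

Definition bfun n (y : R[i]) := eseries (bcoef n) y.
Definition bfun' n (y : R[i]) := eseries (dcoef (bcoef n)) y.
Definition bfun'' n (y : R[i]) := eseries (dcoef (dcoef (bcoef n))) y.

(** The coefficient of [y^j] on the left is [(4 j + 2 n) (j + 1) a_(j+1)], which is [a_j] by the
    recurrence of [bcoef]. *)
Lemma bfun_ode n y : (0 < n)%N ->
  4 * y * bfun'' n y + 2 * n%:R * bfun' n y = bfun n y.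
Proof.
move=> n0; have e0 := ecoef_bcoef n0; have e1 := ecoef_d e0.
have s0 := csums_eseries y e0; have s1 := csums_eseries y e1.
have s2 := csums_Z (4 * y) (csums_deseries y e1).
apply: csums_unique s0.
apply: csums_ext (csums_D s2 (csums_Z (2 * n%:R) s1)) => j.
have -> : (bcoef n j)%:C = (dcoef (bcoef n) j)%:C * (4 * j%:R + 2 * n%:R) :> R[i].
  rewrite -(rmorph_nat (real_complex R) j) -(rmorph_nat (real_complex R) n).
  rewrite -(rmorph_nat (real_complex R) 4) -(rmorph_nat (real_complex R) 2).
  rewrite -!rmorphM -rmorphD -rmorphM; congr (_%:C).
  rewrite /dcoef /=; field.
  apply/andP; split; last by [].
  apply: lt0r_neq0; have := ler0n R j; have : 1 <= n%:R :> R by rewrite ler1n.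
  by move=> *; lra.
case: j => [|j] /=; first by rewrite !expr0; ring.
by rewrite exprS; ring.
Qed.

Lemma bfun0 n : (0 < n)%N -> bfun n 0 = 1.
Proof. by move=> n0; rewrite /bfun eseries0//; exact: ecoef_bcoef. Qed.

End bessel.

(** * The radial Bessel function *)

Section inverse.
Context {R : realType} {V : normedModType R}.
Local Notation Re := complex.Re.
Local Notation Im := complex.Im.

Lemma der_V (f : V -> R) (x v : V) (df : R) : f x != 0 -> is_derive x v f df ->
  is_derive x v (fun y => (f y)^-1) (- (f x ^- 2 * df)).
Proof.
move=> fx [d1 <-]; split; first exact: derivableV.
by rewrite deriveV// -mulNr.
Qed.

Lemma cder_V (f : V -> R[i]) (x v : V) (l : R[i]) : f x != 0 -> cder f x v l ->
  cder (fun y => (f y)^-1) x v (- (l / f x ^+ 2)).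
Proof.
move=> fx fl; have [f1 f2] := fl.
pose D y := Re (f y) ^+ 2 + Im (f y) ^+ 2.
have D0 : D x != 0 by rewrite /D -sqr_normcE expf_neq0// normc_eq0.
have fE y : (f y)^-1 = (f y)^* * ((D y)^-1)%:C.
  have [->|fy] := eqVneq (f y) 0.
    by rewrite invr0; apply: complex_ext; rewrite !ReImE !(mul0r, mulr0, oppr0, subr0, addr0).
  have Dy : D y != 0 by rewrite /D -sqr_normcE expf_neq0// normc_eq0.
  apply: (mulfI fy); rewrite mulfV// mulrA normcJM sqr_normcE -RCM mulfV//.
have dD := der_D (der_X 2 f1) (der_X 2 f2).
have := cder_M (cder_J fl) (cder_real (der_V D0 dD)).
move=> H; apply: (@cder_ext _ _ (fun y => (f y)^* * ((D y)^-1)%:C)) => //.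
apply: (cder_eq H).
have DE : (D x)%:C = f x * (f x)^* by rewrite normcJM sqr_normcE.
clear H; move: DE D0; move: (D x) => d DE d0; rewrite !RCE.
have fJ : (f x)^* != 0 by rewrite -normc_eq0 normcJ normc_eq0.
have -> : 2%:R * (Re (f x))%:C ^+ 1 * (Re l)%:C + 2%:R * (Im (f x))%:C ^+ 1 * (Im l)%:C =
   f x * l^* + (f x)^* * l :> R[i].
  by apply: complex_ext; rewrite !expr1 !ReImE; ring.
rewrite DE; field; by rewrite fx fJ.
Qed.

End inverse.

Section bessel_ray.
Context {R : realType}.
Local Notation Re := complex.Re.
Local Notation Im := complex.Im.
Variables (n : nat) (z : R[i]).
Hypothesis n0 : (0 < n)%N.
Hypothesis z0 : 0 < Re z.

Let N := n.+1.
(** The index is [n + 1]: the chain rule turns [4 y F'' + 2 (n + 1) F' = F] into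
    [f'' + (n / r) f' = z^2 f]. *)
Definition bray (r : R) : R[i] := bfun N (z ^+ 2 * (r ^+ 2)%:C).
Definition dbray (r : R) : R[i] := 2 * z ^+ 2 * r%:C * bfun' N (z ^+ 2 * (r ^+ 2)%:C).
(** The second derivative of [bray], with [(n / r) f'] written without division so that it also
    makes sense at [r = 0]. *)
Let h (r : R) : R[i] := z ^+ 2 * bray r - 2 * n%:R * z ^+ 2 * bfun' N (z ^+ 2 * (r ^+ 2)%:C).

Let eN : ecoef (@bcoef R N) := ecoef_bcoef (ltn0Sn n).

Let arg r : cder (fun r : R => z ^+ 2 * (r ^+ 2)%:C) r 1 (z ^+ 2 * (2 * r)%:C).
Proof.
apply: cder_Zl; apply: cder_real.
by apply: (der_eq (der_X 2 (der_id r 1))); rewrite /= expr1 mulr1.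
Qed.

Lemma cder_bray r : cder bray r 1 (dbray r).
Proof.
apply: (cder_eq (cder_eseries eN (arg r))).
by rewrite /dbray /bfun' !RCE; ring.
Qed.

Lemma cder_dbray r : cder dbray r 1 (h r).
Proof.
have h1 := cder_eseries (ecoef_d eN) (arg r).
have h2 := cder_Zl (2 * z ^+ 2) (cder_real (der_id r 1)).
apply: (cder_eq (cder_M h2 h1)).
have ode := bfun_ode (z ^+ 2 * (r ^+ 2)%:C) (ltn0Sn n).
rewrite /h /bray -/N -ode -/(bfun'' _ _) -/(bfun' _ _) !RCE.
have NE : N%:R = n%:R + 1 :> R[i] by rewrite natr1.
rewrite NE; ring.
Qed.

Lemma bray0 : bray 0 = 1.
Proof. by rewrite /bray expr0n mulr0 bfun0. Qed.

Let E (r : R) : R := Re ((r ^+ n)%:C * z^* * (dbray r * (bray r)^*)).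

Let dE (r : R) : is_derive r 1 E (r ^+ n * (Re z * (normc z ^+ 2 * normc (bray r) ^+ 2 + normc (dbray r) ^+ 2))).
Proof.
have h1 := cder_real (der_X n (der_id r 1)).
have h2 := cder_M h1 (cder_cst r 1 z^*).
have [h3 _] := cder_M h2 (cder_M (cder_dbray r) (cder_J (cder_bray r))).
apply: (der_eq h3).
set F := bray r; set G := dbray r.
(* Multiplied by [r^n], the damping term of the equation cancels the derivative of the weight [r^n];
   only nonnegative terms are left in the derivative of the energy. *)
have hG : (r ^+ n)%:C * h r = (r ^+ n)%:C * z ^+ 2 * F - n%:R * (r ^+ n.-1)%:C * G.
  rewrite /h /G /dbray -/F; case: n n0 => // m _ /=.
  rewrite !RCE exprS; ring.
have -> : ((n%:R * r ^+ n.-1 * 1)%:C * z^* + (r ^+ n)%:C * 0) * (G * F^*) +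
  (r ^+ n)%:C * z^* * (h r * F^* + G * G^*) =
  (n%:R * r ^+ n.-1)%:C * z^* * (G * F^*) + z^* * (((r ^+ n)%:C * h r) * F^*) +
  (r ^+ n)%:C * z^* * (G * G^*) by rewrite mulr1; ring.
rewrite hG RCM RC_nat.
have -> : n%:R * (r ^+ n.-1)%:C * z^* * (G * F^*) +
  z^* * (((r ^+ n)%:C * z ^+ 2 * F - n%:R * (r ^+ n.-1)%:C * G) * F^*) +
  (r ^+ n)%:C * z^* * (G * G^*) =
  (r ^+ n)%:C * (z * (z * z^*) * (F * F^*) + z^* * (G * G^*)) by ring.
rewrite !normcJM; move: (normc z ^+ 2) (normc F ^+ 2) (normc G ^+ 2) => u v w.
by rewrite !ReImE; ring.
Qed.

Let E0 : E 0 = 0.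
Proof. by rewrite /E expr0n eqn0Ngt n0 /= !mul0r. Qed.

Let E_mono (s r : R) : 0 <= s <= r -> E s <= E r.
Proof.
move=> /andP[s0 sr].
have [||c cab EE] := @MVT_segment R E (fun r => r ^+ n * (Re z * (normc z ^+ 2 * normc (bray r) ^+ 2 + normc (dbray r) ^+ 2))) s r sr.
- by move=> *; exact: dE.
- apply: derivable_within_continuous => t _; by have [] := dE t.
rewrite -subr_ge0 EE mulr_ge0 ?subr_ge0// mulr_ge0//.
  have /andP[sc _] : s <= c <= r by move: cab; rewrite in_itv.
  exact/exprn_ge0/(le_trans s0 sc).
apply: mulr_ge0; first exact: ltW.
by apply: addr_ge0; [apply: mulr_ge0; exact: sqr_ge0|exact: sqr_ge0].
Qed.

(** Strictness comes from the origin: [bray 0 = 1], so [bray] is nonzero on some interval, where the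
    energy increases strictly from [E 0 = 0]; monotonicity does the rest. *)
Let E_gt0 (r : R) : 0 < r -> 0 < E r.
Proof.
move=> r0.
have cf : {for 0, continuous (fun r => Re (bray r))}.
  by have [f1 _] := cder_bray 0; exact: der_cont f1.
have : \forall s \near (0 : R), 0 < Re (bray s).
  have : 0 < Re (bray 0) by rewrite bray0.
  by move=> H; exact: (cvgr_gt _ cf _ H).
move=> [e /= e0 He].
pose s := Num.min r (e / 2).
have s0 : 0 < s by rewrite lt_min r0 divr_gt0.
have sr : s <= r by rewrite ge_min lexx.
have se : s < e by rewrite (@le_lt_trans _ _ (e / 2))// ?ge_min ?lexx ?orbT// ltr_pdivrMr//; lra.
have [||c cab EE] := @MVT R E (fun r => r ^+ n * (Re z * (normc z ^+ 2 * normc (bray r) ^+ 2 + normc (dbray r) ^+ 2))) 0 s s0.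
- by move=> *; exact: dE.
- apply: derivable_within_continuous => t _; by have [] := dE t.
apply: lt_le_trans (E_mono (_ : 0 <= s <= r)); last by rewrite ltW.
have -> : E s = E s - E 0 by rewrite E0 subr0.
rewrite EE subr0.
have /andP[c0 cs] : 0 < c < s by move: cab; rewrite in_itv.
apply: mulr_gt0 => //; apply: mulr_gt0; first exact: exprn_gt0.
apply: mulr_gt0 => //; apply: ltr_wpDr; first exact: sqr_ge0.
have zn : 0 < normc z by rewrite normc_gt0; apply: contraTneq z0 => ->; rewrite /= ltxx.
have fc : 0 < normc (bray c).
  have fp : 0 < Re (bray c).
    by apply: He; rewrite /ball_ /= sub0r normrN gtr0_norm// (lt_trans cs se).
  by rewrite normc_gt0; apply: contraTneq fp => ->; rewrite /= ltxx.
by move: (normc z) (normc (bray c)) zn fc => u v u0 v0; rewrite mulr_gt0// exprn_gt0.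
Qed.

(* Hence f has no zero on the ray and f' / (z f) lies in the right half-plane. *)
Lemma bray_Re_gt0 (r : R) : 0 < r -> 0 < Re (z^* * (dbray r * (bray r)^*)).
Proof.
move=> r0; have := E_gt0 r0; rewrite /E -mulrA ReM ReC ImC mul0r subr0.
by rewrite pmulr_rgt0// exprn_gt0.
Qed.

Lemma bray_neq0 (r : R) : 0 < r -> bray r != 0.
Proof.
move=> r0; apply: contraTneq (bray_Re_gt0 r0) => ->.
move: (dbray r) => w; rewrite -leNgt !ReImE /=.
by rewrite oppr0 !(mulr0, subr0, addr0).
Qed.

Let a r := dbray r + z * bray r.
Let b r := dbray r - z * bray r.
(* The Cayley transform of f' / (z f). *)
Definition zray r : R[i] := b r / a r.

(** This polarization identity converts positivity of the energy into [|b| < |a|], that is, into the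
    bound on [zray]. *)
Let normab (r : R) :
  normc (a r) ^+ 2 - normc (b r) ^+ 2 = 4 * Re (z^* * (dbray r * (bray r)^*)).
Proof.
rewrite /a /b; move: (dbray r) (bray r) => u v.
by rewrite !sqr_normcE !ReImE; ring.
Qed.

Lemma bray_add_neq0 (r : R) : 0 < r -> dbray r + z * bray r != 0.
Proof.
move=> r0; rewrite -normc_gt0 -(@ltr_pXn2r _ 2)// ?nnegrE ?normc_ge0// expr0n /=.
have := normab r; have := bray_Re_gt0 r0; have := sqr_ge0 (normc (b r)).
rewrite -/(a r); move: (Re _) (normc (a r) ^+ 2) (normc (b r) ^+ 2) => u v w; lra.
Qed.

Lemma zray_le1 (r : R) : 0 < r -> normc (zray r) <= 1.
Proof.
move=> r0; have a0 := bray_add_neq0 r0; rewrite /zray normcM normcV.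
rewrite ler_pdivrMr ?normc_gt0// mul1r -(@ler_pXn2r _ 2)// ?nnegrE ?normc_ge0//.
have := normab r; have := bray_Re_gt0 r0.
rewrite -/(a r); move: (Re _) (normc (a r) ^+ 2) (normc (b r) ^+ 2) => u v w; lra.
Qed.

(** The second-order linear equation becomes a Riccati equation of first order, in which the term
    [- 2 z zeta] contracts when [0 < Re z]. *)
Lemma cder_zray (r : R) : 0 < r ->
  cder zray r 1 (- (2 * z * zray r) - n%:R / (2 * r%:C) * (1 - zray r ^+ 2)).
Proof.
move=> r0; have a0 : a r != 0 by exact: bray_add_neq0.
have rC0 : r%:C != 0 :> R[i] by rewrite -normc_eq0 normcR normr_eq0 gt_eqF.
have hb := cder_B (cder_dbray r) (cder_Zl z (cder_bray r)).
have ha := cder_D (cder_dbray r) (cder_Zl z (cder_bray r)).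
apply: (cder_eq (cder_M hb (cder_V a0 ha))).
have hE : h r = z ^+ 2 * bray r - n%:R / r%:C * dbray r.
  by rewrite /h /dbray; field.
have z1 : z != 0 by apply: contraTneq z0 => ->; rewrite /= ltxx.
have Bu : bray r = (a r - b r) / (2 * z).
  by rewrite /a /b; move: (bray r) (dbray r) => ? ?; field.
have Du : dbray r = (a r + b r) / 2.
  by rewrite /a /b; move: (bray r) (dbray r) => ? ?; field.
rewrite hE; cbv beta.
rewrite -/(a r) -/(b r) (_ : zray r = b r / a r)// Bu Du.
move: a0; move: (a r) (b r) => u v u0; field.
by rewrite rC0 u0 z1.
Qed.

End bessel_ray.

(** * Asymptotics of the Riccati solution and of the logarithmic derivative *)

Section bessel_asymptotics.
Context {R : realType}.
Local Notation Re := complex.Re.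
Local Notation Im := complex.Im.

(** Sixth power of [X / 6 <= expR (X / 6)]. The exponent is that of the squared error [O(X^-6)] in
    [eta1_le], so the memory of the initial value is absorbed. *)
Lemma expRN_le (X : R) : 0 < X -> expR (- X) <= (6 / X) ^+ 6.
Proof.
move=> X0; have h : X / 6 <= expR (X / 6).
  have := expR_ge1Dx (X / 6); lra.
have -> : - X = - (X / 6 * 6%:R) by field.
rewrite expRN expRM_natr -[leRHS]invrK -exprVn invf_div.
rewrite lef_pV2 ?posrE ?exprn_gt0 ?expR_gt0 ?divr_gt0//.
by rewrite lerXn2r// ?nnegrE ?expR_ge0 ?divr_ge0// ltW.
Qed.

Lemma Re_linear_growth (z u e s : R[i]) :
  2 * (Re e * Re (- (2 * z) * e + u * e - s) + Im e * Im (- (2 * z) * e + u * e - s)) =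
  - (4 * Re z) * normc e ^+ 2 + 2 * Re u * normc e ^+ 2 - 2 * Re (e^* * s).
Proof. by rewrite sqr_normcE !ReImE; ring. Qed.

(** The function [expR (2 X r) (H r - K)] decreases. Starting at [r = 1/2] avoids the singularity of
    the Riccati equation at 0 and still damps the initial value by [expR (- X)]. *)
Lemma gronwall_le (H dH : R -> R) (X K : R) :
  (forall r : R, 1/2 <= r <= 1 -> is_derive r 1 H (dH r)) ->
  (forall r : R, 1/2 <= r <= 1 -> dH r <= - (2 * X) * (H r - K)) ->
  H 1 - K <= expR (- X) * (H (1/2) - K).
Proof.
move=> dHE dHle.
pose F r := expR (2 * X * r) * (H r - K).
pose dF r := expR (2 * X * r) * (2 * X) * (H r - K) + expR (2 * X * r) * dH r.
have dFE (r : R) : 1/2 <= r <= 1 -> is_derive r 1 F (dF r).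
  move=> hr; have h1 := der_Zl (2 * X) (der_id r 1).
  have h2 := @is_derive1_comp _ expR (fun r => 2 * X * r) r _ _ (is_derive_expR _) h1.
  apply: (der_eq (der_M h2 (der_B (dHE r hr) (der_cst r 1 K)))).
  by rewrite /dF /=; ring.
have h12 : 1/2 <= 1 :> R by lra.
have [||c cab FE] := @MVT_segment R F dF (1/2) 1 h12.
- by move=> r; rewrite in_itv /= => /andP[h1 h2]; apply: dFE; rewrite !ltW.
- apply: derivable_within_continuous => r; rewrite in_itv /= => hr.
  by have [] := dFE r hr.
have hc : 1/2 <= c <= 1 by move: cab; rewrite in_itv.
have dc : dF c <= 0.
  rewrite /dF -mulrA -mulrDr; apply: mulr_ge0_le0; first exact: expR_ge0.
  by have := dHle c hc; lra.
have FF : F 1 <= F (1/2) by rewrite -subr_le0 FE; nra.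
move: FF; rewrite /F (_ : 2 * X * (1/2) = X); last by field.
rewrite mulr1 (_ : 2 * X = X + X) ?expRD; last by ring.
have e0 := expR_gt0 X.
rewrite -mulrA ler_pM2l// => FF.
by rewrite expRN mulrC ler_pdivlMr// mulrC.
Qed.

Variables (n : nat) (z : R[i]).
Hypothesis n0 : (0 < n)%N.
Hypothesis zn : 4 * n%:R <= Re z.
Local Notation X := (Re z).
Local Notation Z := (normc z).

Let n1 : 1 <= n%:R :> R. Proof. by rewrite ler1n. Qed.
Let X4 : 4 <= X. Proof. by have := n1; move: zn; lra. Qed.
Let X0 : 0 < X. Proof. by move: X4; lra. Qed.
Let XZ : X <= Z. Proof. exact: Re_le_normc. Qed.
Let Z0 : 0 < Z. Proof. by move: X0 XZ; lra. Qed.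
Let z1 : z != 0. Proof. by rewrite -normc_gt0. Qed.

(* The first two terms of the expansion of the solution of the Riccati equation
   in powers of 1 / (z r). *)
Let m (r : R) : R[i] := - (n%:R / 4) / (z * r%:C) - (n%:R / 8) / (z * r%:C) ^+ 2.
Let eta (r : R) : R[i] := zray n z r - m r.
(** The defect [m' + 2 z m + n / (2 r) * (1 - m^2)] of the approximation [m]. The coefficients of
    [m] are chosen to cancel its terms of order 1 and [1 / z], so it is [O(|z|^-2)]. *)
Let res (r : R) : R[i] :=
  n%:R / (4 * z ^+ 2 * r%:C ^+ 3) - n%:R / (2 * r%:C) * m r ^+ 2.

Let rC0 (r : R) : 0 < r -> r%:C != 0 :> R[i].
Proof. by move=> r0; rewrite -normc_eq0 normcR normr_eq0 gt_eqF. Qed.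

Let cder_eta (r : R) : 0 < r ->
  cder eta r 1 (- (2 * z) * eta r + n%:R / (2 * r%:C) * (m r + zray n z r) * eta r - res r).
Proof.
move=> r0; have hr := rC0 r0.
have d1 := cder_Zl z (cder_real (der_id r 1)).
have zr : z * r%:C != 0 by rewrite mulf_neq0.
have d2 := cder_Zl (- (n%:R / 4)) (cder_V zr d1).
have zr2 : (z * r%:C) ^+ 2 != 0 by rewrite expf_neq0.
have d3 := cder_Zl (n%:R / 8) (cder_V zr2 (cder_X 2 d1)).
apply: (cder_eq (cder_B (cder_zray n0 X0 r0) (cder_B d2 d3))).
rewrite /res /eta /m RC1 /=; move: (zray n z r) => zeta.
by field; rewrite hr z1.
Qed.

Let normc_div_nat (a b : nat) (w : R[i]) (c : R) : (0 < b)%N -> 0 < c -> c <= normc w ->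
  normc (a%:R / b%:R / w) <= a%:R / b%:R / c.
Proof.
move=> b0 c0 cw; rewrite !normcM !normcV !normc_nat ler_wpM2l ?divr_ge0//.
by rewrite lef_pV2 ?posrE// (lt_le_trans c0).
Qed.

Let m_le (r : R) : 1/2 <= r -> normc (m r) <= n%:R / Z.
Proof.
move=> r2; have r0 : 0 < r by lra.
have h1 : Z / 2 <= normc (z * r%:C).
  by rewrite normcM normcR gtr0_norm// ler_pM2l//; lra.
have Z2 : 0 < Z / 2 by rewrite divr_gt0.
apply: (le_trans (normcB _ _)); rewrite mulNr normcN.
apply: (@le_trans _ _ (n%:R / 4 / (Z / 2) + n%:R / 8 / (Z / 2) ^+ 2)).
  apply: lerD; apply: normc_div_nat => //; first exact: exprn_gt0.
  by rewrite normcX lerXn2r// nnegrE ?normc_ge0// ltW.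
have Z1 : 1 <= Z by move: X4 XZ; lra.
rewrite -subr_ge0.
have -> : n%:R / Z - (n%:R / 4 / (Z / 2) + n%:R / 8 / (Z / 2) ^+ 2) =
  n%:R / 2 * ((Z - 1) / Z ^+ 2) by field; exact: lt0r_neq0.
by rewrite mulr_ge0// ?divr_ge0// ?subr_ge0// exprn_ge0// ltW.
Qed.

Let Q : R := 3 * n%:R ^+ 3 / Z ^+ 2.

Let res_le (r : R) : 1/2 <= r <= 1 -> normc (res r) <= Q.
Proof.
move=> /andP[r2 r1]; have r0 : 0 < r by lra.
apply: (le_trans (normcB _ _)).
have m0 := normc_ge0 (m r).
(* The first summand uses [1/8 <= r^3], the second [m_le]; since [1 <= n], the sum is at most
   [3 n^3 / Z^2]. *)
apply: (@le_trans _ _ (2 * n%:R / Z ^+ 2 + n%:R * (n%:R / Z) ^+ 2)).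
  apply: lerD.
    rewrite normcM normcV (normcM (4 * z ^+ 2)) (normcM 4) (normcX z) (normcX r%:C).
    rewrite normcR !normc_nat gtr0_norm//.
    have r3 : 1 / 8 <= r ^+ 3 by nra.
    have Z20 : 0 < Z ^+ 2 by exact: exprn_gt0.
    have r30 : 0 < r ^+ 3 by exact: exprn_gt0.
    rewrite -subr_ge0 (_ : _ - _ = n%:R / Z ^+ 2 * ((8 * r ^+ 3 - 1) / (4 * r ^+ 3))); last first.
      by field; rewrite !lt0r_neq0.
    rewrite mulr_ge0// ?divr_ge0// ?mulr_ge0//; try exact: ltW.
    by rewrite subr_ge0; lra.
  rewrite normcM normcX; apply: ler_pM; rewrite ?exprn_ge0// ?normc_ge0//.
    rewrite normcM normcV normcM normcR !normc_nat gtr0_norm//.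
    rewrite ler_pdivrMr ?mulr_gt0//; have := n1; nra.
  apply: lerXn2r; [by rewrite nnegrE normc_ge0| |exact: m_le].
  by rewrite nnegrE divr_ge0 ?normc_ge0.
rewrite /Q -subr_ge0.
have -> : 3 * n%:R ^+ 3 / Z ^+ 2 - (2 * n%:R / Z ^+ 2 + n%:R * (n%:R / Z) ^+ 2) =
  2 * (n%:R * (n%:R ^+ 2 - 1)) / Z ^+ 2 by field; exact: lt0r_neq0.
apply: divr_ge0; last exact/exprn_ge0/ltW.
by rewrite !mulr_ge0// subr_ge0 expr_ge1.
Qed.

Let H (r : R) : R := normc (eta r) ^+ 2.
Let deta (r : R) : R[i] :=
  - (2 * z) * eta r + n%:R / (2 * r%:C) * (m r + zray n z r) * eta r - res r.
Let dH (r : R) : R := 2 * (Re (eta r) * Re (deta r) + Im (eta r) * Im (deta r)).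

Let dHE (r : R) : 1/2 <= r <= 1 -> is_derive r 1 H (dH r).
Proof.
move=> /andP[r2 r1]; have r0 : 0 < r by lra.
have [e1 e2] := cder_eta r0.
have -> : H = (fun r => Re (eta r) ^+ 2 + Im (eta r) ^+ 2).
  by apply/funext => t; rewrite /H sqr_normcE.
apply: (der_eq (der_D (der_X 2 e1) (der_X 2 e2))).
by rewrite /dH /= !expr1 -/(deta r); ring.
Qed.

Let m_le1 (r : R) : 1/2 <= r -> normc (m r) <= 1 / 4.
Proof.
move=> r2; apply: (le_trans (m_le r2)); rewrite ler_pdivrMr//.
by move: zn XZ; lra.
Qed.

(** Of the contraction rate [4 X], one [X] pays for the term with [u], because
    [|u| <= 2 n <= X / 2], and another for the defect, by [2 |eta| Q <= X |eta|^2 + Q^2 / X]. This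
    is where [4 n <= Re z] is used. *)
Let dH_le (r : R) : 1/2 <= r <= 1 -> dH r <= - (2 * X) * (H r - Q ^+ 2 / (2 * X ^+ 2)).
Proof.
move=> hr; have /andP[r2 r1] := hr; have r0 : 0 < r by lra.
set u := n%:R / (2 * r%:C) * (m r + zray n z r).
have ule : normc u <= X / 2.
  rewrite /u normcM normcM normcV normcM normcR !normc_nat gtr0_norm//.
  have h1 : n%:R / (2 * r) <= n%:R.
    by rewrite ler_pdivrMr ?mulr_gt0// ler_peMr//; lra.
  have h2 : normc (m r + zray n z r) <= 2.
    by apply: (le_trans (normcD _ _)); have := m_le1 r2; have := zray_le1 n0 X0 r0; lra.
  apply: (@le_trans _ _ (n%:R * 2)); last by move: zn; lra.
  by apply: ler_pM; rewrite ?normc_ge0// divr_ge0// mulr_ge0// ltW.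
have Rle := res_le hr.
have E : dH r = - (4 * X) * H r + 2 * Re u * H r - 2 * Re ((eta r)^* * res r).
  exact: Re_linear_growth.
have h1 : Re u <= X / 2 by exact: le_trans (Re_le_normc u) ule.
have h2 : - Re ((eta r)^* * res r) <= normc (eta r) * Q.
  apply: (@le_trans _ _ (normc ((eta r)^* * res r))).
    by rewrite -normcN -ReN Re_le_normc.
  by rewrite normcM normcJ ler_wpM2l// normc_ge0.
have H0 : 0 <= H r by exact: sqr_ge0.
have h3 : 2 * (normc (eta r) * Q) <= X * H r + Q ^+ 2 / X.
  rewrite /H -subr_ge0 (_ : _ - _ = (X * normc (eta r) - Q) ^+ 2 / X).
    by rewrite divr_ge0 ?sqr_ge0// ltW.
  by field; exact: lt0r_neq0.
have -> : - (2 * X) * (H r - Q ^+ 2 / (2 * X ^+ 2)) = - (2 * X) * H r + Q ^+ 2 / X.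
  by field; exact: lt0r_neq0.
rewrite E; move: h1 h2 h3 H0 X0; move: (H r) (Re u) (Re _) (normc _ * Q) (Q ^+ 2 / X) X => *.
nra.
Qed.

(** The stationary part of the Gronwall bound is [Q^2 / (2 X^2)], at most [5 n^6 / X^6] because
    [9 / 2 <= 5]. The rest is at most [4 expR (- X)], since [|eta| <= 2] at [r = 1/2]. *)
Lemma eta1_le : normc (zray n z 1 - (- (n%:R / 4) / z - (n%:R / 8) / z ^+ 2)) ^+ 2 <=
  (5 * n%:R ^+ 6 + 4 * 6 ^+ 6) / X ^+ 6.
Proof.
have -> : zray n z 1 - (- (n%:R / 4) / z - (n%:R / 8) / z ^+ 2) = eta 1.
  by rewrite /eta /m RC1 mulr1.
have G := gronwall_le dHE dH_le.
have h2 : H (1/2) <= 4.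
  rewrite (_ : 4 = 2 ^+ 2)//; last by ring.
  rewrite lerXn2r// ?nnegrE ?normc_ge0//; apply: (le_trans (normcB _ _)).
  have r0 : 0 < 1 / 2 :> R by lra.
  have := zray_le1 n0 X0 r0; have := @m_le1 (1/2) (lexx _); lra.
set K := Q ^+ 2 / (2 * X ^+ 2) in G.
have K0 : 0 <= K by rewrite divr_ge0 ?sqr_ge0// mulr_ge0 ?sqr_ge0.
have e0 := expR_ge0 (- X).
have h1 : H 1 <= K + 4 * expR (- X) by nra.
have KE : K <= 5 * n%:R ^+ 6 / X ^+ 6.
  have -> : K = 9 * n%:R ^+ 6 / (2 * X ^+ 2 * Z ^+ 4).
    by rewrite /K /Q; field; rewrite !lt0r_neq0.
  have Xp : 0 < X ^+ 6 by exact: exprn_gt0.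
  have XZ4 : X ^+ 6 <= X ^+ 2 * Z ^+ 4.
    rewrite (_ : X ^+ 6 = X ^+ 2 * X ^+ 4); last by ring.
    by rewrite ler_wpM2l ?sqr_ge0// lerXn2r// nnegrE ltW.
  have n6 : 0 <= n%:R ^+ 6 :> R by exact: exprn_ge0.
  rewrite ler_pdivrMr; last by rewrite !mulr_gt0// exprn_gt0.
  apply: (@le_trans _ _ (5 * n%:R ^+ 6 / X ^+ 6 * (2 * X ^+ 6))).
    by rewrite (_ : _ * (2 * _) = 10 * n%:R ^+ 6); [lra|field; exact: lt0r_neq0].
  apply: ler_wpM2l; first by rewrite divr_ge0 ?mulr_ge0// ltW.
  lra.
have eX : 4 * expR (- X) <= 4 * 6 ^+ 6 / X ^+ 6.
  by rewrite -mulrA -expr_div_n ler_wpM2l// expRN_le.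
by rewrite /H in h1; rewrite mulrDl; lra.
Qed.

End bessel_asymptotics.

Section log_derivative.
Context {R : realType}.
Local Notation Re := complex.Re.
Local Notation Im := complex.Im.

Definition bq (n : nat) (z : R[i]) : R[i] := dbray n z 1 / bray n z 1.

(* The coefficient of 1 / z in the expansion of bq. *)
Definition kap (n : nat) : R := n%:R * (n%:R - 2) / 8.

(** The left-hand fraction inverts the Cayley transform, so it is [q]. In the numerator on the
    right, every term is [O(|z|^-2)] once [eta] is [O(|z|^-3)] and [zeta] is [O(|z|^-1)]. *)
Lemma bq_expand (n : nat) (z zeta eta : R[i]) : z != 0 -> 1 - zeta != 0 ->
  zeta = - (n%:R / 4) / z - (n%:R / 8) / z ^+ 2 + eta ->
  z * (1 + zeta) / (1 - zeta) - (z - n%:R / 2 + (kap n)%:C / z) =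
  (2 * z * eta + n%:R ^+ 2 / (16 * z ^+ 2) - n%:R / 2 * eta + zeta * (kap n)%:C / z) /
  (1 - zeta).
Proof.
move=> z0 z1 E.
have Ee : eta = zeta + (n%:R / 4) / z + (n%:R / 8) / z ^+ 2 by rewrite E; ring.
rewrite Ee /kap !RCE; field.
by rewrite z0 z1.
Qed.

Lemma remainder_le (n : nat) (k C3 A : R) (z zeta eta : R[i]) :
  0 <= C3 -> 0 <= A -> 1 <= normc z -> normc eta <= C3 / normc z ^+ 3 ->
  normc zeta <= A / normc z ->
  normc (2 * z * eta + n%:R ^+ 2 / (16 * z ^+ 2) - n%:R / 2 * eta + zeta * k%:C / z) <=
  (2 * C3 + n%:R ^+ 2 + n%:R * C3 + A * `|k|) / normc z ^+ 2.
Proof.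
move=> C30 A0; set Z := normc z => Z1 ez zA.
have Z0 : 0 < Z by lra.
have Z20 : 0 < Z ^+ 2 by exact: exprn_gt0.
have -> : (2 * C3 + n%:R ^+ 2 + n%:R * C3 + A * `|k|) / Z ^+ 2 =
  2 * Z * (C3 / Z ^+ 3) + n%:R ^+ 2 / Z ^+ 2 + n%:R * (C3 / Z ^+ 2) + A / Z * `|k| / Z.
  by field; exact: lt0r_neq0.
have Zi : 0 <= Z^-1 by rewrite invr_ge0 ltW.
apply: (le_trans (normcD _ _)); apply: lerD; last first.
  rewrite (normcM (zeta * _)) normcV (normcM zeta) normcR -/Z.
  by apply: ler_wpM2r => //; exact: ler_wpM2r.
apply: (le_trans (normcB _ _)); apply: lerD; last first.
  rewrite (normcM (_ / 2)) (normcM n%:R) normcV !normc_nat.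
  apply: ler_pM; rewrite ?normc_ge0 ?divr_ge0//.
    by rewrite ler_pdivrMr// ler_peMr//; lra.
  apply: (le_trans ez); rewrite ler_wpM2l// lef_pV2 ?posrE ?exprn_gt0//.
  by rewrite [leRHS]exprS ler_peMl// ltW.
apply: (le_trans (normcD _ _)); apply: lerD.
  rewrite (normcM (2 * z)) (normcM 2) !normc_nat -/Z.
  by rewrite ler_wpM2l// mulr_ge0// ltW.
rewrite (normcM (_ ^+ 2)) normcV (normcM 16) !normcX !normc_nat -/Z.
rewrite ler_wpM2l ?exprn_ge0// lef_pV2 ?posrE ?mulr_gt0//; lra.
Qed.

(** In the cone [c |z| <= Re z] negative powers of [Re z] may be traded for those of [|z|], at the
    cost of powers of [c]. *)
Lemma bq_asymptotics (n : nat) (c : R) : (0 < n)%N -> 0 < c ->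
  exists C, 0 <= C /\ exists rho, 1 <= rho /\ forall z : R[i],
    rho <= normc z -> c * normc z <= Re z ->
    normc (bq n z - (z - n%:R / 2 + (kap n)%:C / z)) <= C / normc z ^+ 2.
Proof.
move=> n0 c0.
have n1 : 1 <= n%:R :> R by rewrite ler1n.
pose C1 : R := 5 * n%:R ^+ 6 + 4 * 6 ^+ 6.
have C11 : 1 <= C1.
  have : 0 <= n%:R ^+ 6 :> R by exact: exprn_ge0.
  have : 1 <= 6 ^+ 6 :> R by apply: exprn_ege1; lra.
  rewrite /C1; lra.
(* [C1] bounds the square of the error; as [1 <= C1], it also serves in place of its square root. *)
pose C3 := C1 / c ^+ 3.
have C30 : 0 <= C3 by rewrite divr_ge0 ?exprn_ge0 ?ltW//; lra.
pose A := n%:R + C3.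
have A0 : 0 <= A by rewrite addr_ge0.
pose C := 2 * (2 * C3 + n%:R ^+ 2 + n%:R * C3 + A * `|kap n|).
exists C; split.
  have h1 : 0 <= n%:R ^+ 2 :> R by exact: exprn_ge0.
  have h2 : 0 <= n%:R * C3 by exact: mulr_ge0.
  have h3 : 0 <= A * `|kap n| by exact: mulr_ge0.
  by rewrite /C; lra.
(* The second term ensures [4 n <= Re z]; the third gives [|zeta| <= 1/2], hence [1/2 <= |1 - zeta|]
   and the factor 2 in [C]. *)
exists (1 + 4 * n%:R / c + 2 * A).
have q0 : 0 <= 4 * n%:R / c by apply: divr_ge0; [lra|exact: ltW].
split; first by lra.
move=> z zrho zc; set Z := normc z in zrho zc *.
have Z1 : 1 <= Z by lra.
have ZA : 2 * A <= Z by lra.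
have Z0 : 0 < Z by lra.
have z0 : z != 0 by rewrite -normc_gt0.
have X4 : 4 * n%:R <= Re z.
  apply: le_trans zc; rewrite [leRHS]mulrC -ler_pdivrMr//; lra.
have X0 : 0 < Re z by lra.
have f0 : bray n z 1 != 0 by exact: bray_neq0.
have a0 : dbray n z 1 + z * bray n z 1 != 0 by exact: bray_add_neq0.
set zeta := zray n z 1.
have zE : 1 - zeta = 2 * z * bray n z 1 / (dbray n z 1 + z * bray n z 1).
  by rewrite /zeta /zray; move: a0; move: (dbray _ _ _) (bray _ _ _) => u v a0; field.
have z1 : 1 - zeta != 0.
  by rewrite zE !mulf_neq0// ?invr_eq0// -normc_eq0 normc_nat pnatr_eq0.
have qE : bq n z = z * (1 + zeta) / (1 - zeta).
  rewrite zE /bq /zeta /zray; move: a0 f0; move: (dbray _ _ _) (bray _ _ _) => u v a0 v0.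
  by field; rewrite a0 z0 v0.
pose eta := zeta - (- (n%:R / 4) / z - (n%:R / 8) / z ^+ 2).
have etaE : zeta = - (n%:R / 4) / z - (n%:R / 8) / z ^+ 2 + eta by rewrite /eta; ring.
have ez : normc eta <= C3 / Z ^+ 3.
  have CZ0 : 0 <= C3 / Z ^+ 3 by apply: divr_ge0 => //; exact/exprn_ge0/ltW.
  rewrite -(@ler_pXn2r _ 2)// ?nnegrE ?normc_ge0//.
  apply: (le_trans (eta1_le n0 X4)); rewrite -/C1.
  have XZ6 : (c * Z) ^+ 6 <= Re z ^+ 6.
    by rewrite lerXn2r// ?nnegrE ?ltW// mulr_gt0.
  have cZ6 : 0 < (c * Z) ^+ 6 by rewrite exprn_gt0// mulr_gt0.
  apply: (@le_trans _ _ (C1 / (c * Z) ^+ 6)).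
    apply: ler_wpM2l; first by lra.
    by rewrite lef_pV2 ?posrE ?exprn_gt0 ?mulr_gt0.
  rewrite (_ : (C3 / Z ^+ 3) ^+ 2 = C1 ^+ 2 / (c * Z) ^+ 6); last first.
    by rewrite /C3; field; rewrite !lt0r_neq0.
  apply: ler_wpM2r; first by rewrite invr_ge0 ltW.
  by rewrite expr2; nra.
have Zk k : 1 / Z ^+ k.+1 <= 1 / Z.
  rewrite !div1r lef_pV2 ?posrE ?exprn_gt0// exprS ler_peMr ?(ltW Z0)//.
  exact: exprn_ege1.
have m1 : normc (- (n%:R / 4) / z - (n%:R / 8) / z ^+ 2) <= n%:R / Z.
  apply: (le_trans (normcB _ _)).
  rewrite !mulNr normcN normcM normcV normcM normcV !normc_nat -/Z.
  rewrite (normcM (_ / 8)) normcV normcX normcM normcV !normc_nat -/Z.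
  have := Zk 1%N; rewrite !div1r => h.
  apply: (@le_trans _ _ (n%:R / 4 / Z + n%:R / 8 / Z)).
    by rewrite lerD2l ler_wpM2l.
  have : 0 <= n%:R / Z by rewrite divr_ge0 ?(ltW Z0).
  rewrite (_ : n%:R / 4 / Z + n%:R / 8 / Z = 3/8 * (n%:R / Z)); first by lra.
  by field; exact: lt0r_neq0.
have zA : normc zeta <= A / Z.
  rewrite etaE (le_trans (normcD _ _))// /A mulrDl lerD// (le_trans ez)//.
  by rewrite ler_wpM2l//; have := Zk 2%N; rewrite !div1r.
have z2 : normc zeta <= 1 / 2.
  apply: (le_trans zA); rewrite ler_pdivrMr//; lra.
have n1z : 1 / 2 <= normc (1 - zeta).
  by have := normcB_ge 1 zeta; rewrite normc1; lra.
rewrite qE (bq_expand z0 z1 etaE) normcM normcV.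
have n1z0 : 0 < normc (1 - zeta) by lra.
rewrite ler_pdivrMr//.
pose W := (2 * C3 + n%:R ^+ 2 + n%:R * C3 + A * `|kap n|) / Z ^+ 2.
have W0 : 0 <= W.
  have h1 : 0 <= n%:R ^+ 2 :> R by exact: exprn_ge0.
  have h2 : 0 <= n%:R * C3 by exact: mulr_ge0.
  have h3 : 0 <= A * `|kap n| by exact: mulr_ge0.
  by apply: divr_ge0; [lra|exact/exprn_ge0/ltW].
apply: (@le_trans _ _ W); last first.
  rewrite (_ : C / Z ^+ 2 = 2 * W); last by rewrite /C /W; ring.
  by nra.
exact: remainder_le.
Qed.

End log_derivative.

(** * Construction of the spectral curves by a fixed point *)

Section contraction.
Context {R : realType}.
Local Notation Re := complex.Re.
Local Notation Im := complex.Im.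

(** The iterates from the centre [b] have steps dominated by a geometric series of ratio 1/2, so
    their real and imaginary parts converge; the disc is closed and the limit is fixed. *)
Lemma complex_contraction (T : R[i] -> R[i]) (b : R[i]) :
  (forall z, normc (z - b) <= 1 -> normc (T z - b) <= 1) ->
  (forall z w, normc (z - b) <= 1 -> normc (w - b) <= 1 ->
     normc (T z - T w) <= 1 / 2 * normc (z - w)) ->
  exists2 z, normc (z - b) <= 1 & T z = z.
Proof.
move=> Tb TT; pose u k := iter k T b.
have ub k : normc (u k - b) <= 1.
  by elim: k => [|k IH]; [rewrite /u /= subrr normc0|exact: Tb].
have du k : normc (u k.+1 - u k) <= geometric 1 (1 / 2) k.
  elim: k => [|k IH]; first by rewrite /geometric /= expr0 mulr1; exact: ub 1%N.
  apply: (le_trans (TT _ _ (ub k.+1) (ub k))).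
  by move: IH; rewrite /geometric /= exprS; lra.
have cv (P : R[i] -> R) : (forall z w, P (z - w) = P z - P w) ->
    (forall z, `|P z| <= normc z) -> cvgn (fun k => P (u k)).
  move=> PB PN.
  have E : (fun k => P (u k)) = (fun k => P b + series (fun j => P (u j.+1) - P (u j)) k).
    by apply/funext => k; rewrite /series /= telescope_sumr// addrC subrK.
  rewrite E; apply: is_cvgD; first exact: is_cvg_cst.
  apply: normed_cvg; apply: (@series_le_cvg _ _ (geometric 1 (1 / 2))).
  - by move=> k /=.
  - by move=> k; rewrite /geometric /= mul1r exprn_ge0//; lra.
  - by move=> k /=; rewrite -PB; exact: le_trans (PN _) (du k).
  - by apply: is_cvg_geometric_series; rewrite ger0_norm; lra.
have /cvg_ex[x ux] := cv (@complex.Re R) (@ReB R) (@normRe_le R).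
have /cvg_ex[y uy] := cv (@complex.Im R) (@ImB R) (@normIm_le R).
pose z : R[i] := x +i* y.
have uz : normc (u k - z) @[k --> \oo] --> (0 : R).
  apply: (@squeeze_cvgr _ _ _ _ (fun=> 0) (fun k => `|Re (u k) - x| + `|Im (u k) - y|)).
  - near=> k; rewrite normc_ge0 /=; apply: (le_trans (normc_le_add _)).
    by rewrite !ReImE.
  - exact: cvg_cst.
  - have h1 : `|Re (u k) - x| @[k --> \oo] --> (0 : R).
      by apply/norm_cvg0P/subr_cvg0.
    have h2 : `|Im (u k) - y| @[k --> \oo] --> (0 : R).
      by apply/norm_cvg0P/subr_cvg0.
    by have := cvgD h1 h2; rewrite addr0; exact.
have lim_le (a : R) : (\forall k \near \oo, a <= normc (u k - z)) -> a <= 0.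
  by move=> H; exact: (cvgr_to_ge uz H).
have zb : normc (z - b) <= 1.
  have : normc (z - b) - 1 <= 0.
    apply: lim_le; apply: nearW => k.
    have := normcD (z - u k) (u k - b); rewrite subrKA (normcBC z); have := ub k; lra.
  lra.
exists z => //; apply/eqP; rewrite -subr_eq0 -normc_eq0 eq_le normc_ge0 andbT.
have uz1 : normc (u k.+1 - z) @[k --> \oo] --> (0 : R).
  by move: uz; rewrite -(cvg_shiftS (fun k => normc (u k - z))).
have H : normc (u k - z) + normc (u k.+1 - z) @[k --> \oo] --> (0 : R).
  by have := cvgD uz uz1; rewrite addr0; exact.
apply: (cvgr_to_ge H); apply: nearW => k.
have h1 := TT _ _ zb (ub k); rewrite (normcBC z) in h1.
have h2 := normcD (T z - u k.+1) (u k.+1 - z).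
have h3 := normc_ge0 (u k - z).
rewrite subrKA in h2; have h4 : normc (T z - u k.+1) <= 1 / 2 * normc (u k - z) by exact: h1.
lra.
Unshelve. all: by end_near. Qed.

End contraction.

Section log_derivative_lipschitz.
Context {R : realType}.
Local Notation Re := complex.Re.
Local Notation Im := complex.Im.

(** At [r = 1] the equation of [bfun] says that [q] solves [z q' = z^2 - (n - 1) q - q^2] in the
    variable [z]. A bound on [q] thus bounds its derivative. *)
Lemma cder_bq (n : nat) (g : R -> R[i]) (t : R) (l : R[i]) :
  (0 < n)%N -> cder g t 1 l -> g t != 0 -> bray n (g t) 1 != 0 ->
  cder (fun s => bq n (g s)) t 1
    ((g t ^+ 2 - (n%:R - 1) * bq n (g t) - bq n (g t) ^+ 2) / g t * l).
Proof.
move=> n0 gl g0 f0.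
pose N := n.+1.
have eN : ecoef (@bcoef R N) := ecoef_bcoef (ltn0Sn n).
have gw := cder_X 2 gl.
have h1 := cder_eseries eN gw; have h2 := cder_eseries (ecoef_d eN) gw.
have wE s : s ^+ 2 * (1 ^+ 2)%:C = s ^+ 2 :> R[i] by rewrite expr1n RC1 mulr1.
have fE s : bray n (g s) 1 = eseries (bcoef N) (g s ^+ 2) by rewrite /bray wE.
have dE s : dbray n (g s) 1 = 2 * g s ^+ 2 * eseries (dcoef (bcoef N)) (g s ^+ 2).
  by rewrite /dbray wE RC1 mulr1.
have f1 : eseries (bcoef N) (g t ^+ 2) != 0 by rewrite -fE.
have := cder_M (cder_M (cder_Zl 2 gw) h2) (cder_V f1 h1).
move=> H; apply: (@cder_ext _ _ (fun s => 2 * g s ^+ 2 * eseries (dcoef (bcoef N)) (g s ^+ 2) *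
    (eseries (bcoef N) (g s ^+ 2))^-1)).
  by move=> s; rewrite /bq fE dE.
apply: (cder_eq H); rewrite /bq fE dE.
have ode := bfun_ode (g t ^+ 2) (ltn0Sn n).
move: f1 ode; rewrite /bfun /bfun' /bfun'' -/N.
move: (eseries (bcoef N) _) (eseries (dcoef (bcoef N)) _) => B B'.
move: (eseries (dcoef (dcoef _)) _) => B'' B0 ode.
have E : B'' = (B - 2 * N%:R * B') / (4 * g t ^+ 2) by rewrite -ode; field.
have NE : N%:R = n%:R + 1 :> R[i] by rewrite natr1.
by rewrite E NE /=; field; rewrite g0 B0.
Qed.

Definition berr (n : nat) (z : R[i]) : R[i] := bq n z - z + n%:R / 2.

(** The left-hand side is the derivative of [berr]. Substituting [q = z - n / 2 + e] cancels the
    growing terms and leaves [- 2 e] plus a bounded quantity over [z]. *)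
Lemma berr_derive_le (n : nat) (E : R) (z q : R[i]) : z != 0 -> 1 <= normc z -> 0 <= E ->
  normc (q - z + n%:R / 2) <= E / normc z ->
  normc ((z ^+ 2 - (n%:R - 1) * q - q ^+ 2) / z - 1) <=
  (2 * E + n%:R ^+ 2 + n%:R + E + E ^+ 2) / normc z.
Proof.
move=> z0; set Z := normc z => Z1 E0.
set e := q - z + n%:R / 2 => eE.
have -> : (z ^+ 2 - (n%:R - 1) * q - q ^+ 2) / z - 1 =
  - (2 * e) + (n%:R ^+ 2 / 4 - n%:R / 2 + e - e ^+ 2) / z by rewrite /e; field.
have Z0 : 0 < Z by lra.
have e1 : normc e <= E.
  by apply: (le_trans eE); rewrite ler_pdivrMr// ler_peMr.
have ee : normc e ^+ 2 <= E ^+ 2 by rewrite lerXn2r// nnegrE ?normc_ge0.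
apply: (le_trans (normcD _ _)).
rewrite normcN normcM normc_nat normcM normcV -/Z.
have -> : (2 * E + n%:R ^+ 2 + n%:R + E + E ^+ 2) / Z =
  2 * (E / Z) + (n%:R ^+ 2 + n%:R + E + E ^+ 2) / Z by ring.
apply: lerD; first by rewrite ler_wpM2l.
apply: ler_wpM2r; first by rewrite invr_ge0 ltW.
apply: (le_trans (normcB _ _)); apply: lerD; last by rewrite normcX.
apply: (le_trans (normcD _ _)); apply: lerD => //.
apply: (le_trans (normcB _ _)); apply: lerD.
  rewrite normcM normcV normcX !normc_nat ler_pdivrMr// ler_peMr ?exprn_ge0//; lra.
rewrite normcM normcV !normc_nat ler_pdivrMr// ler_peMr//; lra.
Qed.

(** Segments stay in the truncated cone, so a derivative bound there yields a Lipschitz bound. *)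
Lemma cone_convex (c rho : R) (z w : R[i]) (t : R) : 0 <= t <= 1 ->
  rho <= Re z -> c * normc z <= Re z -> rho <= Re w -> c * normc w <= Re w -> 0 <= c ->
  let v := z + t%:C * (w - z) in rho <= Re v /\ c * normc v <= Re v.
Proof.
move=> /andP[t0 t1] h1 h2 h3 h4 c0 /=.
have E : Re (z + t%:C * (w - z)) = (1 - t) * Re z + t * Re w by rewrite !ReImE; ring.
rewrite E; split; first by nra.
have h5 : normc (z + t%:C * (w - z)) <= (1 - t) * normc z + t * normc w.
  have -> : z + t%:C * (w - z) = (1 - t)%:C * z + t%:C * w by rewrite RCD RCN RC1; ring.
  apply: (le_trans (normcD _ _)); rewrite !normcM !normcR !ger0_norm//; lra.
nra.
Qed.

Lemma berr_summary (n : nat) (c : R) : (0 < n)%N -> 0 < c ->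
  exists C, 0 <= C /\ exists rho, 1 <= rho /\
    [/\ forall z, rho <= Re z -> bray n z 1 != 0,
        forall z, rho <= Re z -> c * normc z <= Re z ->
          normc (berr n z - (kap n)%:C / z) <= C / normc z ^+ 2,
        forall z, rho <= Re z -> c * normc z <= Re z -> normc (berr n z) <= C / normc z &
        forall z w, rho <= Re z -> c * normc z <= Re z -> rho <= Re w -> c * normc w <= Re w ->
          normc (berr n z - berr n w) <= 1 / 2 * normc (z - w)].
Proof.
move=> n0 c0; have [C [C0 [rho0 [rho1 H]]]] := bq_asymptotics n0 c0.
pose E := `|kap n| + C.
have E0 : 0 <= E by rewrite addr_ge0.
pose L := 2 * E + n%:R ^+ 2 + n%:R + E + E ^+ 2.
have L0 : 0 <= L.
  have h1 : 0 <= n%:R ^+ 2 :> R by exact: exprn_ge0.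
  have h2 : 0 <= E ^+ 2 by exact: exprn_ge0.
  have h3 : 0 <= n%:R :> R by [].
  by rewrite /L; lra.
(* The derivative of [berr] is at most [L / |z|]; the term [4 * L] makes this at most 1/4, and the
   real and imaginary parts add up to 1/2. *)
exists E; split => //; exists (rho0 + 4 * L); split; first by lra.
have asy z : rho0 + 4 * L <= Re z -> c * normc z <= Re z ->
    normc (berr n z - (kap n)%:C / z) <= C / normc z ^+ 2.
  move=> h1 h2; have := H z; have := Re_le_normc z => h3.
  rewrite (_ : bq n z - (z - n%:R / 2 + (kap n)%:C / z) = berr n z - (kap n)%:C / z).
    by apply => //; lra.
  by rewrite /berr; ring.
have bnd z : rho0 + 4 * L <= Re z -> c * normc z <= Re z -> normc (berr n z) <= E / normc z.
  move=> h1 h2; have h3 := asy z h1 h2; have h4 := Re_le_normc z.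
  have Z1 : 1 <= normc z by lra.
  have Z0 : 0 < normc z by lra.
  rewrite -[berr n z](subrK ((kap n)%:C / z)) (le_trans (normcD _ _))//.
  rewrite /E mulrDl addrC lerD//; first by rewrite normcM normcR normcV.
  apply: (le_trans h3); rewrite ler_wpM2l// lef_pV2 ?posrE ?exprn_gt0//.
  by rewrite expr2 ler_peMl// ltW.
have nz z : rho0 + 4 * L <= Re z -> bray n z 1 != 0.
  by move=> h1; apply: bray_neq0 => //; lra.
split => //.
  move=> z h1 h2; apply: (le_trans (asy z h1 h2)).
  apply: ler_wpM2r; last by rewrite /E lerDr.
  by rewrite invr_ge0 exprn_ge0// normc_ge0.
move=> z w z1 z2 w1 w2; rewrite normcBC (normcBC z).
pose g (t : R) : R[i] := z + t%:C * (w - z).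
have gl (t : R) : cder g t 1 (w - z).
  apply: (cder_eq (cder_D (cder_cst _ _ _) (cder_M (cder_real (der_id t 1)) (cder_cst _ _ _)))).
  by rewrite RC1 mul1r mulr0 addr0 add0r.
have gD (t : R) : 0 <= t <= 1 -> rho0 + 4 * L <= Re (g t) /\ c * normc (g t) <= Re (g t).
  by move=> t01; apply: cone_convex => //; exact: ltW.
pose dg (t : R) : R[i] := ((g t ^+ 2 - (n%:R - 1) * bq n (g t) - bq n (g t) ^+ 2) / g t - 1) * (w - z).
have Z1 (t : R) : 0 <= t <= 1 -> rho0 + 4 * L <= normc (g t).
  by move=> /gD[h _]; exact: le_trans h (Re_le_normc _).
have g0 (t : R) : 0 <= t <= 1 -> g t != 0.
  by move=> /Z1 h; rewrite -normc_gt0; lra.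
have dgE (t : R) : 0 <= t <= 1 -> cder (fun s => berr n (g s)) t 1 (dg t).
  move=> t01; have [h1 h2] := gD t t01.
  have h3 := cder_bq n0 (gl t) (g0 t t01) (nz _ h1).
  apply: (cder_eq (cder_D (cder_B h3 (gl t)) (cder_cst _ _ _))).
  by rewrite /dg addr0 [RHS]mulrBl mul1r.
have dgle (t : R) : 0 <= t <= 1 -> normc (dg t) <= 1 / 4 * normc (w - z).
  move=> t01; have [h1 h2] := gD t t01; have h3 := Z1 t t01.
  rewrite /dg normcM ler_wpM2r ?normc_ge0//.
  have h4 := berr_derive_le (g0 t t01) _ E0 (bnd _ h1 h2).
  apply: (le_trans (h4 _)); first by lra.
  rewrite ler_pdivrMr; last by lra.
  rewrite -/L; lra.
have g1E : g 1 = w by rewrite /g RC1 mul1r addrC subrK.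
have g0E : g 0 = z by rewrite /g RC0 mul0r addr0.
have fin (P : R[i] -> R) : (forall u, `|P u| <= normc u) ->
    (forall (t : R), 0 <= t <= 1 -> is_derive t 1 (fun s => P (berr n (g s))) (P (dg t))) ->
    `|P (berr n w) - P (berr n z)| <= 1 / 4 * normc (w - z).
  move=> PN Pd; rewrite -g1E -g0E.
  have := @bounded_derive_lipschitz_le R (fun s => P (berr n (g s))) (fun t => P (dg t)) 0 1
    (1 / 4 * normc (w - z)) ler01 Pd.
  rewrite subr0 normr1 mulr1 g1E g0E; apply => t t01.
  by rewrite (le_trans (PN _))// dgle.
have f1 := fin (@complex.Re R) (@normRe_le R) (fun t ht => (dgE t ht).1).
have f2 := fin (@complex.Im R) (@normIm_le R) (fun t ht => (dgE t ht).2).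
apply: (le_trans (normc_le_add _)); rewrite ReB ImB.
apply: (le_trans (lerD f1 f2)).
by rewrite -mulrDl (_ : 1 / 4 + 1 / 4 = 1 / 2)//; field.
Qed.

End log_derivative_lipschitz.

(** With [m = n / 2] and [h = (d - 1) / 2], being a fixed point [w] of the contraction is the Robin
    condition [l + q + a = 0]. *)
Lemma fixed_point_eq {F : fieldType} (l m h w q a : F) :
  m - l = h -> w = - a + h - (q - w + m) -> l + q + a = 0.
Proof.
move=> <- E; have : w - w = 0 by rewrite subrr.
by rewrite {2}E => <-; ring.
Qed.

Section spectral_curve.
Context {R : realType}.
Local Notation Re := complex.Re.
Local Notation Im := complex.Im.
Variables (d l : nat).
Hypothesis d2 : (2 <= d)%N.

(* The coefficient n of the radial equation f'' + (n / r) f' = z^2 f of the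
   eigenfunctions of degree l in dimension d. *)
Definition bidx : nat := (l.*2 + d).-1.
Let n := bidx.
Let hd : R[i] := (d%:R - 1) / 2.

Let ld2 : (1 < l.*2 + d)%N. Proof. exact: leq_trans d2 (leq_addl _ _). Qed.

Let n0 : (0 < n)%N. Proof. by rewrite /n /bidx -ltnS prednK// ltnW. Qed.

(** The degree cancels, which is why all curves share the same expansion up to [O(1)]. *)
Lemma bidxE : n%:R / 2 - l%:R = hd.
Proof.
have -> : n%:R = 2 * l%:R + d%:R - 1 :> R[i].
  have -> : 2 * l%:R + d%:R = n.+1%:R :> R[i].
    by rewrite -natrM -natrD mul2n /n /bidx prednK// ltnW.
  by rewrite -natr1 addrK.
by rewrite /hd; field.
Qed.

Lemma normc_hd : normc hd <= d%:R.
Proof.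
have d1 : 1 <= d%:R :> R by rewrite ler1n ltnW.
have -> : hd = ((d%:R - 1) / 2)%:C by rewrite /hd !RCE.
rewrite normcR ger0_norm; lra.
Qed.

(** For large [a] in the cone, the map [z |-> - a + hd - berr n z] contracts the unit disc around
    [- a + hd]. Halving the aperture constant [c] leaves room for the whole disc in the cone of the
    estimates. *)
Lemma spectral_curve (c : R) : 0 < c ->
  exists C, 0 <= C /\ exists rho, 1 <= rho /\ exists zz : R[i] -> R[i],
    (forall a : R[i], rho <= normc a -> c * normc a <= - Re a ->
    [/\ 0 < Re (zz a) /\ bray n (zz a) 1 != 0,
        l%:R + bq n (zz a) + a = 0,
        normc a / 2 <= normc (zz a),
        normc (zz a - (- a + hd)) <= C / normc a &
        normc (berr n (zz a) - (kap n)%:C / zz a) <= C / normc (zz a) ^+ 2]) /\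
    (forall a b : R[i], rho <= normc a -> c * normc a <= - Re a ->
      rho <= normc b -> c * normc b <= - Re b ->
      normc (zz a - zz b) <= 2 * normc (a - b)).
Proof.
move=> c0; have c20 : 0 < c / 2 by lra.
have [C [C0 [rho0 [rho01 [bz asy bnd lip]]]]] := berr_summary n0 c20.
(* In this order: [(rho0 + 1) / c] gives [rho0 <= Re z] on the disc, [2 / c] and [2 d] keep the disc
   in the cone of constant [c / 2], and [2 C] gives [|berr| <= 1]. *)
pose rho := 2 + (rho0 + 1) / c + 2 / c + 2 * d%:R + 2 * C.
have d0 : 0 <= d%:R :> R by [].
have r1 : 0 <= (rho0 + 1) / c by rewrite divr_ge0 ?ltW//; lra.
have r2 : 0 <= 2 / c by rewrite divr_ge0 ?ltW.
exists (2 * C); split; first by rewrite mulr_ge0.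
exists rho; split; first by rewrite /rho; lra.
have disk (a z : R[i]) : rho <= normc a -> c * normc a <= - Re a ->
   normc (z - (- a + hd)) <= 1 ->
   [/\ rho0 <= Re z, c / 2 * normc z <= Re z & normc a / 2 <= normc z].
  move=> ra ca zb.
  have hh := normc_hd.
  have h1 : - 1 <= Re z - Re (- a + hd).
    have := normRe_le (z - (- a + hd)); rewrite ReB.
    by move=> h; have := le_trans h zb; rewrite ler_norml => /andP[].
  have hRe : 0 <= Re hd.
    have -> : hd = ((d%:R - 1) / 2)%:C by rewrite /hd !RCE.
    have : 1 <= d%:R :> R by rewrite ler1n ltnW.
    rewrite ReC; lra.
  rewrite ReD ReN in h1.
  have h2 : normc z <= normc a + d%:R + 1.
    have := normcD (z - (- a + hd)) (- a + hd); rewrite subrK.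
    have := normcD (- a) hd; rewrite normcN; lra.
  have h3 : normc a - d%:R - 1 <= normc z.
    have := normcB_ge (- a + hd) ((- a + hd) - z); rewrite subKr normcBC.
    have := normcB_ge (- a) (- hd); rewrite opprK !normcN; lra.
  have ca1 : rho0 + 1 <= c * normc a.
    have : (rho0 + 1) / c <= normc a by rewrite /rho in ra; lra.
    by rewrite ler_pdivrMr// mulrC.
  have ca2 : 2 + c * (d%:R + 1) <= c * normc a.
    have : 2 / c + (d%:R + 1) <= normc a by rewrite /rho in ra; lra.
    by rewrite -(ler_pM2l c0) mulrDr mulrCA mulfV ?mulr1 ?lt0r_neq0.
  have na : 2 * d%:R + 2 <= normc a by rewrite /rho in ra; lra.
  split; [lra| |lra].
  have : c / 2 * normc z <= c / 2 * (normc a + d%:R + 1) by rewrite ler_wpM2l// ltW.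
  lra.
(* Outside the region the value 0 is arbitrary, so that choice yields a total function. Its
   regularity comes from the Lipschitz bound proved last. *)
have ex (a : R[i]) : exists z : R[i], rho <= normc a -> c * normc a <= - Re a ->
    normc (z - (- a + hd)) <= 1 /\ z = - a + hd - berr n z.
  have [ra|] := leP rho (normc a); last by move=> h; exists 0 => ?; exfalso; lra.
  have [ca|] := leP (c * normc a) (- Re a); last by move=> h; exists 0 => ? ?; exfalso; lra.
  have [z zb|z w zb wb|z zb zE] := @complex_contraction R (fun z => - a + hd - berr n z) (- a + hd).
  - have [h1 h2 h3] := disk a z ra ca zb.
    rewrite (_ : - a + hd - berr n z - _ = - berr n z); last by ring.
    rewrite normcN (le_trans (bnd z h1 h2))//.
    have z0 : 0 < normc z by rewrite /rho in ra; lra.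
    by rewrite ler_pdivrMr// mul1r; rewrite /rho in ra; lra.
  - have [h1 h2 h3] := disk a z ra ca zb; have [k1 k2 k3] := disk a w ra ca wb.
    rewrite (_ : - a + hd - berr n z - _ = - (berr n z - berr n w)); last by ring.
    by rewrite normcN; exact: lip.
  - by exists z => _ _.
have [zz zzP] := boolp.choice ex.
exists zz; split.
  move=> a ra ca; have [zb zE] := zzP a ra ca; have [h1 h2 h3] := disk a (zz a) ra ca zb.
  have a0 : 0 < normc a by rewrite /rho in ra; lra.
  have z0 : 0 < normc (zz a) by lra.
  split => //.
  - by split; [lra|exact: bz].
  - exact: fixed_point_eq bidxE zE.
  - rewrite (_ : zz a - _ = - berr n (zz a)); last by rewrite {1}zE; ring.
    rewrite normcN (le_trans (bnd _ h1 h2))// -mulrA mulrCA ler_wpM2l//.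
    by rewrite -[2]invrK -invfM lef_pV2 ?posrE ?mulr_gt0 ?invr_gt0// mulrC.
  - apply: (le_trans (asy _ h1 h2)); apply: ler_wpM2r; last by lra.
    by rewrite invr_ge0 exprn_ge0// ltW.
move=> a b ra ca rb cb; have [za zaE] := zzP a ra ca; have [zb zbE] := zzP b rb cb.
have [h1 h2 _] := disk a (zz a) ra ca za; have [k1 k2 _] := disk b (zz b) rb cb zb.
have h := lip _ _ h1 h2 k1 k2.
have : normc (zz a - zz b) <= normc (a - b) + normc (berr n (zz a) - berr n (zz b)).
  have -> : zz a - zz b = - (a - b) - (berr n (zz a) - berr n (zz b)).
    by rewrite {1}zaE {1}zbE; ring.
  by rewrite (le_trans (normcB _ _))// normcN.
lra.
Qed.

End spectral_curve.

(** * The weak formulation *)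

Section complex_integral.
Context {R : realType} {d : nat}.
Local Notation Re := complex.Re.
Local Notation Im := complex.Im.
Variables (mu : {measure set 'rV[R]_d -> \bar R}) (D : set 'rV[R]_d).
Hypothesis mD : measurable D.
Implicit Types f g : 'rV[R]_d -> R[i].

Definition cint f : Prop :=
  mu.-integrable D (EFin \o (fun x => Re (f x))) /\
  mu.-integrable D (EFin \o (fun x => Im (f x))).

Lemma cint_D f g : cint f -> cint g -> cint (fun x => f x + g x).
Proof.
move=> [f1 f2] [g1 g2]; split.
  rewrite (_ : _ \o _ = (EFin \o (fun x => Re (f x))) \+ (EFin \o (fun x => Re (g x))))%E.
    exact: integrableD.
  by apply/funext => x /=; rewrite ReD EFinD.
rewrite (_ : _ \o _ = (EFin \o (fun x => Im (f x))) \+ (EFin \o (fun x => Im (g x))))%E.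
  exact: integrableD.
by apply/funext => x /=; rewrite ImD EFinD.
Qed.

Lemma cint_ext f g : {in D, f =1 g} -> cint f -> cint g.
Proof.
move=> fg [f1 f2]; split; [move: f1|move: f2]; apply: eq_integrable => // x xD /=;
  by rewrite fg.
Qed.

Lemma eq_cintegral f g : {in D, f =1 g} -> cintegral mu D f = cintegral mu D g.
Proof.
move=> fg; rewrite /cintegral; congr (_ +i* _); apply: eq_Rintegral => x xD; by rewrite fg.
Qed.

Lemma cintegralD f g : cint f -> cint g ->
  cintegral mu D (fun x => f x + g x) = cintegral mu D f + cintegral mu D g.
Proof.
move=> [f1 f2] [g1 g2]; apply: complex_ext; rewrite !ReImE /= -RintegralD//;
  by apply: eq_Rintegral => x _; rewrite !ReImE.
Qed.

Lemma cint0 : cint (fun=> 0).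
Proof. by split; exact: integrable0. Qed.

Lemma cintegral0 : cintegral mu D (fun=> 0) = 0.
Proof.
by rewrite /cintegral /Rintegral /= !integral0.
Qed.

Lemma integrable_scale (r : R) (h : 'rV[R]_d -> R) :
  mu.-integrable D (EFin \o h) -> mu.-integrable D (EFin \o (fun x => r * h x)).
Proof.
move=> ih; rewrite (_ : _ \o _ = (fun x => r%:E * (EFin \o h) x)%E).
  exact: integrableZl.
by apply/funext => x /=; rewrite EFinM.
Qed.

Lemma cintegralZ (c : R[i]) f : cint f ->
  cintegral mu D (fun x => c * f x) = c * cintegral mu D f.
Proof.
move=> [f1 f2]; apply: complex_ext; rewrite !ReImE /= -!RintegralZl//.
  rewrite -RintegralB//; [|exact: integrable_scale|exact: integrable_scale].
  by apply: eq_Rintegral => x _; rewrite ReM.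
rewrite -RintegralD//; [|exact: integrable_scale|exact: integrable_scale].
by apply: eq_Rintegral => x _; rewrite ImM.
Qed.

Lemma cint_sum n (F : 'I_n -> 'rV[R]_d -> R[i]) : (forall i, cint (F i)) ->
  cint (fun x => \sum_(i < n) F i x).
Proof.
elim: n => [|n IH] in F *.
  by move=> _; apply: cint_ext cint0 => x _; rewrite big_ord0.
move=> H; apply: (@cint_ext (fun x => \sum_(i < n) F (widen_ord (leqnSn n) i) x + F ord_max x)).
  by move=> x _; rewrite big_ord_recr.
by apply: cint_D => //; exact: IH.
Qed.

Lemma cintegral_sum n (F : 'I_n -> 'rV[R]_d -> R[i]) : (forall i, cint (F i)) ->
  cintegral mu D (fun x => \sum_(i < n) F i x) = \sum_(i < n) cintegral mu D (F i).
Proof.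
elim: n => [|n IH] in F *.
  move=> _; rewrite big_ord0 -[RHS]cintegral0; apply: eq_cintegral => x _.
  by rewrite big_ord0.
move=> H; rewrite big_ord_recr /= -IH// -cintegralD//; last exact: cint_sum.
by apply: eq_cintegral => x _; rewrite big_ord_recr.
Qed.

Hypothesis muD : (mu D < +oo)%E.

Lemma cint_bounded f (M : R) : measurable_fun D (fun x => Re (f x)) ->
  measurable_fun D (fun x => Im (f x)) -> (forall x, D x -> normc (f x) <= M) -> cint f.
Proof.
move=> m1 m2 fM; split; apply: measurable_bounded_integrable => //;
  exists M; (split; first exact: num_real) => y My x Dx; apply: le_trans (ltW My);
  apply: le_trans (fM x Dx); [exact: normRe_le|exact: normIm_le].
Qed.

End complex_integral.

Section complex_divergence.
Context {R : realType} {n : nat}.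
Local Notation Re := complex.Re.
Local Notation Im := complex.Im.
Local Notation leb := (@lebesgue_rV R n.+1).
Local Notation B := (@unit_ball R n.+1).
Local Notation S := (@unit_sphere R n.+1).
Local Notation sigma := (@sphere_measure R n.+1).
Local Notation dv i := (@delta_mx R 1 n.+1 ord0 i).

Lemma sphere_measure_fin : (sigma S < +oo)%E.
Proof.
have -> : sigma S = ((n.+1%:R)%:E * leb ((@radial_proj R n.+1 @^-1` S) `&` B))%E by [].
apply: lte_mul_pinfty => //.
have mP : measurable (@radial_proj R n.+1 @^-1` S).
  by rewrite -[X in measurable X]setTI; apply: measurable_radial_proj => //; exact: measurable_unit_sphere.
have mB := @measurable_unit_ball R n.+1.
apply: (le_lt_trans _ (@lebesgue_rV_ball R n.+1)); apply: le_measure; rewrite ?inE//.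
exact: measurableI.
Qed.

Lemma ccont_measurable (f : 'rV[R]_n.+1 -> R[i]) (D : set 'rV[R]_n.+1) : ccont f ->
  measurable_fun D (fun x => Re (f x)) /\ measurable_fun D (fun x => Im (f x)).
Proof.
by move=> [f1 f2]; split; apply: measurable_funTS; exact: continuous_measurable_rV.
Qed.

Lemma ccont_box_bounded (f : 'rV[R]_n.+1 -> R[i]) : ccont f ->
  exists2 M, 0 <= M & forall x, box n.+1 1 x -> normc (f x) <= M.
Proof.
move=> [f1 f2]; have [M1 M10 h1] := continuous_box_bounded 1 f1.
have [M2 M20 h2] := continuous_box_bounded 1 f2.
exists (M1 + M2) => [|x bx]; first exact: addr_ge0.
by rewrite (le_trans (normc_le_add _))// lerD// ?h1 ?h2.
Qed.

Lemma ccont_cint_ball (f : 'rV[R]_n.+1 -> R[i]) : ccont f -> cint leb B f.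
Proof.
move=> cf; have [m1 m2] := ccont_measurable B cf.
have [M _ fM] := ccont_box_bounded cf.
apply: (@cint_bounded R n.+1 leb B _ _ f M) => //; first exact: measurable_unit_ball.
  exact: lebesgue_rV_ball.
by move=> x Bx; apply: fM; apply: enorm_box; exact: ltW.
Qed.

Lemma ccont_cint_sphere (f : 'rV[R]_n.+1 -> R[i]) : ccont f -> cint sigma S f.
Proof.
move=> cf; have [m1 m2] := ccont_measurable S cf.
have [M _ fM] := ccont_box_bounded cf.
apply: (@cint_bounded R n.+1 sigma S _ _ f M) => //; first exact: measurable_unit_sphere.
  exact: sphere_measure_fin.
by move=> x Sx; apply: fM; apply: enorm_box; rewrite Sx.
Qed.

Lemma complex_divergence (f : 'rV[R]_n.+1 -> R[i]) (G : 'I_n.+1 -> 'rV[R]_n.+1 -> R[i])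
    (i : 'I_n.+1) :
  (forall j x, cder f x (dv j) (G j x)) -> ccont f -> (forall j, ccont (G j)) ->
  cintegral leb B (G i) = cintegral sigma S (fun x => f x * (x ord0 i)%:C).
Proof.
move=> fG [f1 f2] cG; apply: complex_ext => /=.
  rewrite (@ball_divergence R n (fun x => Re (f x)) (fun j x => Re (G j x)) i _ f1).
  - by apply: eq_Rintegral => x _; rewrite ReM ReC ImC mulr0 subr0.
  - by move=> j x; have [] := fG j x.
  - by move=> j; have [] := cG j.
rewrite (@ball_divergence R n (fun x => Im (f x)) (fun j x => Im (G j x)) i _ f2).
- by apply: eq_Rintegral => x _; rewrite ImM ReC ImC mulr0 add0r.
- by move=> j x; have [] := fG j x.
- by move=> j; have [] := cG j.
Qed.

End complex_divergence.

Section L2_limits.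
Context {R : realType} {d : nat}.
Local Notation Re := complex.Re.
Local Notation Im := complex.Im.
Variables (mu : {measure set 'rV[R]_d -> \bar R}) (D : set 'rV[R]_d).
Hypothesis mD : measurable D.
Hypothesis muD : (mu D < +oo)%E.
Implicit Types f g : 'rV[R]_d -> R[i].

Definition cmeas f : Prop :=
  measurable_fun D (fun x => Re (f x)) /\ measurable_fun D (fun x => Im (f x)).

Lemma cmeas_B f g : cmeas f -> cmeas g -> cmeas (fun x => f x - g x).
Proof.
move=> [f1 f2] [g1 g2]; split.
  rewrite (_ : (fun x => _) = (fun x => Re (f x) - Re (g x))); first exact: measurable_funB.
  by apply/funext => x; rewrite ReB.
rewrite (_ : (fun x => _) = (fun x => Im (f x) - Im (g x))); first exact: measurable_funB.
by apply/funext => x; rewrite ImB.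
Qed.

Lemma cmeas_mulJ f g : cmeas f -> cmeas g -> cmeas (fun x => f x * (g x)^*).
Proof.
move=> [f1 f2] [g1 g2]; split.
  rewrite (_ : (fun x => _) = (fun x => Re (f x) * Re (g x) + Im (f x) * Im (g x))).
    by apply: measurable_funD; exact: measurable_funM.
  by apply/funext => x; rewrite !ReImE; ring.
rewrite (_ : (fun x => _) = (fun x => Im (f x) * Re (g x) - Re (f x) * Im (g x))).
  by apply: measurable_funB; exact: measurable_funM.
by apply/funext => x; rewrite !ReImE; ring.
Qed.

Lemma sqr_normc_integrable g : cmeas g -> (L2_norm_sq mu D g < +oo)%E ->
  mu.-integrable D (EFin \o (fun x => normc (g x) ^+ 2)).
Proof.
move=> [g1 g2] gf; apply/integrableP; split.
  apply/measurable_EFinP; under eq_fun do rewrite sqr_normcE.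
  by apply: measurable_funD; exact: measurable_funX.
rewrite (le_lt_trans _ gf)// /L2_norm_sq le_eqVlt; apply/orP; left; apply/eqP.
by apply: eq_integral => x _ /=; rewrite ger0_norm// exprn_ge0// normc_ge0.
Qed.

(* t <= e + t^2 / e replaces the Cauchy-Schwarz inequality. *)
Lemma bounded_mul_L2 (M e : R) (P : 'rV[R]_d -> R) g : 0 < e -> 0 <= M ->
  cmeas g -> (L2_norm_sq mu D g < +oo)%E -> measurable_fun D P ->
  (forall x, D x -> `|P x| <= M * normc (g x)) ->
  mu.-integrable D (EFin \o P) /\
  `|\int[mu]_(x in D) P x| <= M * e * fine (mu D) + M / e * fine (L2_norm_sq mu D g).
Proof.
move=> e0 M0 mg gf mP PM.
have ig := sqr_normc_integrable mg gf.
pose Q x := M * e + M / e * normc (g x) ^+ 2.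
have PQ x : D x -> `|P x| <= Q x.
  move=> Dx; apply: (le_trans (PM x Dx)).
  rewrite /Q (_ : M * e + _ = M * (e + normc (g x) ^+ 2 / e)); last by ring.
  rewrite ler_wpM2l// -(ler_pM2r e0) mulrDl mulfVK ?lt0r_neq0//.
  have := normc_ge0 (g x); have := sqr_ge0 (normc (g x) - e / 2); nra.
have ic : mu.-integrable D (EFin \o (fun=> M * e)).
  apply: measurable_bounded_integrable => //.
  by exists `|M * e|; split => [|y My x _]; [exact: num_real|exact: ltW].
have iQ2 : mu.-integrable D (EFin \o (fun x => M / e * normc (g x) ^+ 2)).
  exact: integrable_scale.
have iQ : mu.-integrable D (EFin \o Q).
  have H := integrableD mD ic iQ2.
  apply: eq_integrable H => // x _ /=; by rewrite /Q EFinD.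
have iP : mu.-integrable D (EFin \o P).
  apply: (le_integrable mD _ _ iQ); first exact/measurable_EFinP.
  move=> x Dx /=; rewrite lee_fin (le_trans (PQ x Dx))// ler_norm //.
split; first exact: iP.
have iPn : mu.-integrable D (EFin \o (fun x => `|P x|)).
  have H := integrable_abse iP; apply: eq_integrable H => // x _ /=.
have h1 := le_normr_Rintegral mD iP; apply: (le_trans h1).
have h2 : \int[mu]_(x in D) `|P x| <= \int[mu]_(x in D) Q x by exact: le_Rintegral.
apply: (le_trans h2).
rewrite /Q RintegralD// Rintegral_cst// RintegralZl//.
Qed.

Definition ccvg (u : nat -> R[i]) (l : R[i]) : Prop :=
  (Re (u k) @[k --> \oo] --> Re l) /\ (Im (u k) @[k --> \oo] --> Im l).

(** On a set of finite measure, pairing with a bounded function is continuous for [L^2] convergence.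
    This is how Green's formula passes to general test functions. *)
Lemma L2_cvg_cintegral (b v : 'rV[R]_d -> R[i]) (w : nat -> 'rV[R]_d -> R[i]) (M : R) :
  0 <= M -> cmeas b -> (forall x, D x -> normc (b x) <= M) ->
  L2 mu D v -> (forall k, cmeas (w k)) -> L2_cvg mu D w v ->
  ccvg (fun k => cintegral mu D (fun x => b x * (w k x)^*))
    (cintegral mu D (fun x => b x * (v x)^*)) /\ cint mu D (fun x => b x * (v x)^*).
Proof.
move=> M0 mb bM [v1 v2 vf] mw wv.
have mv : cmeas v by [].
have key (P : R[i] -> R) : (forall z, `|P z| <= normc z) -> (forall y z, P (y - z) = P y - P z) ->
   (forall f, cmeas f -> measurable_fun D (fun x => P (f x))) ->
   (\int[mu]_(x in D) P (b x * (w k x)^*) @[k --> \oo] --> \int[mu]_(x in D) P (b x * (v x)^*)) /\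
   mu.-integrable D (EFin \o (fun x => P (b x * (v x)^*))).
  move=> PN PB mP.
  have PM g x : D x -> `|P (b x * (g x)^*)| <= M * normc (g x).
    move=> Dx; rewrite (le_trans (PN _))// normcM normcJ ler_wpM2r ?normc_ge0//.
    exact: bM.
  have mPg g : cmeas g -> measurable_fun D (fun x => P (b x * (g x)^*)).
    by move=> mg; apply: mP; exact: cmeas_mulJ.
  have [iv _] := bounded_mul_L2 ltr01 M0 mv vf (mPg _ mv) (PM v).
  split => //; apply/cvgrPdist_le => /= dl dl0.
  have K0 : 0 <= fine (mu D) by exact/fine_ge0.
  (* This makes the measure term of [bounded_mul_L2] at most [dl / 2]; with [e] fixed, the [L^2]
     term is small for large [k]. Adding 1 avoids a zero denominator. *)
  pose e := dl / (2 * (M * fine (mu D) + 1)).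
  have MK : 0 <= M * fine (mu D) by exact: mulr_ge0.
  have e0 : 0 < e by rewrite divr_gt0// mulr_gt0//; lra.
  pose q k := L2_norm_sq mu D (fun x => w k x - v x).
  have /fine_cvgP[qfin qlim] : q k @[k --> \oo] --> (0 : R)%:E by exact: wv.
  have M1 : 0 < M + 1 by rewrite ltr_wpDl.
  have h0 : 0 < dl * e / (2 * (M + 1)) by apply: divr_gt0; apply: mulr_gt0.
  have /cvgrPdist_lt /(_ _ h0) qs := qlim.
  near=> k.
  have qk : (q k < +oo)%E.
    have h : q k \is a fin_num by near: k; exact: qfin.
    by rewrite ltey_eq h.
  have q0 : (0 <= q k)%E by apply: integral_ge0 => x _; rewrite lee_fin exprn_ge0// normc_ge0.
  have mg := cmeas_B (mw k) mv.
  have [ig gb] := bounded_mul_L2 e0 M0 mg qk (mPg _ mg) (PM _).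
  have Ew : \int[mu]_(x in D) P (b x * (w k x)^*) =
     \int[mu]_(x in D) P (b x * (w k x - v x)^*) + \int[mu]_(x in D) P (b x * (v x)^*).
    rewrite -RintegralD//; apply: eq_Rintegral => x _.
    rewrite (_ : b x * (w k x - v x)^* = b x * (w k x)^* - b x * (v x)^*).
      by rewrite PB subrK.
    by rewrite rmorphB mulrBr.
  rewrite Ew distrC addrK; apply: (le_trans gb).
  rewrite -/(q k).
  have qk2 : fine (q k) < dl * e / (2 * (M + 1)).
    have : `|0 - fine (q k)| < dl * e / (2 * (M + 1)) by near: k; exact: qs.
    by rewrite sub0r normrN ger0_norm// fine_ge0.
  have t1 : M * e * fine (mu D) <= dl / 2.
    rewrite (_ : M * e * fine (mu D) = dl / 2 * ((M * fine (mu D)) / (M * fine (mu D) + 1))).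
      rewrite ger_pMr ?divr_gt0// ler_pdivrMr; lra.
    by rewrite /e; field; rewrite lt0r_neq0//; lra.
  have t2 : M / e * fine (q k) <= dl / 2.
    apply: (@le_trans _ _ (M / e * (dl * e / (2 * (M + 1))))).
      apply: ler_wpM2l; last exact: ltW.
      by apply: divr_ge0 => //; exact: ltW.
    rewrite (_ : _ * _ = dl / 2 * (M / (M + 1))).
      rewrite ger_pMr ?divr_gt0// ler_pdivrMr; lra.
    by field; rewrite !lt0r_neq0//; lra.
  rewrite (splitr dl); exact: lerD.
have [r1 r2] := key _ (@normRe_le R) (@ReB R) (fun f mf => proj1 mf).
have [i1 i2] := key _ (@normIm_le R) (@ImB R) (fun f mf => proj2 mf).
by split; split.
Unshelve. all: by end_near.
Qed.

End L2_limits.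

Section ccvg_theory.
Context {R : realType}.
Implicit Types u v : nat -> R[i].

Lemma ccvg_D u v (l m : R[i]) : ccvg u l -> ccvg v m -> ccvg (fun k => u k + v k) (l + m).
Proof.
move=> [u1 u2] [v1 v2]; split; rewrite ?ReD ?ImD; under eq_fun do rewrite ?ReD ?ImD;
  exact: cvgD.
Qed.

Lemma ccvg_cst (c : R[i]) : ccvg (fun=> c) c.
Proof. by split; exact: cvg_cst. Qed.

Lemma ccvg_sum n (F : 'I_n -> nat -> R[i]) (l : 'I_n -> R[i]) :
  (forall i, ccvg (F i) (l i)) -> ccvg (fun k => \sum_(i < n) F i k) (\sum_(i < n) l i).
Proof.
elim: n => [|n IH] in F l *.
  move=> _; rewrite big_ord0 (_ : (fun k => _) = fun=> 0); first exact: ccvg_cst.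
  by apply/funext => k; rewrite big_ord0.
move=> H; rewrite big_ord_recr /= (_ : (fun k => _) = (fun k =>
  \sum_(i < n) F (widen_ord (leqnSn n) i) k + F ord_max k)).
  by apply: ccvg_D => //; exact: IH.
by apply/funext => k; rewrite big_ord_recr.
Qed.

Lemma ccvg_unique u (l m : R[i]) : ccvg u l -> ccvg u m -> l = m.
Proof.
move=> [u1 u2] [v1 v2]; apply: complex_ext; [move: u1 v1|move: u2 v2];
  exact: cvg_unique.
Qed.

End ccvg_theory.

Section smooth_eigenfunction.
Context {R : realType} {n : nat}.
Local Notation Re := complex.Re.
Local Notation Im := complex.Im.
Local Notation leb := (@lebesgue_rV R n.+1).
Local Notation B := (@unit_ball R n.+1).
Local Notation S := (@unit_sphere R n.+1).
Local Notation sigma := (@sphere_measure R n.+1).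
Local Notation dv i := (@delta_mx R 1 n.+1 ord0 i).

Lemma C1_cder (w : 'rV[R]_n.+1 -> R[i]) : C1_complex w ->
  [/\ ccont w, forall i x, cder w x (dv i) (cpartial i w x) & forall i, ccont (cpartial i w)].
Proof.
move=> [[c1 d1] [c2 d2]]; split; first by split.
- move=> i x; have [/(_ x) e1 _] := d1 i; have [/(_ x) e2 _] := d2 i.
  exact: conj (DeriveDef e1 erefl) (DeriveDef e2 erefl).
- by move=> i; have [_ e1] := d1 i; have [_ e2] := d2 i.
Qed.

Lemma cder_C1 (w : 'rV[R]_n.+1 -> R[i]) (g : 'I_n.+1 -> 'rV[R]_n.+1 -> R[i]) :
  ccont w -> (forall i x, cder w x (dv i) (g i x)) -> (forall i, ccont (g i)) ->
  C1_complex w /\ forall i, cpartial i w = g i.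
Proof.
move=> [c1 c2] dw cg.
have E1 i : partial i (fun x => Re (w x)) = (fun x => Re (g i x)).
  by apply/funext => x; have [e1 _] := dw i x; rewrite /partial derive_val.
have E2 i : partial i (fun x => Im (w x)) = (fun x => Im (g i x)).
  by apply/funext => x; have [_ e1] := dw i x; rewrite /partial derive_val.
split; last first.
  move=> i; apply/funext => x; apply: complex_ext => /=.
    by rewrite -[LHS]/(partial i (fun x => Re (w x)) x) E1.
  by rewrite -[LHS]/(partial i (fun x => Im (w x)) x) E2.
split; (split => // i; split => [x|/=]).
- by have [[]] := dw i x.
- by rewrite E1; have [] := cg i.
- by have [_ []] := dw i x.
- by rewrite E2; have [] := cg i.
Qed.

Lemma ccont_L2 (mu : {measure set 'rV[R]_n.+1 -> \bar R}) (D : set 'rV[R]_n.+1) f :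
  measurable D -> (mu D < +oo)%E -> D `<=` box n.+1 1 -> ccont f -> L2 mu D f.
Proof.
move=> mD muD Dbox cf; have [m1 m2] := ccont_measurable D cf; split => //.
have [M M0 fM] := ccont_box_bounded cf.
apply: (@le_lt_trans _ _ (\int[mu]_(x in D) (M ^+ 2)%:E)%E).
  apply: ge0_le_integral => //.
  - by move=> x _; rewrite lee_fin exprn_ge0// normc_ge0.
  - apply/measurable_EFinP; under eq_fun do rewrite sqr_normcE.
    by apply: measurable_funD; exact: measurable_funX.
  - move=> x Dx; rewrite lee_fin; apply: lerXn2r; rewrite ?nnegrE ?normc_ge0//.
    by apply: fM; exact: Dbox.
by rewrite integral_cst// lte_mul_pinfty// lee_fin exprn_ge0.
Qed.

Let mB := @measurable_unit_ball R n.+1.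
Let mS := @measurable_unit_sphere R n.
Let lB := @lebesgue_rV_ball R n.+1.
Let lS := @sphere_measure_fin R n.

Let Bbox : B `<=` box n.+1 1.
Proof. by move=> x Bx; apply: enorm_box; exact: ltW. Qed.

Let Sbox : S `<=` box n.+1 1.
Proof. by move=> x Sx; apply: enorm_box; rewrite Sx. Qed.

Variables (u : 'rV[R]_n.+1 -> R[i]) (g : 'I_n.+1 -> 'rV[R]_n.+1 -> R[i]).
Hypothesis cu : ccont u.
Hypothesis du : forall i x, cder u x (dv i) (g i x).
Hypothesis cg : forall i, ccont (g i).

(** The divergence theorem for [u phi]: the boundary term vanishes because the support of [phi] lies
    in the open ball. *)
Lemma smooth_H1 : H1 B u g.
Proof.
split; [exact: ccont_L2|by move=> i; exact: ccont_L2|].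
move=> phi i [sphi [K [_ KB phi0]]].
have [cphi dphi] := sphi 1%N.
have cp : ccont (fun x => (phi x)%:C) by exact: ccont_real.
have cdp j : ccont (fun x => (partial j phi x)%:C).
  by apply: ccont_real; have [_] := dphi j.
have dp j x : cder (fun x => (phi x)%:C) x (dv j) (partial j phi x)%:C.
  by apply: cder_real; have [/(_ x) e _] := dphi j; apply: DeriveDef.
have i1 : cint leb B (fun x => g i x * (phi x)%:C) by apply: ccont_cint_ball; exact: ccont_M.
have i2 : cint leb B (fun x => u x * (partial i phi x)%:C).
  by apply: ccont_cint_ball; exact: ccont_M.
have := @complex_divergence R n (fun x => u x * (phi x)%:C)
  (fun j x => g j x * (phi x)%:C + u x * (partial j phi x)%:C) i.
rewrite (@cintegralD R n.+1 leb B mB _ _ i1 i2) => H.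
apply/eqP; rewrite -addr_eq0 addrC; apply/eqP; rewrite H.
- rewrite -[RHS](cintegral0 sigma S); apply: eq_cintegral => x; rewrite inE => Sx.
  rewrite phi0 ?mulr0 ?mul0r// => /KB; rewrite /unit_ball /= Sx; lra.
- by move=> j x; exact: cder_M.
- exact: ccont_M.
- by move=> j; apply: ccont_D; exact: ccont_M.
Qed.

(** As [u] is [C^1] on the whole space, the constant sequence [u] approximates it. *)
Lemma smooth_trace : trace B S sigma u g u.
Proof.
split; first exact: ccont_L2.
have [C1u Eg] := cder_C1 cu du cg.
have triv mu D (f : 'rV[R]_n.+1 -> R[i]) : L2_cvg mu D (fun=> f) f.
  rewrite /L2_cvg (_ : (fun k => _) = fun=> 0%E); first exact: cvg_cst.
  apply/funext => k; apply: integral0_eq => x _.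
  by rewrite subrr normc0 expr0n.
exists (fun=> u); split => // i.
by rewrite Eg.
Qed.

Variables (h : 'I_n.+1 -> 'I_n.+1 -> 'rV[R]_n.+1 -> R[i]) (alpha lambda : R[i]).
Hypothesis dg : forall i j x, cder (g i) x (dv j) (h i j x).
Hypothesis ch : forall i j, ccont (h i j).
Hypothesis lap : forall x, \sum_i h i i x = - lambda * u x.
Hypothesis bc : forall x, S x -> \sum_i g i x * (x ord0 i)%:C = - alpha * u x.

(** The divergence theorem is applied to each [g i * w^*] and summed; [lap] rewrites the trace of
    the Hessian and [bc] the normal derivative. *)
Lemma smooth_green (w : 'rV[R]_n.+1 -> R[i]) : C1_complex w ->
  \sum_i cintegral leb B (fun x => g i x * (cpartial i w x)^*) +
  cintegral sigma S (fun x => alpha * u x * (w x)^*) =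
  cintegral leb B (fun x => lambda * u x * (w x)^*).
Proof.
move=> /C1_cder[cw dw cpw].
have i1 i : cint leb B (fun x => h i i x * (w x)^*).
  by apply: ccont_cint_ball; apply: ccont_M => //; exact: ccont_J.
have i2 i : cint leb B (fun x => g i x * (cpartial i w x)^*).
  by apply: ccont_cint_ball; apply: ccont_M => //; exact: ccont_J.
have i3 i : cint sigma S (fun x => g i x * (w x)^* * (x ord0 i)%:C).
  apply: ccont_cint_sphere; apply: ccont_M; last exact/ccont_real/continuous_coord.
  by apply: ccont_M => //; exact: ccont_J.
have div i : cintegral leb B (fun x => h i i x * (w x)^*) +
   cintegral leb B (fun x => g i x * (cpartial i w x)^*) =
   cintegral sigma S (fun x => g i x * (w x)^* * (x ord0 i)%:C).
  rewrite -(cintegralD mB)//.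
  apply: (@complex_divergence R n _ (fun j x => h i j x * (w x)^* + g i x * (cpartial j w x)^*)).
  - by move=> j x; apply: cder_M => //; exact: cder_J.
  - by apply: ccont_M => //; exact: ccont_J.
  - by move=> j; apply: ccont_D; apply: ccont_M => //; exact: ccont_J.
have : \sum_i (cintegral leb B (fun x => h i i x * (w x)^*) +
   cintegral leb B (fun x => g i x * (cpartial i w x)^*)) =
   \sum_i cintegral sigma S (fun x => g i x * (w x)^* * (x ord0 i)%:C).
  by apply: eq_bigr => i _; exact: div.
rewrite big_split /= -(cintegral_sum mB i1) -(cintegral_sum mS i3).
rewrite (_ : cintegral leb B (fun x => \sum_(i < n.+1) h i i x * (w x)^*) =
  (- 1) * cintegral leb B (fun x => lambda * u x * (w x)^*)); last first.
  rewrite -(cintegralZ mB); last first.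
    apply: ccont_cint_ball; apply: ccont_M; last exact: ccont_J.
    by apply: ccont_M => //; exact: ccont_cst.
  by apply: eq_cintegral => x _; rewrite -mulr_suml lap; ring.
rewrite (_ : cintegral sigma S (fun x => \sum_(i < n.+1) g i x * (w x)^* * (x ord0 i)%:C) =
  (- 1) * cintegral sigma S (fun x => alpha * u x * (w x)^*)); last first.
  rewrite -(cintegralZ mS); last first.
    apply: ccont_cint_sphere; apply: ccont_M; last exact: ccont_J.
    by apply: ccont_M => //; exact: ccont_cst.
  apply: eq_cintegral => x; rewrite inE => Sx.
  under eq_bigr do rewrite mulrAC.
  by rewrite -mulr_suml bc//; ring.
by rewrite !mulN1r addrC => /eqP; rewrite subr_eq => /eqP ->; rewrite addrAC addNr add0r.
Qed.

(** A trace of the test function [v] comes with [C^1] functions converging to [v], to its gradient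
    and to its trace. Green's formula holds for each of them and passes to the limit term by
    term. *)
Lemma smooth_robin : robin_laplacian B S sigma alpha u (fun x => lambda * u x).
Proof.
have clu : ccont (fun x => lambda * u x) by apply: ccont_M => //; exact: ccont_cst.
have cau : ccont (fun x => alpha * u x) by apply: ccont_M => //; exact: ccont_cst.
split; first exact: ccont_L2.
exists g, u; split; [exact: smooth_H1|exact: smooth_trace|].
move=> v p s [Lv Lp _] [Ls [w [C1w wv wp ws]]].
have lim (mu : {measure set 'rV[R]_n.+1 -> \bar R}) D b f (W : nat -> 'rV[R]_n.+1 -> R[i]) :
    measurable D -> (mu D < +oo)%E -> D `<=` box n.+1 1 -> ccont b -> L2 mu D f ->
    (forall k, ccont (W k)) -> L2_cvg mu D W f ->
    ccvg (fun k => cintegral mu D (fun x => b x * (W k x)^*))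
      (cintegral mu D (fun x => b x * (f x)^*)) /\ cint mu D (fun x => b x * (f x)^*).
  move=> mD muD Dbox cb Lf cW Wf.
  have [M M0 bM] := ccont_box_bounded cb.
  apply: (@L2_cvg_cintegral R n.+1 mu D mD muD b f W M) => //.
  - exact: ccont_measurable.
  - by move=> x /Dbox; exact: bM.
  - by move=> k; exact: ccont_measurable.
have cw k : ccont (w k) by have [] := C1_cder (C1w k).
have cpw k i : ccont (cpartial i (w k)) by have [] := C1_cder (C1w k).
have L1 i := lim leb B (g i) (p i) (fun k => cpartial i (w k)) mB lB Bbox (cg i) (Lp i)
  (fun k => cpw k i) (wp i).
have [L2 _] := lim sigma S _ s w mS lS Sbox cau Ls cw ws.
have [L3 _] := lim leb B _ v w mB lB Bbox clu Lv cw wv.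
rewrite /robin_form (cintegral_sum mB); last by move=> i; have [] := L1 i.
apply: ccvg_unique L3.
have L4 := ccvg_D (ccvg_sum (fun i => proj1 (L1 i))) L2.
rewrite (_ : (fun k => cintegral leb B _) = (fun k =>
  \sum_i cintegral leb B (fun x => g i x * (cpartial i (w k) x)^*) +
  cintegral sigma S (fun x => alpha * u x * (w k x)^*)))//.
by apply/funext => k; rewrite smooth_green.
Qed.

End smooth_eigenfunction.

(** * Eigenfunctions *)

Section not_null.
Context {R : realType}.

Lemma lebesgue_rV_box_gt0 n : (0 < @lebesgue_rV R n (box n 1))%E.
Proof.
elim: n => [|n IH].
  rewrite /= /dirac indicE (_ : (0 : 'rV[R]_0) \in box 0 1) ?lte01//.
  by rewrite inE => -[].
have -> : box n.+1 1 =
  [set x : 'rV[R]_n.+1 | `[-1, 1]%classic (x ord0 ord0) /\ box n 1 (\row_i x ord0 (lift ord0 i))].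
  apply/seteqP; split => x /=.
    by move=> H; split => [|i]; [exact: H|rewrite mxE; exact: H].
  move=> [H0 H] i; case: (unliftP ord0 i) => [j ->|-> //].
  by have := H j; rewrite mxE.
rewrite lebesgue_rVS_product//; last exact: measurable_box.
rewrite mule_gt0// lebesgue_measure_itv /= lte_fin ifT; last by lra.
by rewrite -EFinB lte_fin; lra.
Qed.

(** A neighbourhood contains [x0 + (e / 2) box], whose measure is [(e / 2)^n] times the positive
    measure of the box. *)
Lemma nbhs_not_null n (A N : set 'rV[R]_n) (x0 : 'rV[R]_n) :
  nbhs x0 A -> A `<=` N -> measurable N -> @lebesgue_rV R n N <> 0%E.
Proof.
move=> /nbhs_ballP[e /= e0 eA] AN mN N0.
have e20 : 0 < e / 2 by lra.
have mI : measurable_fun [set: 'rV[R]_n] (fun x => (\1_N x)%:E : \bar R).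
  by apply/measurable_EFinP; exact: measurable_indic.
have I0 (x : 'rV[R]_n) : (0 <= (\1_N x)%:E :> \bar R)%E by rewrite lee_fin.
have H := ge0_integral_affine x0 e20 mI I0.
have E0 : (\int[@lebesgue_rV R n]_x (\1_N x)%:E = 0)%E by rewrite integral_indic// setIT; exact: N0.
have : (((e / 2) ^+ n)%:E * @lebesgue_rV R n (box n 1) <= 0 :> \bar R)%E.
  rewrite -[leRHS]E0 H; apply: lee_wpmul2l; first by rewrite lee_fin exprn_ge0 // ltW.
  have <- : (\int[@lebesgue_rV R n]_x (\1_(box n 1) x)%:E = @lebesgue_rV R n (box n 1))%E.
    by rewrite integral_indic ?setIT//; exact: measurable_box.
  apply: ge0_le_integral => //.
  - by apply/measurable_EFinP; apply: measurable_indic; exact: measurable_box.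
  - apply: (@measurableT_comp _ _ _ _ _ _ (fun x => (\1_N x)%:E)) => //.
    exact: measurable_affine.
  move=> x _; rewrite lee_fin !indicE.
  case: (boolP (x \in box n 1)) => [|_]; last by case: (_ \in N).
  rewrite inE => bx; rewrite mem_set//; apply: AN; apply: eA; split => // i j.
  rewrite ord1 /ball /= !mxE opprD addrCA subrr addr0 normrN normrM (ger0_norm (ltW e20)).
  have : `|x ord0 j| <= 1 by rewrite ler_norml; have := bx j; rewrite in_itv.
  nra.
apply/negP; rewrite -ltNge mule_gt0 ?lebesgue_rV_box_gt0//.
by rewrite lte_fin exprn_gt0.
Qed.

Lemma continuous_not_ae0 n (u : 'rV[R]_n.+1 -> R[i]) (x0 : 'rV[R]_n.+1) : ccont u ->
  @unit_ball R n.+1 x0 -> u x0 != 0 ->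
  ~ {ae @lebesgue_rV R n.+1, forall x, @unit_ball R n.+1 x -> u x = 0}.
Proof.
move=> [cu1 cu2] Bx0 ux0 [N [mN N0 sN]].
pose v x := complex.Re (u x) ^+ 2 + complex.Im (u x) ^+ 2.
have vE x : v x = normc (u x) ^+ 2 by rewrite sqr_normcE.
have cv : continuous v by apply: cont_D; exact: cont_X.
have v0 : 0 < v x0 by rewrite vE exprn_gt0// normc_gt0.
apply: (@nbhs_not_null n.+1 [set x | 0 < v x /\ sqn x < 1] N x0) N0 => //.
  have h1 : \forall x \near x0, 0 < v x by exact: (cvgr_gt _ (cv x0)).
  have h2 : \forall x \near x0, sqn x < 1.
    by apply: (cvgr_lt _ (@continuous_sqn R n.+1 x0)); exact/unit_ballE.
  by near=> x; split; near: x.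
move=> x [vx sx]; apply: sN => /= H; move: vx.
by rewrite vE H ?normc0 ?expr0n ?ltxx//; exact/unit_ballE.
Unshelve. all: by end_near.
Qed.

End not_null.

Section eigenfunction.
Context {R : realType} {m : nat}.
Local Notation Re := complex.Re.
Local Notation Im := complex.Im.
Local Notation V := 'rV[R]_m.+2.
Local Notation B := (@unit_ball R m.+2).
Local Notation S := (@unit_sphere R m.+2).
Local Notation sigma := (@sphere_measure R m.+2).
Local Notation dv i := (@delta_mx R 1 m.+2 ord0 i).

(* An isotropic vector: the powers of isolin are harmonic. *)
Definition isov (i : 'I_m.+2) : R[i] :=
  if i == 0 :> nat then 1 else if i == 1 :> nat then 'i else 0.

Lemma isov_sqr : \sum_i isov i ^+ 2 = 0.
Proof.
rewrite big_ord_recl big_ord_recl big1 => [|i _]; last by rewrite /isov /= expr0n.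
by rewrite /isov /= expr1n sqr_i addr0 subrr.
Qed.

Definition isolin (x : V) : R[i] := \sum_i isov i * (x ord0 i)%:C.

Lemma cder_coord (x : V) (i j : 'I_m.+2) :
  cder (fun y : V => (y ord0 i)%:C) x (dv j) ((i == j)%:R : R)%:C.
Proof.
by apply: cder_real; apply: (der_eq (der_coord x (dv j) i)); rewrite mxE eqxx.
Qed.

Lemma cder_isolin (x : V) j : cder isolin x (dv j) (isov j).
Proof.
apply: (cder_eq (cder_sum (fun i => cder_Zl (isov i) (cder_coord x i j)))).
rewrite (bigD1 j)//= eqxx mulr1 big1 ?addr0// => i /negPf ->.
by rewrite mulr0.
Qed.

Lemma ccont_coord i : ccont (fun x : V => (x ord0 i)%:C).
Proof. exact/ccont_real/continuous_coord. Qed.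

Lemma ccont_isolin : ccont isolin.
Proof.
by apply: ccont_sum => i; apply: ccont_M; [exact: ccont_cst|exact: ccont_coord].
Qed.

Variables (l : nat) (w : R[i]).
Let N := (l.*2 + m.+2)%N.
Let N0 : (0 < N)%N. Proof. by rewrite /N addnS. Qed.

Let arg (x : V) : R[i] := w * (sqn x)%:C.

Let cder_arg x j : cder arg x (dv j) (2 * w * (x ord0 j)%:C).
Proof.
apply: (cder_eq (cder_Zl w (cder_real (der_sqn x (dv j))))).
by rewrite sum_delta RCM RC_nat; ring.
Qed.

Let ccont_arg : ccont arg.
Proof. by apply: ccont_M; [exact: ccont_cst|exact/ccont_real/continuous_sqn]. Qed.

Let F x := bfun N (arg x).
Let F' x := bfun' N (arg x).
Let F'' x := bfun'' N (arg x).

Let e0 : ecoef (@bcoef R N) := ecoef_bcoef N0.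

Let dF x j : cder F x (dv j) (F' x * (2 * w * (x ord0 j)%:C)).
Proof. exact: cder_eseries e0 (cder_arg x j). Qed.

Let dF' x j : cder F' x (dv j) (F'' x * (2 * w * (x ord0 j)%:C)).
Proof. exact: cder_eseries (ecoef_d e0) (cder_arg x j). Qed.

Let cF : ccont F. Proof. exact: ccont_eseries. Qed.
Let cF' : ccont F'. Proof. by apply: ccont_eseries => //; exact: ecoef_d. Qed.
Let cF'' : ccont F''.
Proof. by apply: ccont_eseries => //; apply: ecoef_d; exact: ecoef_d. Qed.

Definition efun (x : V) : R[i] := isolin x ^+ l * F x.

(** Truncated predecessors are harmless here and in [ehess]: the power [l.-1] comes with the factor
    [l], and [l.-1.-1] with [l] and [l.-1]. *)
Definition egrad (i : 'I_m.+2) (x : V) : R[i] :=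
  l%:R * isov i * (isolin x ^+ l.-1 * F x) + 2 * w * (isolin x ^+ l * F' x * (x ord0 i)%:C).

Definition ehess (i j : 'I_m.+2) (x : V) : R[i] :=
  l%:R * isov i * (l.-1%:R * isolin x ^+ l.-1.-1 * isov j * F x +
     isolin x ^+ l.-1 * (F' x * (2 * w * (x ord0 j)%:C))) +
  2 * w * ((l%:R * isolin x ^+ l.-1 * isov j * F' x +
     isolin x ^+ l * (F'' x * (2 * w * (x ord0 j)%:C))) * (x ord0 i)%:C +
     isolin x ^+ l * F' x * ((i == j)%:R : R)%:C).

Lemma cder_efun i x : cder efun x (dv i) (egrad i x).
Proof.
apply: (cder_eq (cder_M (cder_X l (cder_isolin x i)) (dF x i))).
by rewrite /egrad; ring.
Qed.

Lemma cder_egrad i j x : cder (egrad i) x (dv j) (ehess i j x).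
Proof.
apply: cder_D; apply: cder_Zl.
  by apply: cder_M => //; apply: cder_X; exact: cder_isolin.
apply: cder_M; last exact: cder_coord.
by apply: cder_M => //; apply: cder_X; exact: cder_isolin.
Qed.

Let cX k : ccont (fun x => isolin x ^+ k).
Proof. by apply: ccont_X; exact: ccont_isolin. Qed.

Lemma ccont_efun : ccont efun. Proof. exact: ccont_M. Qed.

Let cc (c : R[i]) (f : V -> R[i]) : ccont f -> ccont (fun x => c * f x).
Proof. by move=> cf; apply: ccont_M => //; exact: ccont_cst. Qed.

Let cco := ccont_coord.

Let ccr (c : R[i]) (f : V -> R[i]) : ccont f -> ccont (fun x => f x * c).
Proof. by move=> cf; apply: ccont_M => //; exact: ccont_cst. Qed.

Lemma ccont_egrad i : ccont (egrad i).
Proof.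
apply: ccont_D; apply: cc; first exact: ccont_M.
by apply: ccont_M => //; exact: ccont_M.
Qed.

Lemma ccont_ehess i j : ccont (ehess i j).
Proof.
apply: ccont_D; apply: cc; apply: ccont_D.
- by apply: ccont_M => //; apply: ccr; exact: cc.
- by apply: ccont_M => //; apply: ccont_M => //; exact: cc.
- apply: ccont_M => //; apply: ccont_D.
    by apply: ccont_M => //; apply: ccr; exact: cc.
  by apply: ccont_M => //; apply: ccont_M => //; exact: cc.
- by apply: ccr; exact: ccont_M.
Qed.

Let sqnE (x : V) : (sqn x)%:C = \sum_i (x ord0 i)%:C ^+ 2.
Proof.
by rewrite (raddf_sum (real_complex R)); apply: eq_bigr => i _; exact: RCX.
Qed.

(** Isotropy removes the term in [isolin^(l-2)]. The cross term gives [isolin^l] by homogeneity,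
    which shifts the dimension from [d] to [2 l + d]; the rest is the equation of [F]. *)
Lemma efun_laplacian x : \sum_i ehess i i x = - (- w) * efun x.
Proof.
pose a := l%:R * (l.-1%:R * isolin x ^+ l.-1.-1) * F x.
pose b := 4 * w * (l%:R * isolin x ^+ l.-1) * F' x.
pose c := 4 * w ^+ 2 * isolin x ^+ l * F'' x.
pose e := 2 * w * isolin x ^+ l * F' x.
have -> : \sum_i ehess i i x =
    \sum_i (a * isov i ^+ 2 + b * (isov i * (x ord0 i)%:C) + c * (x ord0 i)%:C ^+ 2 + e).
  apply: eq_bigr => i _; rewrite /ehess eqxx RC1 /a /b /c /e; ring.
rewrite !big_split /= -!mulr_sumr isov_sqr -/(isolin x) -sqnE sumr_const card_ord -mulr_natl.
have bE : b * isolin x = 4 * w * l%:R * isolin x ^+ l * F' x.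
  rewrite /b; case: l => [|k]; first by rewrite !(mul0r, mulr0).
  by rewrite /= exprS; ring.
have ode : F x = 4 * arg x * F'' x + 2 * N%:R * F' x by rewrite /F -(bfun_ode (arg x) N0).
rewrite bE mulr0 add0r opprK /efun ode.
have -> : N%:R = 2 * l%:R + m.+2%:R :> R[i] by rewrite /N natrD -mul2n natrM.
by rewrite /c /e /arg; ring.
Qed.

(** The normal is [x] itself, so Euler's relation for the homogeneous factor gives [l F], and the
    radial factor gives [2 w F']. *)
Lemma egrad_normal x : S x ->
  \sum_i egrad i x * (x ord0 i)%:C = isolin x ^+ l * (l%:R * F x + 2 * w * F' x).
Proof.
move=> /unit_sphereE sx.
have -> : \sum_i egrad i x * (x ord0 i)%:C =
    \sum_i (l%:R * isolin x ^+ l.-1 * F x * (isov i * (x ord0 i)%:C) +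
      2 * w * isolin x ^+ l * F' x * (x ord0 i)%:C ^+ 2).
  by apply: eq_bigr => i _; rewrite /egrad; ring.
rewrite big_split /= -!mulr_sumr -/(isolin x) -sqnE sx RC1.
have -> : l%:R * isolin x ^+ l.-1 * F x * isolin x = l%:R * isolin x ^+ l * F x.
  case: l => [|k]; first by rewrite !mul0r.
  by rewrite /= exprS; ring.
ring.
Qed.

End eigenfunction.

Section robin_eigenfunction.
Context {R : realType} {m : nat}.
Local Notation Re := complex.Re.

Lemma robin_eigenvalue_bq (l : nat) (z alpha : R[i]) :
  0 < Re z -> bray (bidx m.+2 l) z 1 != 0 -> l%:R + bq (bidx m.+2 l) z + alpha = 0 ->
  robin_eigenvalue (@unit_ball R m.+2) (@unit_sphere R m.+2) (@sphere_measure R m.+2)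
    alpha (- z ^+ 2).
Proof.
set n := bidx m.+2 l => z0 b0 eq0.
have nE : (l.*2 + m.+2)%N = n.+1 by rewrite /n /bidx prednK// addnS.
have n0 : (0 < n)%N by rewrite -ltnS -nE addnS ltnS addnS.
exists (efun l (z ^+ 2)); split.
  (* At half the first basis vector [isolin] equals 1/2 and the radial factor is [bray n z (1 / 2)],
     which is nonzero. *)
  pose x0 : 'rV[R]_m.+2 := (1 / 2 : R) *: delta_mx ord0 ord0.
  have sx0 : sqn x0 = (1 / 2) ^+ 2.
    rewrite sqnZ /sqn (bigD1 ord0)//= mxE !eqxx expr1n big1 ?addr0 ?mulr1// => i /negPf i0.
    by rewrite mxE i0 andbF expr0n.
  apply: (@continuous_not_ae0 R _ _ x0); first exact: ccont_efun.
    by apply/unit_ballE; rewrite sx0; lra.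
  apply: mulf_neq0.
    apply: expf_neq0; rewrite /isolin (bigD1 ord0)//= big1 ?addr0.
      rewrite /isov /= mul1r !mxE !eqxx /= mulr1.
      by apply/eqP => /(congr1 (@complex.Re R)) /=; lra.
    by move=> i /negPf i0; rewrite !mxE i0 andbF mulr0 mulr0.
  rewrite nE sx0; apply: (@bray_neq0 R n z) => //; lra.
apply: (@smooth_robin R m.+1 _ (egrad l (z ^+ 2)) _ _ _ (ehess l (z ^+ 2))).
- exact: ccont_efun.
- exact: cder_efun.
- exact: ccont_egrad.
- exact: cder_egrad.
- exact: ccont_ehess.
- exact: efun_laplacian.
- move=> x Sx; rewrite egrad_normal// /efun.
  have sx : sqn x = 1 by exact/unit_sphereE.
  rewrite sx nE [RHS]mulrCA; congr (_ * _).
  have Eb : bfun n.+1 (z ^+ 2 * 1%:C) = bray n z 1 by rewrite /bray expr1n.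
  have Ed : 2 * z ^+ 2 * bfun' n.+1 (z ^+ 2 * 1%:C) = dbray n z 1.
    by rewrite /dbray expr1n RC1 !mulr1.
  rewrite Ed Eb; have -> : alpha = - (l%:R + bq n z) by apply/eqP; rewrite -addr_eq0 addrC eq0.
  by rewrite opprK mulrDl /bq divfK.
Qed.

End robin_eigenfunction.

(** * Eigenvalue curves *)

Section sector_theory.
Context {R : realType}.
Local Notation Re := complex.Re.
Local Notation Im := complex.Im.

Lemma neg_sector_Re (phi : R) (a : R[i]) : 0 < phi -> phi < pi / 2 ->
  neg_sector phi a -> cos phi * normc a <= - Re a.
Proof.
move=> phi0 phi2 [r [theta [r0 tphi ->]]].
have -> : normc (- (r * cos theta +i* (r * sin theta))) = r.
  rewrite normcN /= !exprMn -mulrDr cos2Dsin2 mulr1 sqrtr_sqr ger0_norm// ltW//.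
rewrite /= opprK mulrC; apply: ler_wpM2l; first exact: ltW.
have -> : cos theta = cos `|theta|.
  by case: (ger0P theta) => // _; rewrite cosN.
have pi2 : phi <= pi by have := @pi_gt0 R; lra.
rewrite leNgt ltr_cos ?in_itv /= ?normr_ge0 ?(ltW phi0) ?pi2//.
  by rewrite -leNgt ltW.
by rewrite (le_trans (ltW tphi)).
Qed.

(** The norm of [R[i]] takes values in [R[i]], so the tolerance is a complex number; positivity
    forces it to be real. *)
Lemma lipschitz_near_continuous (f : R[i] -> R[i]) (a : R[i]) (r L : R) : 0 < r -> 0 < L ->
  (forall b, normc (a - b) < r -> normc (f a - f b) <= L * normc (a - b)) ->
  {for a, continuous f}.
Proof.
move=> r0 L0 lip.
suff H : forall e : R[i], 0 < e -> \forall b \near nbhs a, `|f a - f b| <= e.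
  exact: (cvgrPdist_le _ _).2 H.
move=> e e0.
have [er ei] : 0 < Re e /\ Im e = 0.
  by move: e0; rewrite ltcE /= => /andP[/eqP -> ->].
have eE : e = (Re e)%:C by apply: complex_ext; rewrite ?ReC ?ImC.
apply/nbhs_normP; exists (Num.min r (Re e / L))%:C => /=.
  by rewrite ltcR lt_min r0 divr_gt0.
move=> b; rewrite /ball_ /= => ab.
have {ab} : normc (a - b) < Num.min r (Re e / L) by rewrite -ltcR.
rewrite lt_min => /andP[h1 h2].
rewrite eE; have -> : `|f a - f b| = (normc (f a - f b))%:C by [].
rewrite lecR (le_trans (lip b h1))// mulrC -ler_pdivlMr// ltW//.
Qed.

(** [n (n - 2)] takes the same value at distinct [p] and [q] only if [p + q = 2], which is
    impossible for distinct positive integers. *)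
Lemma kap_bidx_inj (d j k : nat) : (2 <= d)%N -> j != k ->
  kap (bidx d j) != kap (bidx d k) :> R.
Proof.
move=> d2 jk; apply/eqP => /(congr1 (fun t => 8 * t)); rewrite /kap.
have b1 l : (1 <= bidx d l)%N.
  by rewrite /bidx -ltnS prednK ?(leq_trans d2 (leq_addl _ _))// (leq_trans _ (leq_addl _ _))// ltnW.
have bE l : (bidx d l).+1 = (l.*2 + d)%N.
  by rewrite /bidx prednK// (leq_trans _ (leq_addl _ _))// ltnW.
have bjk : (bidx d j) != (bidx d k).
  apply: contra jk => /eqP E; have := bE j; rewrite E bE => /eqP.
  by rewrite eqn_add2r => /eqP /double_inj ->.
move: (b1 j) (b1 k) bjk; move: (bidx d j) (bidx d k) => p q p1 q1 pq E.
have : (p%:R - q%:R) * (p%:R + q%:R - 2) = 0 :> R.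
  have : 8 * (p%:R * (p%:R - 2) / 8) - 8 * (q%:R * (q%:R - 2) / 8) = 0 :> R.
    by rewrite E subrr.
  by move=> H; rewrite -[RHS]H; field.
move/eqP; rewrite mulf_eq0 subr_eq0 eqr_nat (negPf pq) /= subr_eq0 -natrD eqr_nat.
move/eqP => pq2; move: pq; apply/negP; rewrite negbK.
by case: p q p1 q1 pq2 {E} => [|[|[|p]]] [|[|[|q]]]; rewrite ?addSn ?addnS.
Qed.

End sector_theory.

Section eigenvalue_curves.
Context {R : realType}.
Local Notation Re := complex.Re.
Variables (m : nat) (phi : R).
Hypotheses (phi0 : 0 < phi) (phi2 : phi < pi / 2).
Let d := m.+2.
Let d2 : (2 <= d)%N. Proof. by []. Qed.
Let hd : R[i] := (d%:R - 1) / 2.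
(** Half of the constant [cos phi] of the sector: a disc around a point of the sector, of radius
    proportional to its modulus, then stays in the cone. Continuity needs such a neighbourhood. *)
Let c : R := cos phi / 2.

Let c0 : 0 < c.
Proof.
apply: divr_gt0 => //; apply: cos_gt0_pihalf; rewrite phi2 andbT.
by apply: lt_trans phi0; rewrite oppr_lt0 divr_gt0// pi_gt0.
Qed.

Let c1 : c <= 1 / 2.
Proof. by rewrite /c; have := cos_le1 phi; lra. Qed.

Definition curve_spec l (t : R * R * (R[i] -> R[i])) : Prop :=
  let: (C, rho, zz) := t in
  0 <= C /\ 1 <= rho /\
  (forall a : R[i], rho <= normc a -> c * normc a <= - Re a ->
    [/\ 0 < Re (zz a) /\ bray (bidx d l) (zz a) 1 != 0,
        l%:R + bq (bidx d l) (zz a) + a = 0,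
        normc a / 2 <= normc (zz a),
        normc (zz a - (- a + hd)) <= C / normc a &
        normc (berr (bidx d l) (zz a) - (kap (bidx d l))%:C / zz a) <= C / normc (zz a) ^+ 2]) /\
  (forall a b : R[i], rho <= normc a -> c * normc a <= - Re a ->
    rho <= normc b -> c * normc b <= - Re b ->
    normc (zz a - zz b) <= 2 * normc (a - b)).

Let sec (a : R[i]) : neg_sector phi a -> c * normc a <= - Re a.
Proof.
move=> sa; have := neg_sector_Re phi0 phi2 sa; have := normc_ge0 a.
have := c0; rewrite /c; nra.
Qed.

Lemma curve_spec_eigenvalue l C rho zz : curve_spec l (C, rho, zz) ->
  \forall a \near sector_infty phi,
    robin_eigenvalue (@unit_ball R d) (@unit_sphere R d) (@sphere_measure R d) a (- zz a ^+ 2).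
Proof.
move=> [_ [_ [H _]]]; exists rho => a /sec sa /ltW ra.
have [[h1 h2] h3 _ _ _] := H a ra sa.
exact: robin_eigenvalue_bq h1 h2 h3.
Qed.

Lemma curve_spec_continuous l C rho zz : curve_spec l (C, rho, zz) ->
  \forall a \near sector_infty phi, {for a, continuous (fun b => - zz b ^+ 2)}.
Proof.
move=> [_ [rho1 [_ L]]]; exists (2 * rho) => a sa ra.
have a0 : 0 < normc a by lra.
have Ra := neg_sector_Re phi0 phi2 sa.
have ca : 0 < c * normc a by exact: mulr_gt0.
have czz : {for a, continuous zz}.
  (* In this disc the modulus stays above [3/4 |a|], hence above [rho] by the choice [2 * rho], and
     the loss in [- Re] is covered by the spare factor 2 in [cos phi = 2 c]. *)
  apply: (@lipschitz_near_continuous R zz a (c * normc a / 2) 2) => //; first by lra.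
  move=> b ab; have := normc_ge0 (a - b) => ab0.
  have nb : normc b <= normc a + normc (a - b).
    by rewrite -{1}(subKr a b) (le_trans (normcB _ _)).
  have nb2 : normc a - normc (a - b) <= normc b.
    by rewrite -{2}(subKr a b); exact: normcB_ge.
  have rb : Re a - Re b >= - normc (a - b).
    by rewrite -ReB; have := normRe_le (a - b); rewrite ler_norml => /andP[].
  have E : cos phi = 2 * c by rewrite /c; field.
  have h4 : c * normc a <= normc a / 2 by move: (c1) a0; nra.
  apply: L; [lra|by rewrite E in Ra; nra|nra|].
  rewrite E in Ra; have := c1; have := c0; nra.
suff : {for a, continuous (fun b => - (zz b * zz b))} by [].
by exact: (cvgN (cvgM czz czz)).
Qed.

(** Put [z = - a + hd + e]. As [2 hd = d - 1], the error is [2 a e - (hd + e)^2], bounded because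
    [|a e| <= C]. *)
Lemma curve_spec_asymptotics l C rho zz : curve_spec l (C, rho, zz) ->
  (fun a => - zz a ^+ 2 - (- a ^+ 2 + a * (d%:R - 1))) =O_ (sector_infty phi) (fun=> 1 : R[i]).
Proof.
move=> [C0 [rho1 [H _]]]; apply/eqO_exP.
exists (2 * C + (normc hd + C) ^+ 2 + 1)%:C.
  rewrite ltcR; have : 0 <= (normc hd + C) ^+ 2 by exact: sqr_ge0.
  by move: (_ ^+ 2) => t t0; lra.
exists rho => a /sec sa /ltW ra.
have [_ _ _ h _] := H a ra sa.
have a1 : 1 <= normc a by lra.
rewrite normr1 mulr1; set e := zz a - (- a + hd) in h.
have -> : - zz a ^+ 2 - (- a ^+ 2 + a * (d%:R - 1)) = 2 * (a * e) - (hd + e) ^+ 2.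
  have -> : zz a = - a + hd + e by rewrite /e addrC subrK.
  by rewrite /hd; field.
rewrite -[`|_|]/(normc _)%:C lecR.
have e1 : normc e <= C by rewrite (le_trans h)// ler_pdivrMr; [nra|lra].
have e2 : normc a * normc e <= C by move: h; rewrite ler_pdivlMr 1?mulrC//; lra.
rewrite (le_trans (normcB _ _))// [normc (2 * _)]normcM [normc (a * e)]normcM normc_nat.
rewrite normcX.
have e3 : normc (hd + e) ^+ 2 <= (normc hd + C) ^+ 2.
  apply: lerXn2r; rewrite ?nnegrE ?normc_ge0 ?addr_ge0 ?normc_ge0//.
  by rewrite (le_trans (normcD _ _))// lerD2l.
lra.
Qed.

(** Equal eigenvalues force [zj = zk], since both have positive real part. The Robin condition then
    gives [berr = hd - a - z] for both degrees, so the two expansions of [berr] differ only by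
    [O(|z|^-2)], although their [1 / z] coefficients are distinct; this bounds [|z|]. *)
Lemma curve_spec_distinct j k Cj rj zj Ck rk zk :
  curve_spec j (Cj, rj, zj) -> curve_spec k (Ck, rk, zk) -> j != k ->
  \forall a \near sector_infty phi, - zj a ^+ 2 != - zk a ^+ 2.
Proof.
move=> [Cj0 [rj1 [Hj _]]] [Ck0 [rk1 [Hk _]]] jk.
pose D : R := `|kap (bidx d j) - kap (bidx d k)|.
have D0 : 0 < D by rewrite normr_gt0 subr_eq0 kap_bidx_inj.
(* A common root would satisfy [|z| <= (Cj + Ck) / D], while [|a| / 2 <= |z|]. *)
exists (rj + rk + 2 * ((Cj + Ck) / D)) => a /sec sa ra.
have CD : 0 <= (Cj + Ck) / D by rewrite divr_ge0 ?addr_ge0// ltW.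
have raj : rj <= normc a by lra.
have rak : rk <= normc a by lra.
have [[uj _] ej nj _ aj] := Hj a raj sa.
have [[uk _] ek _ _ ak] := Hk a rak sa.
apply/negP => /eqP /oppr_inj /eqP; rewrite -subr_eq0 subr_sqr mulf_eq0 => /orP[|]; last first.
  rewrite addr_eq0 => /eqP E; move: uj; rewrite E ReN; lra.
rewrite subr_eq0 => /eqP E; rewrite -E in uk ek ak.
have Eb : berr (bidx d j) (zj a) = berr (bidx d k) (zj a).
  have Eb l : l%:R + bq (bidx d l) (zj a) + a = 0 ->
      berr (bidx d l) (zj a) = hd - a - zj a.
    rewrite /berr /hd -(bidxE l d2); move: (bq _ _) => q qE.
    have -> : q = - a - l%:R by apply/eqP; rewrite -subr_eq0 -[X in _ == X]qE; apply/eqP; ring.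
    by ring.
  by rewrite !Eb// E.
have z0 : 0 < normc (zj a) by lra.
have h1 : D / normc (zj a) <= (Cj + Ck) / normc (zj a) ^+ 2.
  have -> : D / normc (zj a) =
      normc ((kap (bidx d j))%:C / zj a - (kap (bidx d k))%:C / zj a).
    by rewrite -mulrBl -RCN -RCD normcM normcR normcV.
  rewrite mulrDl; apply: (le_trans _ (lerD aj ak)).
  rewrite Eb [leRHS]addrC.
  move: (berr _ _) ((kap (bidx d j))%:C / zj a) ((kap (bidx d k))%:C / zj a) => b X Y.
  by rewrite (_ : X - Y = (b - Y) - (b - X)) ?normcB//; ring.
have h2 : D * normc (zj a) <= Cj + Ck.
  move: h1; rewrite ler_pdivrMr// expr2 invfM mulrA mulfVK ?gt_eqF// ler_pdivlMr//.
have h3 : normc (zj a) <= (Cj + Ck) / D by rewrite ler_pdivlMr// mulrC.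
lra.
Qed.

End eigenvalue_curves.


Theorem theorem9p9 (R : realType) (d : nat) (phi : R) :
  (2 <= d)%N -> 0 < phi -> phi < pi / 2 ->
  exists lambda : nat -> R[i] -> R[i],
    (forall k,
      [/\ \forall alpha \near sector_infty phi,
            robin_eigenvalue (@unit_ball R d) (@unit_sphere R d)
              (@sphere_measure R d) alpha (lambda k alpha),
          \forall alpha \near sector_infty phi,
            {for alpha, continuous (lambda k)} &
          (fun alpha => lambda k alpha
             - (- alpha ^+ 2 + alpha * (d%:R - 1)))
            =O_ (sector_infty phi) (fun=> 1 : R[i])]) /\
    (forall j k, j != k ->
      \forall alpha \near sector_infty phi, lambda j alpha != lambda k alpha).
Proof.
case: d => [|[|m]] // _ phi0 phi2.
have /boolp.choice[t tP] l : exists t, curve_spec m phi l t.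
  have c0 : 0 < cos phi / 2.
    rewrite divr_gt0// cos_gt0_pihalf// phi2 andbT.
    by apply: lt_trans phi0; rewrite oppr_lt0 divr_gt0// pi_gt0.
  have [C [C0 [rho [rho1 [zz [H1 H2]]]]]] := @spectral_curve R m.+2 l isT _ c0.
  by exists (C, rho, zz).
have {}tP l : curve_spec m phi l ((t l).1.1, (t l).1.2, (t l).2).
  by have := tP l; case: (t l) => -[].
exists (fun l a => - (t l).2 a ^+ 2); split => [k|j k jk].
  split.
  - exact: curve_spec_eigenvalue phi0 phi2 _ _ _ _ (tP k).
  - exact: curve_spec_continuous phi0 phi2 _ _ _ _ (tP k).
  - exact: curve_spec_asymptotics phi0 phi2 _ _ _ _ (tP k).
exact: curve_spec_distinct phi0 phi2 _ _ _ _ _ _ _ _ (tP j) (tP k) jk.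
Qed.
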